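(* Let $p=3$ and $\tau=\overline{\sigma}_4$, where $\sigma_4=e^{2\pi i/7}+e^{4\pi i/7}+e^{8\pi i/7}$. Then the group $\Gamma\left(\frac{2\pi}{3},\overline{\sigma}_4\right)$ is a cocompact arithmetic lattice in $\mathrm{SU}(2,1)$ (where $\mathrm{SU}(2,1)$ is identified with $\mathrm{SU}(H_\tau)$).
   Context: For an integer $p\ge 2$ put $\psi=2\pi/p$, and for $\tau\in\mathbb{C}$ let $$J=\begin{pmatrix}0&0&1\\1&0&0\\0&1&0\end{pmatrix},\qquad R_1=\begin{pmatrix}e^{2i\psi/3}&\tau&-e^{i\psi/3}\overline{\tau}\\0&e^{-i\psi/3}&0\\0&0&e^{-i\psi/3}\end{pmatrix},$$ $$H_\tau=\begin{pmatrix}2\sin(\psi/2)&-ie^{-i\psi/6}\tau&ie^{i\psi/6}\overline{\tau}\\ ie^{i\psi/6}\overline{\tau}&2\sin(\psi/2)&-ie^{-i\psi/6}\tau\\-ie^{-i\psi/6}\tau&ie^{i\psi/6}\overline{\tau}&2\sin(\psi/2)\end{pmatrix}.$$ Both $R_1$ and $J$ preserve the Hermitian form $\langle \mathbf z,\mathbf w\rangle=\mathbf w^*H_\tau\mathbf z$. The group $\Gamma(2\pi/p,\tau)$ is the group generated by $R_1$ and $J$. When $H_\tau$ has signature $(2,1)$ (as is the case here), $\Gamma(2\pi/p,\tau)\subset \mathrm{SU}(H_\tau)\cong \mathrm{SU}(2,1)$. A lattice in $G$ is a discrete subgroup with finite covolume; it is cocompact if the quotient of $G$ by it is compact. A subgroup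 $\Gamma$ of a semisimple Lie group $G$ is an arithmetic lattice in $G$ if there exist an algebraic group $S$ defined over $\mathbb{Q}$ and a continuous homomorphism $\phi:S(\mathbb{R})^0\to G$ with compact kernel such that $\Gamma$ is commensurable to $\phi(S(\mathbb{Z})\cap S(\mathbb{R})^0)$. *)

(* Defs.v *)
From HB Require Import structures.
From mathcomp Require Import all_boot all_order all_algebra.
From mathcomp Require Import all_classical all_reals all_analysis.
From mathcomp Require Import complex.
From mathcomp Require Import -(notations) mpoly.
Set Implicit Arguments.
Unset Strict Implicit.
Unset Printing Implicit Defensive.
Import Order.TTheory GRing.Theory Num.Theory.
Import numFieldNormedType.Exports.

Local Open Scope classical_set_scope.
Local Open Scope sesquilinear_scope.
Local Open Scope ring_scope.

(* R[i] itself carries no canonical topology; packaged as a numClosedFieldType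
   it gets the usual one, and so do the matrices over it. *)
Definition Cplx (R : realType) : numClosedFieldType := R[i].

Section MatrixGroups.
Context {F : fieldType} {n : nat}.

Definition mx_group (G : set 'M[F]_n) : Prop :=
  [/\ G 1%:M,
      forall x y, G x -> G y -> G (x *m y),
      forall x, G x -> x \in unitmx
    & forall x, G x -> G (invmx x)].

Record mxgroup := MxGroup {
  mxgroup_set :> set 'M[F]_n;
  mxgroupP : mx_group mxgroup_set }.

Lemma smallest_mx_group (A : set 'M[F]_n) :
  A `<=` [set x | x \in unitmx] -> mx_group (smallest mx_group A).
Proof.
move=> AU; split.
- by move=> H [[]].
- move=> x y xA yA H HA; have [[_ HM _ _] _] := HA.
  by apply: HM; [exact: xA|exact: yA].
- move=> x xA; apply: (xA [set y | y \in unitmx]); split => //; split => /=.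
  + exact: unitmx1.
  + by move=> y z yU zU; rewrite unitmx_mul yU.
  + by [].
  + by move=> y; rewrite unitmx_inv.
- move=> x xA H HA; have [[_ _ _ HV] _] := HA.
  by apply: HV; exact: xA.
Qed.

Definition generated (A : set 'M[F]_n) (AU : A `<=` [set x | x \in unitmx]) :
  mxgroup := MxGroup (smallest_mx_group AU).

Definition finite_index (B A : set 'M[F]_n) : Prop :=
  finite_set [set [set a *m b | b in B] | a in A].

Definition commensurable (A B : set 'M[F]_n) : Prop :=
  finite_index (A `&` B) A /\ finite_index (A `&` B) B.

End MatrixGroups.
Arguments mxgroup : clear implicits.

Section BorelSets.
Context {R : realType} {n : nat}.

Definition borel (G : mxgroup (Cplx R) n) : Type := G.

Variable G : mxgroup (Cplx R) n.

Lemma mxgroup1 : 1%:M \in (G : set _).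
Proof. by apply/mem_set; have [] := mxgroupP G. Qed.

Lemma borelC (A : set G) : <<s @open G >> A -> <<s @open G >> (~` A).
Proof. by move=> sA; rewrite -setTD; exact: sigma_algebraCD. Qed.

HB.instance Definition _ := Choice.copy (borel G) (set_type G).
HB.instance Definition _ := isPointed.Build (borel G) (exist _ 1%:M mxgroup1).
HB.instance Definition _ := @isMeasurable.Build (sigma_display (@open G))
  (borel G) <<s @open G >> (@sigma_algebra0 _ setT (@open G)) borelC
  (@sigma_algebra_bigcup _ setT (@open G)).

End BorelSets.

Section Lattices.
Context {R : realType} {n : nat}.
Local Notation C := (Cplx R).
Implicit Types G Gam : mxgroup C n.

Definition discrete_subgroup Gam : Prop := Gam `<=` isolated Gam.

Definition same_orbit G Gam (x y : G) : Prop :=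
  exists2 g, (Gam : set _) g & \val x = g *m \val y.

Definition orbit_rel G Gam : rel G := fun x y => `[< same_orbit Gam x y >].

Lemma orbit_relP G Gam : equiv_class_of (@orbit_rel G Gam).
Proof.
have [G1 GM GU GV] := mxgroupP Gam; split.
- by move=> x; apply/asboolP; exists 1%:M; rewrite ?mul1mx.
- suff sym x y : @orbit_rel G Gam x y -> orbit_rel Gam y x.
    by move=> x y; apply/idP/idP; exact: sym.
  move=> /asboolP[g Gg xE]; apply/asboolP; exists (invmx g); first exact: GV.
  by rewrite xE mulKmx// GU.
- move=> y x z /asboolP[g Gg xE] /asboolP[h Gh yE]; apply/asboolP.
  by exists (g *m h); [exact: GM|rewrite xE yE mulmxA].
Qed.

(* Gam \ G, with the quotient of the subspace topology of G. *)
Definition coset_space G Gam : topologicalType :=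
  quotient_topology {eq_quot EquivRelPack (@orbit_relP G Gam)}%qT.

Definition cocompact G Gam : Prop := compact [set: coset_space G Gam].

Definition left_translate G (g : 'M[C]_n) (A : set G) : set G :=
  [set y | exists2 x, A x & \val y = g *m \val x].

(* No regularity condition is needed: closed matrix groups are locally compact
   and second countable. *)
Definition haar_measure G (mu : {measure set (borel G) -> \bar R}) : Prop :=
  [/\ forall K : set G, compact K -> (mu K < +oo)%E,
      forall (g : 'M[C]_n) (A : set (borel G)), (G : set _) g ->
        measurable A -> mu (left_translate g A) = mu A
    & mu [set: borel G] <> 0%E].

Definition fundamental_domain G Gam (D : set (borel G)) : Prop :=
  measurable D /\ forall x : G, exists! y : G, D y /\ same_orbit Gam x y.

(* Haar measure exists and is unique up to scaling, so quantifying over all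
   Haar measures is the same as fixing one. *)
Definition finite_covolume G Gam : Prop :=
  forall mu : {measure set (borel G) -> \bar R}, haar_measure mu ->
    exists2 D, fundamental_domain Gam D & (mu D < +oo)%E.

Definition lattice G Gam : Prop :=
  [/\ Gam `<=` G, discrete_subgroup Gam & finite_covolume G Gam].

End Lattices.

Section Arithmetic.

(* A linear algebraic group over Q is given by finitely many polynomials with
   rational coefficients in the m * m matrix entries (enumerated by mxvec), whose
   complex zeros in GL_m form a group. *)
Definition points m (S : seq (mpoly (m * m) rat)) (F : fieldType) :
    set 'M[F]_m :=
  [set x | x \in unitmx /\
    forall P, P \in S -> mmap ratr (fun k => mxvec x 0 k) P = 0].
Arguments points {m} S F.

Definition algebraic_group (R : realType) m
    (S : seq (mpoly (m * m) rat)) : Prop :=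
  mx_group (points S (Cplx R)).

Definition integral_points (R : realType) m
    (S : seq (mpoly (m * m) rat)) : set 'M[R]_m :=
  points S R `&` [set map_mx intr x | x in [set x : 'M[int]_m | x \in unitmx]].

Definition identity_component (R : realType) m
    (S : seq (mpoly (m * m) rat)) : set 'M[R]_m :=
  connected_component (points S R) 1%:M.

Arguments algebraic_group R {m} S.
Arguments integral_points R {m} S.
Arguments identity_component R {m} S.

Definition arithmetic_subgroup (R : realType) n (G Gam : mxgroup (Cplx R) n) : Prop :=
  exists (m : nat) (S : seq (mpoly (m * m) rat))
         (phi : 'M[R]_m -> 'M[Cplx R]_n),
    let S0 := identity_component R S in
    [/\ algebraic_group R S,
        {within S0, continuous phi},
        (forall x, S0 x -> (G : set _) (phi x)) /\
          (forall x y, S0 x -> S0 y -> phi (x *m y) = phi x *m phi y),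
        compact (S0 `&` [set x | phi x = 1%:M])
      & commensurable Gam (phi @` (integral_points R S `&` S0))].

Definition cocompact_arithmetic_lattice (R : realType) n
    (G Gam : mxgroup (Cplx R) n) : Prop :=
  [/\ lattice G Gam, cocompact G Gam & arithmetic_subgroup G Gam].

End Arithmetic.

Section Hermitian.
Context {R : realType}.
Local Notation C := (Cplx R).

Definition has_signature (p q : nat) (H : 'M[C]_(p + q)) : Prop :=
  exists2 P : 'M[C]_(p + q), P \in unitmx &
    P ^t* *m H *m P = block_mx 1%:M 0 0 (- 1%:M).

Definition SU_set n (H : 'M[C]_n) : set 'M[C]_n :=
  [set g | g ^t* *m H *m g = H /\ \det g = 1].

Lemma SU_group n (H : 'M[C]_n) : mx_group (SU_set H).
Proof.
have U (x : 'M[C]_n) : \det x = 1 -> x \in unitmx.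
  by move=> dx; rewrite unitmxE dx unitr1.
have tM (x y : 'M[C]_n) : (x *m y) ^t* = y ^t* *m x ^t*.
  by rewrite trmx_mul map_mxM.
have t1 : (1%:M : 'M[C]_n) ^t* = 1%:M by rewrite trmx1 map_mx1.
split.
- by rewrite /SU_set /= t1 mul1mx mulmx1 det1.
- move=> x y [xH dx] [yH dy]; split; last by rewrite det_mulmx dx dy mul1r.
  by rewrite tM !mulmxA -(mulmxA _ _ H) -(mulmxA _ _ x) xH.
- by move=> x [_ /U].
- move=> x [xH dx]; split; last by rewrite det_inv dx invr1.
  rewrite -{1}xH !mulmxA -tM mulmxV ?U// t1 mul1mx -mulmxA mulmxV ?U//.
  by rewrite mulmx1.
Qed.

Definition SU n (H : 'M[C]_n) : mxgroup C n := MxGroup (SU_group H).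

End Hermitian.

Section TriangleGroups.
Context {R : realType}.
Local Notation C := (Cplx R).

Definition expi (t : R) : C := (cos t +i* sin t)%C.

Definition mx33 (s : seq (seq C)) : 'M[C]_3 :=
  \matrix_(i < 3, j < 3) nth 0 (nth [::] s i) j.

Definition Jmx : 'M[C]_3 :=
  mx33 [:: [:: 0; 0; 1];
           [:: 1; 0; 0];
           [:: 0; 1; 0] ].

Definition R1mx (psi : R) (tau : C) : 'M[C]_3 :=
  mx33 [:: [:: expi (2 * psi / 3); tau; - (expi (psi / 3) * tau^*)];
           [:: 0; expi (- (psi / 3)); 0];
           [:: 0; 0; expi (- (psi / 3))] ].

Definition Hmx (psi : R) (tau : C) : 'M[C]_3 :=
  let a : C := (2 * sin (psi / 2))%:C%C in
  let b : C := - ('i%C * expi (- (psi / 6)) * tau) in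
  let c : C := 'i%C * expi (psi / 6) * tau^* in
  mx33 [:: [:: a; b; c];
           [:: c; a; b];
           [:: b; c; a] ].

Lemma expi_neq0 t : expi t != 0.
Proof.
apply/eqP => -[ct st]; have := cos2Dsin2 t.
by rewrite ct st expr0n addr0 => /eqP; rewrite eq_sym oner_eq0.
Qed.

Lemma generators_unit psi tau :
  [set R1mx psi tau; Jmx] `<=` [set x | x \in unitmx].
Proof.
move=> x /= [->|->].
- rewrite -unitmx_tr unitmxE det_trig; last first.
    by apply/is_trig_mxP => -[[|[|[|i]]] ?] [[|[|[|j]]] ?]; rewrite !mxE.
  rewrite !big_ord_recl big_ord0 !mxE/= unitfE.
  by rewrite !mulf_neq0 ?expi_neq0 ?oner_neq0.
- suff /mulmx1_unit[] : Jmx *m Jmx^T = 1%:M by [].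
  apply/matrixP => -[[|[|[|i]]] ?] [[|[|[|j]]] ?] //;
  rewrite !mxE !big_ord_recl big_ord0 !mxE/=;
  by rewrite ?(mulr0, mul0r, mulr1, addr0, add0r).
Qed.

Definition triangle_group (psi : R) (tau : C) : mxgroup C 3 :=
  generated (@generators_unit psi tau).

Definition sigma4 : C :=
  expi (2 * pi / 7) + expi (4 * pi / 7) + expi (8 * pi / 7).

End TriangleGroups.

(* Main.v *)
(* Conjugated by D = diag(1, u, u^2), u = - exp(i pi / 9), and divided by powers of u
   (u^9 = 1), the generators R_1 and J have entries in the ring of integers O of
   Q(sqrt(-3), sqrt(-7)), and they preserve a Hermitian form h over O.  Under the
   given embedding h has signature (2,1), under the other one (sigma4 in place of
   its conjugate) it is definite, so that the special unitary group of h, with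
   scalars restricted to Q, is SU(2,1) x SU(3) over the reals, with compact second
   factor.  Both generators are joined to the identity by one-parameter groups, so
   up to the nine powers of u the triangle group lies in the arithmetic subgroup.

   Finite index and cocompactness come from a descent.  Let x0 = (1,1,1), a negative
   eigenvector of the circulant matrix H, and N(g) = |x0^* g x0|^2, a proper function
   on SU(H).  In the coordinates v_k = y_k / y_0 of g x0 along the eigenvectors of H
   the condition N(g) >= 900 says that v lies in a thin shell inside the unit ball
   of the complex hyperbolic plane, and a covering of this shell, verified in
   integer arithmetic, shows that one of twelve words c in the generators satisfies
   N(c g) <= 99/100 N(g).  Hence SU(H) is the product of the triangle group and the
   compact set N <= 900.  Only finitely many elements of the arithmetic group lie in
   this compact set, by definiteness of h at the second embedding; this gives
   discreteness and finite index. *)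
Require Import Defs.
From HB Require Import structures.
From Stdlib Require Import ZArith.
From mathcomp Require Import all_boot all_order all_algebra.
From mathcomp Require Import all_classical all_reals all_analysis.
From mathcomp Require Import finmap ring lra zify ssrZ complex.
From mathcomp Require Import -(notations) mpoly.
Set Implicit Arguments.
Unset Strict Implicit.
Unset Printing Implicit Defensive.
Import Order.TTheory GRing.Theory Num.Theory.
Import numFieldNormedType.Exports.
Local Open Scope classical_set_scope.
Local Open Scope sesquilinear_scope.
Local Open Scope ring_scope.
Delimit Scope Z_scope with ZZ.

(** * The ring of integers of Q(sqrt(-3), sqrt(-7)) and the algebraic group *)

(** Containment in an arithmetic group is algebra; the obstacle is that such a subgroup could have
    infinite index there. Only the descent excludes this, and it also gives finite covolume and
    cocompactness. It becomes a finite check because N(c g) / N(g) depends only on v: it is one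
    ninth of the squared modulus of a row of the word c at (1, v1, v2). The form takes the same
    value at g x0 as at x0, so |y_0|^2 = n puts v on an ellipsoid of level 1 - 1/n, and N = 9 n >=
    900 means a level of at least 99/100. The contraction factor 99/100 leaves room for rounding.
    The entries of R_1 involve ninth roots of unity, which together with sqrt(-7) generate a field
    of degree 12; conjugation by D and removal of powers of u lower the degree to 4, where only two
    unitary factors remain. Membership in the identity component is shown by explicit paths, so that
    connectedness of the unitary groups never has to be settled. *)

(* quad q K is K[x] / (x^2 + x + q), with basis 1, x. *)
Record quad (q : nat) (K : Type) := Quad { qre : K; qim : K }.
Arguments Quad {q K}.
Arguments qre {q K} x : rename.
Arguments qim {q K} x : rename.

Section Quad.
Context {q : nat} {K : comNzRingType}.
Implicit Types x y : quad q K.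

Definition quad_pair x := (qre x, qim x).
Definition pair_quad (p : K * K) : quad q K := Quad p.1 p.2.
Lemma quad_pairK : cancel quad_pair pair_quad. Proof. by case. Qed.
HB.instance Definition _ := Choice.copy (quad q K) (can_type quad_pairK).

Lemma quadP x y : qre x = qre y -> qim x = qim y -> x = y.
Proof. by case: x y => [? ?] [? ?] /= -> ->. Qed.

Definition quad_add x y : quad q K := Quad (qre x + qre y) (qim x + qim y).
Definition quad_opp x : quad q K := Quad (- qre x) (- qim x).
Definition quad_mul x y : quad q K :=
  Quad (qre x * qre y - q%:R * (qim x * qim y))
       (qre x * qim y + qim x * qre y - qim x * qim y).

Fact quad_addA : associative quad_add.
Proof. by move=> *; apply: quadP; exact: addrA. Qed.
Fact quad_addC : commutative quad_add.
Proof. by move=> *; apply: quadP; exact: addrC. Qed.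
Fact quad_add0 : left_id (Quad 0 0) quad_add.
Proof. by move=> *; apply: quadP; exact: add0r. Qed.
Fact quad_addN : left_inverse (Quad 0 0) quad_opp quad_add.
Proof. by move=> *; apply: quadP; exact: addNr. Qed.
HB.instance Definition _ :=
  GRing.isZmodule.Build (quad q K) quad_addA quad_addC quad_add0 quad_addN.

Fact quad_mulA : associative quad_mul.
Proof.
by move=> x y z; apply: quadP; rewrite /=; ring.
Qed.
Fact quad_mulC : commutative quad_mul.
Proof. by move=> x y; apply: quadP; rewrite /=; ring. Qed.
Fact quad_mul1 : left_id (Quad 1 0) quad_mul.
Proof. by move=> x; apply: quadP; rewrite /=; ring. Qed.
Fact quad_mulDl : left_distributive quad_mul +%R.
Proof. by move=> x y z; apply: quadP; rewrite /=; ring. Qed.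
Fact quad_1neq0 : (Quad 1 0 : quad q K) != 0.
Proof. by apply/eqP => -[/eqP]; rewrite oner_eq0. Qed.
HB.instance Definition _ := GRing.Zmodule_isComNzRing.Build (quad q K)
  quad_mulA quad_mulC quad_mul1 quad_mulDl quad_1neq0.

Fact qre_is_zmod : zmod_morphism (@qre q K). Proof. by []. Qed.
Fact qim_is_zmod : zmod_morphism (@qim q K). Proof. by []. Qed.
HB.instance Definition _ := GRing.isZmodMorphism.Build _ _ _ qre_is_zmod.
HB.instance Definition _ := GRing.isZmodMorphism.Build _ _ _ qim_is_zmod.

End Quad.

Section QuadMorphisms.
Context {q : nat} {K L : comNzRingType} (f : {rmorphism K -> L}).

Definition qmap (x : quad q K) : quad q L := Quad (f (qre x)) (f (qim x)).
Fact qmap_is_zmod : zmod_morphism qmap.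
Proof. by move=> x y; apply: quadP; rewrite /= rmorphB. Qed.
Fact qmap_is_monoid : monoid_morphism qmap.
Proof.
split; first by apply: quadP; rewrite /= ?rmorph1 ?rmorph0.
by move=> x y; apply: quadP; rewrite /= !(rmorphB, rmorphD, rmorphM, rmorph_nat).
Qed.
HB.instance Definition _ := GRing.isZmodMorphism.Build _ _ _ qmap_is_zmod.
HB.instance Definition _ := GRing.isMonoidMorphism.Build _ _ _ qmap_is_monoid.

Definition root_of (t : L) := t ^+ 2 + t + q%:R == 0.
(** The proof that t is a root is an argument because only then is the evaluation multiplicative;
    this lets [qev rt] carry the ring morphism structure. *)
Definition qev (t : L) of root_of t := fun x : quad q K => f (qre x) + f (qim x) * t.
Variables (t : L) (rt : root_of t).
Fact qev_is_zmod : zmod_morphism (qev rt).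
Proof. by move=> x y; rewrite /qev !raddfB /=; ring. Qed.
Fact qev_is_monoid : monoid_morphism (qev rt).
Proof.
split; first by rewrite /qev rmorph1 rmorph0 mul0r addr0.
move=> x y; rewrite /qev /= !(rmorphB, rmorphD, rmorphM, rmorph_nat).
have /eqP t2 : t ^+ 2 == - t - q%:R.
  by rewrite -subr_eq0 opprD !opprK addrA.
transitivity (f (qre x) * f (qre y) + (f (qre x) * f (qim y) + f (qim x) * f (qre y)) * t
   + f (qim x) * f (qim y) * t ^+ 2); last by ring.
by rewrite t2; ring.
Qed.
HB.instance Definition _ := GRing.isZmodMorphism.Build _ _ _ qev_is_zmod.
HB.instance Definition _ := GRing.isMonoidMorphism.Build _ _ _ qev_is_monoid.
End QuadMorphisms.

Section QuadConj.
Context {q : nat} {K : comNzRingType} (c : {rmorphism K -> K}).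
(** The root x is sent to the other root -1 - x, while [c] acts on the coefficients. *)
Definition qconj (x : quad q K) : quad q K :=
  Quad (c (qre x) - c (qim x)) (- c (qim x)).
Fact qconj_is_zmod : zmod_morphism qconj.
Proof. by move=> x y; apply: quadP; rewrite /= !rmorphB; ring. Qed.
Fact qconj_is_monoid : monoid_morphism qconj.
Proof.
split; first by apply: quadP; rewrite /= ?rmorph1 ?rmorph0 ?subr0 ?oppr0.
move=> x y; apply: quadP;
  rewrite /= !(rmorphB, rmorphD, rmorphM, rmorph_nat); ring.
Qed.
HB.instance Definition _ := GRing.isZmodMorphism.Build _ _ _ qconj_is_zmod.
HB.instance Definition _ := GRing.isMonoidMorphism.Build _ _ _ qconj_is_monoid.
End QuadConj.

(* Restriction of scalars: a + b x acts as [[a, - q b], [b, a - b]], blockwise. *)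
Section Restriction.
Context {q : nat} {K : comNzRingType} {n : nat}.

Definition res_mx (Y : 'M[quad q K]_n) : 'M[K]_(n + n) :=
  let Y0 := map_mx qre Y in let Y1 := map_mx qim Y in
  block_mx Y0 (- (q%:R *: Y1)) Y1 (Y0 - Y1).

(** The first block column determines a restricted matrix, so X is in the image of [res_mx] exactly
    when [X = res_mx (unres_mx X)]. *)
Definition unres_mx (X : 'M[K]_(n + n)) : 'M[quad q K]_n :=
  \matrix_(i, j) Quad (ulsubmx X i j) (dlsubmx X i j).

Lemma res_mxK : cancel res_mx unres_mx.
Proof.
move=> Y; apply/matrixP => i j; rewrite mxE block_mxKul block_mxKdl.
by apply: quadP; rewrite /= mxE.
Qed.

Lemma res_mxM Y Z : res_mx (Y *m Z) = res_mx Y *m res_mx Z.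
Proof.
have re : map_mx qre (Y *m Z) = map_mx qre Y *m map_mx qre Z
    - q%:R *: (map_mx qim Y *m map_mx qim Z).
  apply/matrixP => i j; rewrite !mxE raddf_sum mulr_sumr -sumrB.
  by apply: eq_bigr => k _; rewrite !mxE.
have im : map_mx qim (Y *m Z) = map_mx qre Y *m map_mx qim Z
    + map_mx qim Y *m map_mx qre Z - (map_mx qim Y *m map_mx qim Z).
  apply/matrixP => i j; rewrite !mxE raddf_sum -big_split -sumrB /=.
  by apply: eq_bigr => k _; rewrite !mxE.
rewrite /res_mx mulmx_block re im.
move: (map_mx qre Y) (map_mx qim Y) (map_mx qre Z) (map_mx qim Z) => a b c d.
have l (u v : 'M[K]_n) : (q%:R *: u) *m v = q%:R *: (u *m v) by rewrite scalemxAl.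
have r (u v : 'M[K]_n) : u *m (q%:R *: v) = q%:R *: (u *m v) by rewrite scalemxAr.
rewrite !(mulmxBl, mulmxBr, mulmxN, mulNmx, l, r, scalerBr, scalerDr).
move: (a *m c) (a *m d) (b *m c) (b *m d) => ac ad bc bd.
by congr block_mx; apply/matrixP => i j; rewrite !mxE; ring.
Qed.

Lemma res_mx1 : res_mx 1%:M = 1%:M.
Proof.
have re : map_mx (@qre q K) 1%:M = 1%:M :> 'M[K]_n.
  by apply/matrixP => i j; rewrite !mxE; case: eqP.
have im : map_mx (@qim q K) 1%:M = 0 :> 'M[K]_n.
  by apply/matrixP => i j; rewrite !mxE; case: eqP.
by rewrite /res_mx re im scaler0 oppr0 addr0 -scalar_mx_block.
Qed.

End Restriction.

Section RestrictionMap.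
Context {q : nat} {K L : comNzRingType} {n : nat} (f : {rmorphism K -> L}).

Lemma map_res_mx (Y : 'M[quad q K]_n) :
  map_mx f (res_mx Y) = res_mx (map_mx (qmap f) Y).
Proof.
rewrite /res_mx map_block_mx !(map_mxB, map_mxN) map_mxZ rmorph_nat.
by congr block_mx; apply/matrixP => i j; rewrite !mxE.
Qed.

Lemma map_unres_mx (X : 'M[K]_(n + n)) :
  map_mx (qmap f) (unres_mx X) = unres_mx (map_mx f X) :> 'M[quad q L]_n.
Proof. by apply/matrixP => i j; rewrite !mxE. Qed.

End RestrictionMap.

Definition mat3 (T : nmodType) (s : seq (seq T)) : 'M[T]_3 :=
  \matrix_(i < 3, j < 3) nth 0 (nth [::] s i) j.

Lemma mat3P (T : nmodType) (M N : 'M[T]_3) :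
  (forall i j : 'I_3, M i j = N i j) -> M = N.
Proof. by move=> h; apply/matrixP. Qed.

Section SpecialUnitary.
Context {A : comNzRingType} (c : {rmorphism A -> A}) {n : nat}.
Implicit Types Y Z h : 'M[A]_n.

Definition adj Y : 'M[A]_n := (map_mx c Y)^T.

Definition special_unitary h Y : Prop := adj Y *m h *m Y = h /\ \det Y = 1.

Lemma adjM Y Z : adj (Y *m Z) = adj Z *m adj Y.
Proof. by rewrite /adj map_mxM trmx_mul. Qed.

Lemma adj1 : adj 1%:M = 1%:M.
Proof. by rewrite /adj map_mx1 trmx1. Qed.

Lemma special_unitary1 h : special_unitary h 1%:M.
Proof. by rewrite /special_unitary adj1 mul1mx mulmx1 det1. Qed.

Lemma special_unitaryM h Y Z :
  special_unitary h Y -> special_unitary h Z -> special_unitary h (Y *m Z).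
Proof.
move=> [Yh dY] [Zh dZ]; split; last by rewrite det_mulmx dY dZ mulr1.
by rewrite adjM -!mulmxA (mulmxA h) (mulmxA (adj Y)) (mulmxA (adj Y)) Yh mulmxA.
Qed.

Lemma special_unitaryV h Y Z :
  Y *m Z = 1%:M -> special_unitary h Y -> special_unitary h Z.
Proof.
move=> YZ [Yh dY]; split; last first.
  by have := congr1 determinant YZ; rewrite det_mulmx dY mul1r det1.
by rewrite -{1}Yh !mulmxA -adjM YZ adj1 mul1mx -mulmxA YZ mulmx1.
Qed.

Lemma special_unitary_inv h Y : special_unitary h Y -> Y *m \adj Y = 1%:M.
Proof. by move=> [_ dY]; rewrite mul_mx_adj dY. Qed.

End SpecialUnitary.

(* E K is K[w, s] with w^2 + w + 1 = 0 and s^2 + s + 2 = 0; E int is the ring of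
   integers of Q(sqrt(-3), sqrt(-7)), and the complex conjugation of every
   embedding is [econj]. *)
Definition E (K : comNzRingType) : comNzRingType := quad 2 (quad 1 K).

Fact res_key : unit. Proof. exact: tt. Qed.

Section ERing.
Context (K : comNzRingType).
Definition econj : {rmorphism E K -> E K} := qconj (qconj idfun).
Definition ew : E K := Quad (Quad 0 1) 0.
Definition es : E K := Quad 0 1.

Lemma econjE a b c d : econj (Quad (Quad a b) (Quad c d)) =
  Quad (Quad (a - b - (c - d)) (d - b)) (Quad (d - c) d).
Proof. by apply: quadP; apply: quadP; rewrite /= /idfun /=; ring. Qed.

(** Up to conjugation by D, this is sqrt 3 times the form H_tau: th is sqrt(-3), and the factor sqrt
    3 makes the entries integral. *)
Definition eherm : 'M[E K]_3 :=
  let th := 1 + 2 * ew in let s' := econj es in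
  mat3 [:: [:: 3; th * es; - (th * ew ^+ 2 * s')];
           [:: - (th * s'); 3; th * es];
           [:: th * ew * es; - (th * s'); 3] ].

Definition eSU : 'M[E K]_3 -> Prop := special_unitary econj eherm.

(* Locked: unification must not unfold these 12 x 12 matrices. *)
Definition resE (Y : 'M[E K]_3) : 'M[K]_((3 + 3) + (3 + 3)) :=
  locked_with res_key (res_mx (res_mx Y)).
Definition unresE (X : 'M[K]_((3 + 3) + (3 + 3))) : 'M[E K]_3 :=
  locked_with res_key (unres_mx (unres_mx X)).

Lemma resE_unlock Y : resE Y = res_mx (res_mx Y).
Proof. by rewrite /resE unlock. Qed.
Lemma unresE_unlock X : unresE X = unres_mx (unres_mx X).
Proof. by rewrite /unresE unlock. Qed.

Lemma resEK : cancel resE unresE.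
Proof. by move=> Y; rewrite resE_unlock unresE_unlock !res_mxK. Qed.
Lemma resEM Y Z : resE (Y *m Z) = resE Y *m resE Z.
Proof. by rewrite !resE_unlock !res_mxM. Qed.
Lemma resE1 : resE 1%:M = 1%:M.
Proof. by rewrite !resE_unlock !res_mx1. Qed.

Lemma eSU1 : eSU 1%:M.
Proof. exact: (@special_unitary1 (E K) econj 3 eherm). Qed.
Lemma eSUM Y Z : eSU Y -> eSU Z -> eSU (Y *m Z).
Proof. exact: (@special_unitaryM (E K) econj 3 eherm Y Z). Qed.
Lemma eSUV Y Z : Y *m Z = 1%:M -> eSU Y -> eSU Z.
Proof. exact: (@special_unitaryV (E K) econj 3 eherm Y Z). Qed.
Lemma eSU_inv Y : eSU Y -> Y *m \adj Y = 1%:M.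
Proof. exact: (@special_unitary_inv (E K) econj 3 eherm Y). Qed.

Lemma resE_closedM (X X' : 'M[_]_((3 + 3) + (3 + 3))) :
  X = resE (unresE X) -> X' = resE (unresE X') ->
  X *m X' = resE (unresE X *m unresE X').
Proof. by move=> hX hX'; rewrite resEM -hX -hX'. Qed.
Lemma resE_closed (X X' : 'M[_]_((3 + 3) + (3 + 3))) :
  X = resE (unresE X) -> X' = resE (unresE X') ->
  X *m X' = resE (unresE (X *m X')).
Proof.
by move=> hX hX'; have e := resE_closedM hX hX'; rewrite {2}e resEK; exact: e.
Qed.
End ERing.
Arguments econj {K}.
Arguments resE {K} Y.
Arguments unresE {K} X.
Arguments eSU {K} Y.
Arguments ew {K}.
Arguments es {K}.
Arguments eherm {K}.

Section EMap.
Context {K L : comNzRingType} (f : {rmorphism K -> L}).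
Definition emap : {rmorphism E K -> E L} := qmap (qmap f).
Lemma emapE a b c d : emap (Quad (Quad a b) (Quad c d)) =
  Quad (Quad (f a) (f b)) (Quad (f c) (f d)).
Proof. by []. Qed.
Lemma emap_conj x : emap (econj x) = econj (emap x).
Proof.
case: x => [[a b] [c d]]; rewrite econjE !emapE econjE.
by rewrite !rmorphB.
Qed.
Lemma emap_w : emap ew = ew.
Proof. by apply: quadP; apply: quadP; rewrite /= ?rmorph0 ?rmorph1. Qed.
Lemma emap_s : emap es = es.
Proof. by apply: quadP; apply: quadP; rewrite /= ?rmorph0 ?rmorph1. Qed.
Lemma map_adj n (Y : 'M[_]_n) : map_mx emap (adj econj Y) = adj econj (map_mx emap Y).
Proof. by apply/matrixP => i j; rewrite !mxE emap_conj. Qed.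
Lemma map_mat3 (T U : zmodType) (g : {additive T -> U}) s :
  map_mx g (mat3 s) = mat3 (map (map g) s).
Proof.
apply/matrixP => i j; rewrite !mxE.
(* Positions past the end of the lists hold the default 0, which an additive map preserves. *)
have [iz|iz] := ltnP i (size s); last first.
  by rewrite (nth_default _ iz) (@nth_default _ _ (map _ s)) ?size_map// !nth_nil raddf0.
rewrite (nth_map [::]) //.
have [jz|jz] := ltnP j (size (nth [::] s i)).
  by rewrite (nth_map 0).
by rewrite (nth_default _ jz) nth_default ?size_map// raddf0.
Qed.
Lemma map_eherm : map_mx emap eherm = eherm.
Proof.
rewrite /eherm map_mat3 /=.
by rewrite !(rmorphN, rmorphM, rmorphD, rmorphXn, rmorph_nat, rmorph1,
  emap_conj, emap_w, emap_s).
Qed.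
Lemma map_resE Y : map_mx f (resE Y) = resE (map_mx emap Y).
Proof. by rewrite !resE_unlock !map_res_mx. Qed.
Lemma map_unresE X : map_mx emap (unresE X) = unresE (map_mx f X).
Proof. by rewrite !unresE_unlock -!map_unres_mx. Qed.
End EMap.

(** * Polynomial equations of the group *)

Section Equations.
Local Notation m := ((3 + 3) + (3 + 3))%N.
Local Notation P := (mpoly (m * m) rat).
Let gen : 'M[P]_m := \matrix_(i, j) mpolyX rat (mnm1 (mxvec_index i j)).
Let Y := unresE gen.
Let ecoords (x : E P) : seq P :=
  [:: qre (qre x); qim (qre x); qre (qim x); qim (qim x)].

Definition SU_equations : seq P :=
  [seq (gen - resE Y) k.1 k.2 | k : 'I_m * 'I_m]
  ++ flatten [seq ecoords ((adj econj Y *m eherm *m Y - eherm) k.1 k.2) | k : 'I_3 * 'I_3]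
  ++ ecoords (\det Y - 1).

(** Evaluation at the entries of x is a ring morphism that sends the generic matrix [gen] to x, and
    every construction in the equations commutes with ring morphisms; an equation over [E] is tested
    on its four coordinates. *)
Lemma SU_equationsP (F : comNzRingType) (h : {rmorphism rat -> F}) (x : 'M[F]_m) :
  (forall p, p \in SU_equations -> mmap h (fun k => mxvec x 0 k) p = 0) <->
  x = resE (unresE x) /\ eSU (unresE x).
Proof.
pose ev : {rmorphism P -> F} := mmap h (fun k => mxvec x 0 k).
have evg : map_mx ev gen = x.
  by apply/matrixP => i j; rewrite !mxE /= mmapX mmap1U mxvecE.
have evY : map_mx (emap ev) Y = unresE x by rewrite /Y map_unresE evg.
have e0 (y : E P) : (forall p, p \in ecoords y -> ev p = 0) <-> emap ev y = 0.
  split=> [h0|].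
    by apply: quadP; apply: quadP; apply: h0; rewrite !inE eqxx ?orbT.
  move=> [e1 e2 e3 e4] p; rewrite !inE.
  by move=> /or4P[] /eqP->.
rewrite -/ev; split=> [all0|[xE [xh dx]]].
- split; last split.
  + rewrite -{1}evg -{1}evY -map_resE; apply/eqP; rewrite -subr_eq0 -map_mxB.
    apply/eqP/matrixP => i j; rewrite [LHS]mxE [RHS]mxE; apply: all0.
    by rewrite mem_cat; apply/orP; left; apply/fintype.imageP; exists (i, j).
  + rewrite -evY -(map_eherm ev) -map_adj -!map_mxM.
    apply/eqP; rewrite -subr_eq0 -map_mxB.
    apply/eqP/matrixP => i j; rewrite [LHS]mxE [RHS]mxE; apply/e0 => p pe.
    apply: all0; rewrite !mem_cat; apply/orP; right; apply/orP; left.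
    by apply/flattenP; eexists; [apply/fintype.imageP; exists (i, j)|exact: pe].
  + rewrite -evY det_map_mx; apply/eqP; rewrite -subr_eq0 -(rmorph1 (emap ev)).
    rewrite -rmorphB; apply/eqP/e0 => p pe.
    by apply: all0; rewrite !mem_cat pe !orbT.
- move=> p; rewrite !mem_cat => /or3P[/fintype.imageP[[i j] _ ->]|/flattenP[s]|].
  + transitivity ((map_mx ev (gen - resE Y)) i j); first by rewrite [RHS]mxE.
    by rewrite map_mxB map_resE evg evY -xE subrr mxE.
  + move=> /fintype.imageP[[i j] _ ->] pe; apply: (proj2 (e0 _) _ _ pe).
    transitivity ((map_mx (emap ev) (adj econj Y *m eherm *m Y - eherm)) i j).
      by rewrite [RHS]mxE.
    by rewrite map_mxB !map_mxM map_adj map_eherm evY xh subrr mxE.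
  + move=> pe; apply: (proj2 (e0 _) _ _ pe).
    by rewrite rmorphB -det_map_mx evY dx rmorph1 subrr.
Qed.
End Equations.

(** * Topology of complex matrices *)

Section MatrixContinuity.
Context {T : topologicalType} {K : numFieldType}.

Lemma continuous_mxP m n (f : T -> 'M[K]_(m, n)) :
  continuous f <-> forall i j, continuous (fun x => f x i j).
Proof.
split=> [cf i j x|cf x].
  apply: (@continuous_comp _ _ _ f (fun M : 'M[K]_(m, n) => M i j)).
    exact: cf.
  exact: coord_continuous.
move=> A [P Pn PA] /=.
have : \forall y \near x, forall ij : 'I_m * 'I_n, P ij.1 ij.2 (f y ij.1 ij.2).
  apply: filter_forall => -[i j] /=.
  exact: (cf i j x).
by apply: filterS => y Py; apply: PA => i j; exact: (Py (i, j)).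
Qed.

Lemma continuous_sumr (I : Type) (r : seq I) (P : pred I) (f : I -> T -> K) :
  (forall i, P i -> continuous (f i)) -> continuous (fun x => \sum_(i <- r | P i) f i x).
Proof.
move=> cf; elim: r => [|i r IH].
  by rewrite (_ : (fun=> _) = (fun=> 0)); [exact: cst_continuous|apply/funext => x; rewrite big_nil].
rewrite (_ : (fun=> _) = (fun x => (if P i then f i x else 0) + \sum_(j <- r | P j) f j x)).
  move=> x; apply: cvgD; last exact: IH.
  by case: (boolP (P i)) => Pi; [exact: cf|exact: cvg_cst].
by apply/funext => x; rewrite big_cons; case: ifP; rewrite ?add0r.
Qed.

Lemma continuous_mulmx m n p (f : T -> 'M[K]_(m, n)) (g : T -> 'M[K]_(n, p)) :
  continuous f -> continuous g -> continuous (fun x => f x *m g x).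
Proof.
move=> /continuous_mxP cf /continuous_mxP cg; apply/continuous_mxP => i j.
rewrite (_ : (fun=> _) = (fun x => \sum_k f x i k * g x k j)).
  by apply: continuous_sumr => k _ x; apply: cvgM; [exact: cf|exact: cg].
by apply/funext => x; rewrite mxE.
Qed.

Lemma continuous_addmx m n (f g : T -> 'M[K]_(m, n)) :
  continuous f -> continuous g -> continuous (fun x => f x + g x).
Proof.
move=> /continuous_mxP cf /continuous_mxP cg; apply/continuous_mxP => i j.
rewrite (_ : (fun=> _) = (fun x => f x i j + g x i j)).
  by move=> x; apply: cvgD; [exact: cf|exact: cg].
by apply/funext => x; rewrite mxE.
Qed.

Lemma continuous_prodr (I : Type) (r : seq I) (f : I -> T -> K) :
  (forall i, continuous (f i)) -> continuous (fun x => \prod_(i <- r) f i x).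
Proof.
move=> cf; elim: r => [|i r IH].
  by rewrite (_ : (fun=> _) = (fun=> 1)); [exact: cst_continuous|apply/funext => x; rewrite big_nil].
rewrite (_ : (fun=> _) = (fun x => f i x * \prod_(j <- r) f j x)).
  by move=> x; apply: cvgM; [exact: cf|exact: IH].
by apply/funext => x; rewrite big_cons.
Qed.

Lemma continuous_det n (f : T -> 'M[K]_n) :
  continuous f -> continuous (fun x => \det (f x)).
Proof.
move=> /continuous_mxP cf; apply: continuous_sumr => s _ x.
apply: cvgM; first exact: cvg_cst.
by apply: continuous_prodr => i; exact: cf.
Qed.

End MatrixContinuity.

Section ComplexTopology.
Context {R : realType}.
Local Notation C := (Cplx R).

Lemma normCE (z : C) : `|z| = (Num.sqrt (complex.Re z ^+ 2 + complex.Im z ^+ 2))%:C%C.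
Proof. exact: normc_def. Qed.

Lemma conjCE (z : C) : z^* = conjc z.
Proof. by []. Qed.

(** Balls in C have radii in C itself; a positive radius is real, which allows passing between the
    two kinds of balls. *)
Lemma gt0_complex (e : C) : 0 < e -> e = (complex.Re e)%:C%C /\ 0 < complex.Re e.
Proof. by case: e => a b; rewrite ltcE /= => /andP[/eqP-> ->]. Qed.

Lemma continuous_real_complex : continuous (fun x : R => x%:C%C : C).
Proof.
move=> x A /(@nbhs_ballP C C)[e /= /gt0_complex[eE e0] eA]; apply/nbhs_ballP.
exists (complex.Re e) => // y; rewrite -ball_normE /= => xy; apply: eA.
rewrite -ball_normE /= eE -rmorphB normCE /= expr0n addr0 sqrtr_sqr.
by rewrite ltcR.
Qed.

Lemma normRe_le (z : C) : `|complex.Re z|%:C%C <= `|z|.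
Proof. exact: normc_ge_Re. Qed.

Lemma normIm_le (z : C) : `|complex.Im z|%:C%C <= `|z|.
Proof. by rewrite normCE lecR -sqrtr_sqr ler_wsqrtr// lerDr sqr_ge0. Qed.

Lemma continuous_Re : continuous (fun z : C => complex.Re z).
Proof.
move=> x A /nbhs_ballP[e /= e0 eA]; apply/(@nbhs_ballP C C).
exists e%:C%C => [|y]; first by rewrite /= ltcR.
rewrite -ball_normE /= => xy; apply: eA; rewrite -ball_normE /=.
by rewrite -ltcR -raddfB (le_lt_trans (normRe_le _)).
Qed.

Lemma continuous_Im : continuous (fun z : C => complex.Im z).
Proof.
move=> x A /nbhs_ballP[e /= e0 eA]; apply/(@nbhs_ballP C C).
exists e%:C%C => [|y]; first by rewrite /= ltcR.
rewrite -ball_normE /= => xy; apply: eA; rewrite -ball_normE /=.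
by rewrite -ltcR -raddfB (le_lt_trans (normIm_le _)).
Qed.

Lemma continuous_conjC : continuous (fun z : C => z^*).
Proof.
move=> x A /(@nbhs_ballP C C)[e /= e0 eA]; apply/(@nbhs_ballP C C).
exists e => // y; rewrite -ball_normE /= => xy; apply: eA.
by rewrite -ball_normE /= -rmorphB norm_conjC.
Qed.

Lemma continuous_complexP (T : topologicalType) (f : T -> C) :
  continuous (fun x => complex.Re (f x)) -> continuous (fun x => complex.Im (f x)) ->
  continuous f.
Proof.
move=> cr ci; rewrite (_ : f = (fun x => ((complex.Re (f x))%:C%C : C) + 'i%C * (complex.Im (f x))%:C%C)).
  move=> x; apply: (@cvgD C).
    by apply: continuous_comp; [exact: cr|exact: continuous_real_complex].
  apply: cvgM; first exact: cvg_cst.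
  by apply: continuous_comp; [exact: ci|exact: continuous_real_complex].
by apply/funext => x; exact: complexE.
Qed.

(** The set is covered by the image of a compact square of R x R under (a, b) -> a + i b, and it is
    closed. *)
Lemma compact_box (B : R) :
  compact [set z : C | `|complex.Re z| <= B /\ `|complex.Im z| <= B].
Proof.
pose f (p : R * R) : C := (p.1 +i* p.2)%C.
have cf : continuous f.
  by apply: continuous_complexP => /= p; [exact: cvg_fst|exact: cvg_snd].
have : compact (f @` (`[- B, B] `*` `[- B, B])).
  apply: continuous_compact; first exact: continuous_subspaceT.
  by apply: compact_setX; exact: segment_compact.
move=> cK; apply: (subclosed_compact _ cK).
  apply: closedI.
    apply: (@closed_comp _ _ (fun z : C => `|complex.Re z|) [set x | x <= B]) => [z _|].
      apply: (@continuous_comp _ _ _ (fun z : C => complex.Re z) (fun x : R => `|x|)).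
        exact: continuous_Re.
      exact: norm_continuous.
    exact: closed_le.
  apply: (@closed_comp _ _ (fun z : C => `|complex.Im z|) [set x | x <= B]) => [z _|].
    apply: (@continuous_comp _ _ _ (fun z : C => complex.Im z) (fun x : R => `|x|)).
      exact: continuous_Im.
    exact: norm_continuous.
  exact: closed_le.
move=> [a b] /= [ha hb]; exists (a, b) => //=.
by rewrite !in_itv /= -!ler_norml.
Qed.

(** Heine-Borel for complex matrices, from the compactness of a product of boxes in row vectors
    carried over by [vec_mx]. *)
Lemma compact_mx m n (A : set 'M[C]_(m, n)) (B : R) : closed A ->
  (forall x i j, A x -> `|x i j| <= B%:C%C) -> compact A.
Proof.
move=> cA bA.
have cv : continuous (@vec_mx C m n).
  apply/continuous_mxP => i j.
  rewrite (_ : (fun=> _) = (fun x : 'rV[C]_(m * n) => x 0 (mxvec_index i j))).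
    exact: coord_continuous.
  by apply/funext => x; rewrite mxE.
have : compact (@vec_mx C m n @` [set v : 'rV[C]_(m * n) | forall i, [set z : C | `|complex.Re z| <= B /\ `|complex.Im z| <= B] (v 0 i)]).
  apply: continuous_compact; first exact: continuous_subspaceT.
  apply: (@rV_compact C _ (fun=> [set z : C | `|complex.Re z| <= B /\ `|complex.Im z| <= B])).
  by move=> i; exact: compact_box.
move=> cK; apply: (subclosed_compact cA cK) => x Ax; exists (mxvec x); last exact: mxvecK.
move=> k /=; case/mxvec_indexP: k => i j; rewrite mxvecE.
have := bA _ i j Ax => h.
by split; rewrite -lecR; apply: (le_trans _ h); [exact: normRe_le|exact: normIm_le].
Qed.

Lemma closed_eq (T : topologicalType) (K : numFieldType) (f g : T -> K) :
  continuous f -> continuous g -> closed [set x | f x = g x].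
Proof.
move=> cf cg; rewrite (_ : mkset _ = (fun x => f x - g x) @^-1` [set 0]).
  apply: closed_comp => [x _|]; first by apply: cvgB; [exact: cf|exact: cg].
  apply: accessible_closed_set1; apply: hausdorff_accessible.
  exact: (@norm_hausdorff K K).
by apply/seteqP; split => x /=; [move=> ->; rewrite subrr|move/eqP; rewrite subr_eq0 => /eqP].
Qed.

Lemma closed_eq_mx (T : topologicalType) (K : numFieldType) m n (f g : T -> 'M[K]_(m, n)) :
  continuous f -> continuous g -> closed [set x | f x = g x].
Proof.
move=> /continuous_mxP cf /continuous_mxP cg.
rewrite (_ : mkset _ = \bigcap_i \bigcap_j [set x | f x i j = g x i j]).
  apply: closed_bigI => i _; apply: closed_bigI => j _.
  by apply: closed_eq; [exact: cf|exact: cg].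
apply/seteqP; split => [x /= h i _ j _ /=|x h]; first by rewrite h.
by apply/matrixP => i j; exact: h.
Qed.

Lemma continuous_conj_mx (T : topologicalType) m n (f : T -> 'M[C]_(m, n)) :
  continuous f -> continuous (fun x => (map_mx Num.conj (f x))^T).
Proof.
move=> /continuous_mxP cf; apply/continuous_mxP => i j.
rewrite (_ : (fun=> _) = (fun x => (f x j i)^*)).
  move=> x; apply: (@continuous_comp _ _ _ (fun x => f x j i) (fun z : C => z^*)).
    exact: cf.
  exact: continuous_conjC.
by apply/funext => x; rewrite !mxE.
Qed.

Lemma closed_SU n (H : 'M[C]_n) : closed (SU H : set 'M[C]_n).
Proof.
have cid : continuous (fun g : 'M[C]_n => g) by move=> x; exact: cvg_id.
have cst k l (M : 'M[C]_(k, l)) : continuous (fun _ : 'M[C]_n => M).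
  exact: cst_continuous.
have c1 : closed [set g : 'M[C]_n | (map_mx Num.conj g)^T *m H *m g = H].
  apply: closed_eq_mx; last exact: cst.
  apply: continuous_mulmx; last exact: cid.
  apply: continuous_mulmx; last exact: cst.
  exact: continuous_conj_mx.
have c2 : closed [set g : 'M[C]_n | \det g = 1].
  by apply: closed_eq; [exact: continuous_det|exact: cst_continuous].
rewrite (_ : mxgroup_set _ = [set g : 'M[C]_n | (map_mx Num.conj g)^T *m H *m g = H] `&` [set g : 'M[C]_n | \det g = 1]).
  exact: closedI.
by apply/seteqP; split => g []; rewrite /= map_trmx.
Qed.

End ComplexTopology.

(** * Cocompact lattices from a reduction theory *)

(* N is a proper height on G that Gam brings below M0. *)
Section CocompactLattice.
Context {R : realType} {n : nat}.
Local Notation C := (Cplx R).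
Variables (G Gam : mxgroup C n) (N : 'M[C]_n -> R) (M0 : R).
(** A map that is continuous on all matrices and inverts on G; it makes (y, z) -> y z^-1 continuous
    near points of G. *)
Variable cinv : 'M[C]_n -> 'M[C]_n.
Hypothesis GamG : Gam `<=` G.
Hypothesis finGam : forall x : C, finite_set [set g | (Gam : set _) g /\ forall i j, `|g i j| <= x].
Hypothesis cN : continuous N.
Hypothesis compN : forall M, compact [set g | (G : set _) g /\ N g <= M].
Hypothesis reduceN : forall g, (G : set _) g -> exists2 c, (Gam : set _) c & N (c *m g) <= M0.
Hypothesis ccinv : continuous cinv.
Hypothesis cinvE : forall g, (G : set _) g -> cinv g = invmx g.

(** Elements of Gam within distance 1 of c have bounded entries, so they are finitely many; those
    other than c form a closed set, which is removed from the ball. *)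
Lemma isolating (c : 'M[C]_n) : exists2 W, nbhs c W & Gam `&` W `<=` [set c].
Proof.
pose B := \sum_i \sum_j `|c i j| + 1 : C.
have cB i j : `|c i j| <= B - 1.
  rewrite addrK (bigD1 i)//= (bigD1 j)//= -addrA lerDl.
  by rewrite addr_ge0 ?sumr_ge0 // => *; rewrite ?sumr_ge0.
pose F := [set g | (Gam : set _) g /\ forall i j, `|g i j| <= B] `\ c.
have cF : closed F.
  have T1 : accessible_space 'M[C]_n.
    by apply: hausdorff_accessible; exact: (@norm_hausdorff C 'M[C]_n).
  have /accessible_finite_set_closed := T1; apply.
  exact: finite_setD (finGam B).
exists (~` F `&` ball c 1).
  apply: filterI; last exact: nbhsx_ballx.
  by apply: open_nbhs_nbhs; split; [exact: closed_openC|move=> -[_ /(_ erefl)]].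
move=> g [Gg [nF [_ gc]]] /=; apply: contrapT => gnc; apply: nF; split => //.
split=> // i j; have := gc i j; rewrite -ball_normE /= => cg.
rewrite -(subrK (c i j) (g i j)) (le_trans (ler_normD _ _)) // -(subrK 1 B) addrC.
by rewrite lerD // distrC ltW.
Qed.

Lemma discrete_Gam : discrete_subgroup Gam.
Proof.
move=> c Gc; split; first exact/mem_set.
have [W Wc WG] := isolating c; exists W => //.
apply/seteqP; split => g /=; first by move=> [Wg Gg]; apply: WG.
by move=> ->; split => //; exact: nbhs_singleton.
Qed.

Lemma open_val (O : set 'M[C]_n) : open O -> open (set_val @^-1` O : set G).
Proof. by move=> oO; exists O. Qed.

(** [compN] speaks of a set of matrices, this lemma of the subtype G with its initial topology. The
    map f, a retraction of the matrices onto G that is continuous on the subspace G, carries one to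
    the other. *)
Lemma compact_G M : compact [set g : G | N (\val g) <= M].
Proof.
have G1 : (G : set _) 1%:M by case: (mxgroupP G).
pose f (x : 'M[C]_n) : G := insubd (exist _ 1%:M (mem_set G1) : G) x.
have fK (x : G) : f (\val x) = x by exact: valKd.
have vf x : (G : set _) x -> \val (f x) = x by move=> Gx; rewrite val_insubd mem_set.
have cf : {within [set g | (G : set _) g /\ N g <= M], continuous f}.
  apply: (@continuous_subspaceW _ _ _ (G : set _) f); first by move=> x [].

  apply/subspace_sigL_continuousP.
  rewrite (_ : sigL _ _ = id); first by move=> x; exact: cvg_id.
  by apply/funext => x; rewrite /sigL /=; exact: fK.
have := continuous_compact cf (@compN M).
congr compact; apply/seteqP; split => [_ [x [Gx xM] <-] /=|x xM /=].
  by rewrite vf.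
exists (\val x); last exact: fK.
by split => //; exact: set_valP.
Qed.

(** Every orbit meets the compact set N <= M0, so the projection maps this set onto the quotient. *)
Lemma cocompact_Gam : cocompact G Gam.
Proof.
have := continuous_compact (continuous_subspaceT (@pi_continuous _ _)) (@compact_G M0).
move=> /(_ {eq_quot EquivRelPack (@orbit_relP R n G Gam)}%qT).
congr compact; apply/seteqP; split => // q _.
pose x : G := repr q.
have [c Gc cM] := reduceN (set_valP x).
have Gcx : (G : set _) (c *m \val x).
  by case: (mxgroupP G) => _ GM _ _; apply: GM; [exact: GamG|exact: set_valP].
exists (exist (fun y => y \in (G : set _)) _ (mem_set Gcx) : G) => //.
rewrite -[RHS]reprK; apply/eqmodP => /=; apply/asboolP.
by exists c.
Qed.

(** If y and c y are both close to x, then c = (c y) y^-1 is close to 1 and hence equal to 1. The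
    condition that x is in G stands under the existential so that [choice] yields a function on all
    matrices. *)
Lemma separating (x : 'M[C]_n) : exists O : set 'M[C]_n, (G : set _) x ->
  [/\ open O, O x, O `<=` [set y | N y <= N x + 1]
    & forall y z c, (G : set _) y -> O y -> O z -> (Gam : set _) c ->
        z = c *m y -> z = y].
Proof.
have [GG1 GGM GGU GGV] := mxgroupP G.
case: (pselect ((G : set _) x)) => [Gx|nGx]; last by exists set0.
have [W W1 WG] := isolating 1%:M.
pose h (p : 'M[C]_n * 'M[C]_n) : 'M[C]_n := p.1 *m cinv p.2.
have ch : continuous h.
  apply: continuous_mulmx => [p|p]; first exact: cvg_fst.
  apply: (@continuous_comp _ _ _ snd cinv); first exact: cvg_snd.
  exact: ccinv.
have [[A B] /= [Ax Bx] AB] : nbhs (x, x) (h @^-1` W).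
  by apply: ch; rewrite /h /= cinvE ?mulmxV//; exact: GGU.
have Nx : nbhs x [set g | N g < N x + 1].
  have : nbhs (N x) [set r | r < N x + 1].
    by apply: open_nbhs_nbhs; split; [exact: open_lt|rewrite /= ltrDl].
  exact: cN.
exists (A `&` B `&` [set g | N g < N x + 1])^° => _; split.
- exact: open_interior.
- by apply: filterI => //; exact: filterI.
- by move=> y /interior_subset[_ /ltW].
- move=> y z c Gy /interior_subset[[_ By] _] /interior_subset[[Az _] _] Gc zE.
  have -> : z = c *m y by [].
  suff -> : c = 1%:M by rewrite mul1mx.
  apply: (WG c); split => //; have := AB (z, y) (conj Az By).
  by rewrite /h /= zE cinvE// mulmxK// GGU.
Qed.

Lemma open_saturation (V : set G) : open V ->
  open [set y : G | exists2 x, V x & same_orbit Gam x y].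
Proof.
have [GG1 GGM GGU GGV] := mxgroupP G.
case=> O oO <-.
rewrite (_ : mkset _ = set_val @^-1` (\bigcup_(c in (Gam : set _)) [set y | O (c *m y)])).
  apply: open_val; apply: bigcup_open => c _.
  apply: open_comp => // y _.
  by apply: continuous_mulmx => [z|z]; [exact: cst_continuous|exact: cvg_id].
apply/seteqP; split => [y [x Ox [c Gc xE]] /=|y [c Gc /= Oy]].
  by exists c => //=; rewrite -xE.
have Gcy : (G : set _) (c *m \val y).
  by apply: GGM; [exact: GamG|exact: set_valP].
by exists (exist (fun y => y \in (G : set _)) _ (mem_set Gcy) : G) => //; exists c.
Qed.

(** The compact set N <= M0 meets every orbit and is covered by finitely many separating open sets.
    The domain cut out of them lies in the compact set N <= M0 + 1, whose Haar measure is finite. *)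
Lemma finite_covolume_Gam : finite_covolume G Gam.
Proof.
have [GG1 GGM GGU GGV] := mxgroupP Gam.
move=> mu [muK _ _].
have [U UP] := choice separating.
pose U' x : set G := set_val @^-1` U x.
have [F FD FK] : finite_subset_cover [set x | (G : set _) x /\ N x <= M0] U
    [set x | (G : set _) x /\ N x <= M0].
  have := @compN M0; rewrite compact_cover; apply.
    by move=> x [Gx _]; case: (UP x Gx).
  by move=> x [Gx xM]; exists x => //; case: (UP x Gx).
have Fu x : x \in F -> (G : set _) x /\ N x <= M0 by move=> /FD /set_mem.
pose u : seq (set G) := [seq U' x | x <- F].
(* Past the end of the list V is empty, so the facts about V hold for every index. *)
pose V k : set G := nth set0 u k.
have Vopen k : open (V k).
  have [ku|ku] := ltnP k (size u); last by rewrite /V nth_default//; exact: open0.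
  rewrite /V; have /mapP[x /Fu[Gx _] ->] := mem_nth set0 ku.
  by apply: open_val; case: (UP x Gx).
have Vsep k y z c : V k y -> V k z -> (Gam : set _) c -> \val z = c *m \val y -> z = y.
  have [ku|ku] := ltnP k (size u); last by rewrite /V nth_default.
  rewrite /V; have /mapP[x /Fu[Gx _] ->] := mem_nth set0 ku => Oy Oz Gc zE.
  have [_ _ _ h] := UP x Gx; apply: val_inj.
  by apply: (h _ _ c) => //; exact: set_valP.
have VN k y : V k y -> N (\val y) <= M0 + 1.
  have [ku|ku] := ltnP k (size u); last by rewrite /V nth_default.
  rewrite /V; have /mapP[x /Fu[Gx xM] ->] := mem_nth set0 ku => Oy.
  have [_ _ h _] := UP x Gx.
  by rewrite (le_trans (h _ Oy)) // lerD2r.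
pose sat (A : set G) : set G := [set y | exists2 x, A x & same_orbit Gam x y].
(* An orbit is represented in the first V k that it meets, and by [Vsep] it has only one point
   there. *)
pose D : set G := \bigcup_(k in `I_(size u)) (V k `\` sat (\bigcup_(j in `I_k) V j)).
have mopen (A : set G) : open A -> measurable (A : set (borel G)).
  exact: sub_sigma_algebra.
have mD : measurable (D : set (borel G)).
  apply: (@fin_bigcup_measurable _ (borel G)) => // k _.
  apply: (@measurableD _ (borel G)); apply: mopen => //.
  by apply: open_saturation; apply: bigcup_open => j _; exact: Vopen.
have osym (y z : G) : same_orbit Gam y z -> same_orbit Gam z y.
  by case=> c Gc yE; exists (invmx c); [exact: GGV|rewrite yE mulKmx// GGU].
have otrans (y z t : G) : same_orbit Gam y z -> same_orbit Gam z t -> same_orbit Gam y t.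
  by move=> [c Gc yE] [d Gd zE]; exists (c *m d); [exact: GGM|rewrite yE zE mulmxA].
have DM : D `<=` [set y | N (\val y) <= M0 + 1] by move=> y [k _ [/VN]].
exists D.
  split=> // x.
  have ex : exists k, `[< sat (V k) x >].
    have [c Gc cx] := reduceN (set_valP x).
    have Gcx : (G : set _) (c *m \val x).
      by have [_ GM _ _] := mxgroupP G; apply: GM; [exact: GamG|exact: set_valP].
    have [y Fy Uy] := FK _ (conj Gcx cx).
    exists (index (U' y) u); apply/asboolP.
    exists (exist (fun y => y \in (G : set _)) _ (mem_set Gcx) : G); last by exists c.
    rewrite /V nth_index //; apply/mapP; by exists y.
  case: (ex_minnP ex) => k /asboolP[y Vy yx] kmin.
  exists y; split; [split; last exact: osym|].
    exists k => [/=|]; last split=> //.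
      by rewrite ltnNge; apply/negP => uk; move: Vy; rewrite /V nth_default.
    move=> [z [j jk Vz] zy]; have := kmin j.
    rewrite leqNgt jk => /(_ _)/negP; apply => //; apply/asboolP.
    by exists z => //; exact: otrans zy yx.
  move=> z [[l _ [Vz nz]] xz].
  have kl : (k <= l)%N by apply: kmin; apply/asboolP; exists z => //; exact: osym.
  have lk : (l <= k)%N.
    rewrite leqNgt; apply/negP => kl'; apply: nz.
    by exists y; [exists k|exact: otrans yx xz].
  have lkE : l = k by apply/eqP; rewrite eqn_leq lk.
  rewrite lkE in Vz; have [c Gc zE] := osym _ _ (otrans _ _ _ yx xz).
  by apply/esym; exact: (Vsep k y z c).
apply: (@le_lt_trans _ _ (mu [set y : G | N (\val y) <= M0 + 1])); last first.
  by apply: muK; exact: compact_G.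
apply: le_measure; [exact/mem_set|apply/mem_set|exact: DM].
rewrite -[X in measurable X]setCK; apply: (@measurableC _ (borel G)); apply: mopen.
apply: closed_openC; apply: (@closed_comp _ _ (fun y : G => N (\val y)) [set r | r <= M0 + 1]).
  move=> y _; apply: (@continuous_comp _ _ _ (fun y : G => \val y) N); last exact: cN.
  exact: initial_continuous.
exact: closed_le.
Qed.

Lemma lattice_Gam : lattice G Gam.
Proof. by split; [exact: GamG|exact: discrete_Gam|exact: finite_covolume_Gam]. Qed.

End CocompactLattice.

(** * The two embeddings and the integral structure of the triangle group *)

Section RootsOfUnity.
Context {R : realType}.
Local Notation C := (Cplx R).

Lemma complexP (x y : C) :
  complex.Re x = complex.Re y -> complex.Im x = complex.Im y -> x = y.
Proof. by case: x y => [a b] [c d] /= -> ->. Qed.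

Lemma expiD (a b : R) : expi (a + b) = expi a * expi b :> C.
Proof. by apply: complexP; rewrite /= ?cosD ?sinD; ring. Qed.

Lemma expi0 : expi 0 = 1 :> C.
Proof. by rewrite /expi cos0 sin0. Qed.

Lemma expiN (a : R) : expi (- a) = (expi a)^-1 :> C.
Proof.
by apply: (mulIf (expi_neq0 a)); rewrite -expiD addNr expi0 mulVf// expi_neq0.
Qed.

Lemma expi_conj (a : R) : (expi a)^* = (expi a)^-1 :> C.
Proof. by rewrite -expiN /expi cosN sinN conjCE. Qed.

Lemma expiMn (a : R) k : expi (k%:R * a) = expi a ^+ k :> C.
Proof.
elim: k => [|k IH]; first by rewrite mul0r expi0.
by rewrite -natr1 mulrDl mul1r expiD IH exprSr.
Qed.

Lemma expipi : expi pi = -1 :> C.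
Proof. by apply: complexP; rewrite /= ?cospi ?sinpi ?oppr0. Qed.

(** This is the Gauss period of the squares 1, 2, 4 modulo 7. Its conjugate is the period of the
    non-squares 3, 5, 6, and the two add up to -1. *)
Lemma sigma4_facts : let s : C := sigma4 in
  [/\ s ^+ 2 + s + 2 = 0, s^* = -1 - s & 0 < complex.Im s].
Proof.
pose x : C := expi (2 * pi / 7).
have x7 : x ^+ 7 = 1.
  rewrite -expiMn (_ : 7 * _ = 2%:R * pi); last by field.
  by rewrite expiMn expipi sqrrN expr1n.
have s2 : 0 < sin (2 * pi / 7 : R) by apply: sin_gt0_pi; have := pi_gt0 R; lra.
have x1 : x != 1.
  by apply/eqP => /(congr1 (@complex.Im R)) /= s0; move: s2; rewrite s0 ltxx.
have S0 : x ^+ 6 + x ^+ 5 + x ^+ 4 + x ^+ 3 + x ^+ 2 + x + 1 = 0.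
  apply: (mulfI (_ : x - 1 != 0)); first by rewrite subr_eq0.
  by rewrite mulr0; transitivity (x ^+ 7 - 1); [ring|rewrite x7 subrr].
have sE : sigma4 = x + x ^+ 2 + x ^+ 4 :> C.
  by rewrite /sigma4 -!expiMn; congr (_ + expi _ + expi _); field.
have xV : x^* = x ^+ 6.
  rewrite expi_conj; apply: (mulIf (expi_neq0 (2 * pi / 7))).
  by rewrite mulVf ?expi_neq0// -/x -exprSr x7.
split.
- rewrite sE; transitivity (2 * (x ^+ 6 + x ^+ 5 + x ^+ 4 + x ^+ 3 + x ^+ 2 + x + 1)
    + x * (x ^+ 7 - 1)); first by ring.
  by rewrite S0 x7 subrr !mulr0 addr0.
- rewrite sE !rmorphD !rmorphXn /= xV.
  (* The multiple of x^7 - 1 reduces the conjugate x^6 + x^12 + x^24 to x^6 + x^5 + x^3. *)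
  transitivity (-1 - (x + x ^+ 2 + x ^+ 4) + (x ^+ 6 + x ^+ 5 + x ^+ 4 + x ^+ 3 + x ^+ 2 + x + 1)
    + (x ^+ 7 - 1) * (x ^+ 5 + (x ^+ 7 + 1) * x ^+ 10 + x ^+ 3)); first by ring.
  by rewrite S0 x7 subrr mul0r !addr0.
- rewrite /sigma4 /=.
  have -> : sin (8 * pi / 7 : R) = - sin (pi / 7).
    by rewrite (_ : 8 * pi / 7 = pi / 7 + pi); [rewrite sinDpi|field].
  have -> : sin (4 * pi / 7 : R) = sin (3 * pi / 7).
    rewrite (_ : 4 * pi / 7 = pi - 3 * pi / 7); last by field.
    by rewrite sinB sinpi cospi mul0r add0r mulN1r opprK.
  have : sin (pi / 7 : R) < sin (3 * pi / 7).
    by rewrite ltr_sin ?in_itv /=; have := pi_gt0 R; lra.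
  by move: s2; lra.
Qed.

(** This is sqrt 3, in the form in which it occurs on the diagonal of H_tau for p = 3. *)
Definition r3 : R := 2 * sin (pi / 3).
(** The sign makes this a primitive ninth root of unity rather than one of order 18. Its square is
    exp(i psi / 3), and u^6 is the cube root of unity w. *)
Definition u : C := - expi (pi / 9).

Lemma expi_pi3 : let y : C := expi (pi / 3) in y ^+ 2 = y - 1 /\ 0 < complex.Im y.
Proof.
move=> y; have yi : 0 < complex.Im y by apply: sin_gt0_pi; have := pi_gt0 R; lra.
split=> //; have y3 : y ^+ 3 = -1.
  by rewrite -expiMn (_ : 3 * _ = pi) ?expipi//; field.
apply: (mulfI (_ : y + 1 != 0)).
  apply/eqP => /(congr1 (@complex.Im R)) /= y0; move: yi.
  by rewrite (_ : complex.Im y = 0) ?ltxx// -y0 addr0.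
by transitivity (y ^+ 3 + 1 + (y ^+ 2 - 1)); [ring|rewrite y3; ring].
Qed.

Lemma cos_pi3 : cos (pi / 3) = 1 / 2 :> R.
Proof.
have [y2 yi] := expi_pi3; move: y2; rewrite /expi expr2 => /(congr1 (@complex.Im R)) /=.
rewrite subr0 => /eqP; rewrite -subr_eq0 => /eqP y2.
apply: (mulIf (lt0r_neq0 yi)); apply/eqP; rewrite -subr_eq0; apply/eqP.
by move: y2 => /=; lra.
Qed.

Lemma u3E : u ^+ 3 = - expi (pi / 3).
Proof.
have -> : pi / 3 = 3%:R * (pi / 9) :> R by field.
by rewrite expiMn /u; ring.
Qed.

Lemma u6 : u ^+ 6 = - u ^+ 3 - 1.
Proof.
have -> : u ^+ 6 = (u ^+ 3) ^+ 2 by ring.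
by have [y2 _] := expi_pi3; rewrite u3E sqrrN y2; ring.
Qed.

Lemma u9 : u ^+ 9 = 1.
Proof. by transitivity (u ^+ 6 * u ^+ 3); [ring|rewrite u6; ring: u6]. Qed.

Lemma u_neq0 : u != 0.
Proof. by rewrite oppr_eq0 expi_neq0. Qed.

Lemma uV : u^-1 = u ^+ 8.
Proof. by apply: (mulIf u_neq0); rewrite mulVf ?u_neq0// -exprSr u9. Qed.

Lemma u_conj : u^* = u ^+ 8.
Proof. by rewrite -uV rmorphN /= expi_conj invrN. Qed.

Lemma r3E : r3%:C%C * 'i%C = 1 + 2 * u ^+ 6.
Proof.
by rewrite u6 u3E /r3; apply: complexP; rewrite /= ?cos_pi3; field.
Qed.

Lemma r3_gt0 : 0 < r3.
Proof. by have [_] := expi_pi3; rewrite /r3 /=; lra. Qed.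

Lemma r3_sqr : r3 ^+ 2 = 3.
Proof.
have := cos2Dsin2 (pi / 3 : R); rewrite cos_pi3 /r3 => h.
by rewrite exprMn; move: h; lra.
Qed.

End RootsOfUnity.

(** * Embeddings of the ring of integers and integral form of the generators *)

Section Embedding.
Context {R : realType}.
Local Notation C := (Cplx R).
Local Notation u := (u : C).

Fact root_w : root_of (q := 1) (u ^+ 6 : C).
Proof. by apply/eqP; rewrite u6; ring: (@u6 R). Qed.

(* The field Q(w, s) is embedded by sending w to exp(2 i pi / 3) and s to a root
   t of x^2 + x + 2. *)
Record embedding := Embedding {
  emb :> C;
  emb_root : emb ^+ 2 + emb + 2 = 0;
  emb_conj : emb^* = -1 - emb }.

Fact root_emb (t : embedding) : root_of (q := 2) (t : C).
Proof. by apply/eqP; exact: emb_root. Qed.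

Fact s4_root : (sigma4 : C) ^+ 2 + sigma4 + 2 = 0.
Proof. by have [] := @sigma4_facts R. Qed.
Fact s4_conj : (sigma4 : C)^* = -1 - sigma4.
Proof. by have [] := @sigma4_facts R. Qed.
Definition emb_s4 : embedding := Embedding s4_root s4_conj.
Fact conj_root : (sigma4^* : C) ^+ 2 + sigma4^* + 2 = 0.
Proof. by have [r c _] := @sigma4_facts R; rewrite c -r; ring. Qed.
Fact conj_conj : ((sigma4^* : C)^*) = -1 - sigma4^*.
Proof. by have [r c _] := @sigma4_facts R; rewrite conjCK c; ring. Qed.
Definition emb_s4c : embedding := Embedding conj_root conj_conj.

Section Ev.
Context {K : comNzRingType} (f : {rmorphism K -> C}).
Definition ev (t : embedding) : {rmorphism E K -> C} := qev (qev f root_w) (root_emb t).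

Lemma evE t x : ev t x = f (qre (qre x)) + f (qim (qre x)) * u ^+ 6
  + (f (qre (qim x)) + f (qim (qim x)) * u ^+ 6) * emb t.
Proof. by []. Qed.

Lemma ev_w t : ev t ew = u ^+ 6.
Proof. by rewrite evE /= rmorph0 rmorph1; ring. Qed.
Lemma ev_s t : ev t es = emb t.
Proof. by rewrite evE /= rmorph0 rmorph1; ring. Qed.

Lemma ev_conj t x : (forall a, (f a)^* = f a) -> ev t (econj x) = (ev t x)^*.
Proof.
case: x => [[a b] [c d]] cf; rewrite econjE !evE /=.
rewrite !(rmorphD, rmorphM, rmorphXn, rmorphB) /= !cf u_conj emb_conj.
have u48 : (u ^+ 8) ^+ 6 = - u ^+ 6 - 1.
  by transitivity ((u ^+ 9) ^+ 5 * u ^+ 3); [ring|rewrite u9 u6; ring].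
by rewrite u48; ring.
Qed.
End Ev.

Definition Dm : 'M[C]_3 := diag_mx (\row_i u ^+ i).
Definition Dv : 'M[C]_3 := diag_mx (\row_i u ^- i).

Lemma DmV : Dm *m Dv = 1%:M.
Proof.
apply/matrixP => i j; rewrite mul_diag_mx !mxE.
by case: eqP => // _; rewrite ?mulr0// mulr1n mulfV// expf_neq0// u_neq0.
Qed.
Lemma DvD : Dv *m Dm = 1%:M.
Proof. exact: mulmx1C DmV. Qed.

(** Inverse powers of u are written with u^-1 = u^8, so that entrywise identities become ring
    identities modulo u^9 = 1. *)
Lemma DmE (M : 'M[C]_3) i j : (Dm *m M *m Dv) i j = u ^+ i * M i j * u ^+ (8 * j).
Proof. by rewrite mul_diag_mx mul_mx_diag !mxE -exprVn uV exprM. Qed.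

(** Here R_1 = u^7 times the conjugate of [genA], a complex reflection of order 3, and J = u^8 times
    the conjugate of [genB]. *)
Definition genA (K : comNzRingType) : 'M[E K]_3 :=
  mat3 [:: [:: ew; ew ^+ 2 * es; - (ew * econj es)]; [:: 0; 1; 0]; [:: 0; 0; 1]].
Definition genAV (K : comNzRingType) : 'M[E K]_3 :=
  mat3 [:: [:: ew ^+ 2; - (ew * es); econj es]; [:: 0; 1; 0]; [:: 0; 0; 1]].
Definition genB (K : comNzRingType) : 'M[E K]_3 :=
  mat3 [:: [:: 0; 0; ew ^+ 2]; [:: 1; 0; 0]; [:: 0; 1; 0]].
Definition genBV (K : comNzRingType) : 'M[E K]_3 :=
  mat3 [:: [:: 0; 1; 0]; [:: 0; 0; 1]; [:: ew; 0; 0]].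

Definition conjD (M : 'M[C]_3) : 'M[C]_3 := Dm *m M *m Dv.

Definition intf : {rmorphism int -> C} := intr.

Lemma R1mxE (t : embedding) :
  R1mx (2 * pi / 3) t = u ^+ 7 *: conjD (map_mx (ev intf t) (genA _)).
Proof.
have e2 : expi (2 * pi / 3 / 3 : R) = u ^+ 2.
  rewrite (_ : 2 * pi / 3 / 3 = 2%:R * (pi / 9)); last by field.
  by rewrite expiMn /u sqrrN.
have e4 : expi (2 * (2 * pi / 3) / 3 : R) = u ^+ 4.
  rewrite (_ : 2 * (2 * pi / 3) / 3 = 2%:R * (2 * pi / 3 / 3)); last by field.
  by rewrite expiMn e2 -exprM.
have em2 : expi (- (2 * pi / 3 / 3) : R) = u ^+ 7.
  by rewrite expiN e2 -exprVn uV -exprM (_ : (8 * 2 = 9 + 7)%N)// exprD u9 mul1r.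
apply/mat3P => i j; rewrite [RHS]mxE DmE /R1mx e2 e4 em2 map_mat3 /= !mxE.
have s9 := @u9 R; have t2 := emb_conj t.
case: i => [[|[|[|//]]] ?]; case: j => [[|[|[|//]]] ?] /=;
 rewrite ?(rmorph0, rmorph1, rmorphM, rmorphN, rmorphXn) ?ev_conj ?ev_w ?ev_s.
all: try by rewrite /intf; ring: s9.
by move=> a; rewrite /intf /= rmorph_int.
Qed.

Lemma JmxE (t : embedding) : Jmx = u ^+ 8 *: conjD (map_mx (ev intf t) (genB _)).
Proof.
apply/mat3P => i j; rewrite [RHS]mxE DmE map_mat3 /= !mxE.
have s9 := @u9 R.
case: i => [[|[|[|//]]] ?]; case: j => [[|[|[|//]]] ?] /=;
  rewrite ?(rmorph0, rmorph1, rmorphXn) ?ev_w; rewrite /intf; ring: s9.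
Qed.

Definition hC (t : embedding) : 'M[C]_3 :=
  let th : C := 1 + 2 * u ^+ 6 in
  mat3 [:: [:: 3; th * emb t; - (th * u ^+ 12 * (-1 - emb t))];
           [:: - (th * (-1 - emb t)); 3; th * emb t];
           [:: th * u ^+ 6 * emb t; - (th * (-1 - emb t)); 3] ].

Lemma map_ev_eherm (K : comNzRingType) (f : {rmorphism K -> C}) t :
  (forall a, (f a)^* = f a) -> map_mx (ev f t) eherm = hC t.
Proof.
move=> cf; rewrite /eherm map_mat3 /=.
rewrite !(rmorphXn, rmorphN, rmorphM, rmorphD, rmorph_nat, rmorph1).
by rewrite !ev_conj// !ev_w !ev_s emb_conj -exprM.
Qed.

Lemma HmxE (t : embedding) : r3%:C%C *: Hmx (2 * pi / 3) t = conjD (hC t).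
Proof.
have em1 : expi (- (2 * pi / 3 / 6) : R) = - u ^+ 8.
  rewrite (_ : 2 * pi / 3 / 6 = pi / 9); last by field.
  by rewrite expiN -uV /u invrN opprK.
have e1 : expi (2 * pi / 3 / 6 : R) = - u.
  rewrite (_ : 2 * pi / 3 / 6 = pi / 9); last by field.
  by rewrite /u opprK.
have rE : 2 * sin (2 * pi / 3 / 2 : R) = r3.
  by rewrite /r3; congr (_ * sin _); field.
apply/mat3P => i j; rewrite /conjD DmE /Hmx em1 e1 rE !mxE emb_conj.
have r32 : r3%:C%C ^+ 2 = 3 :> C by rewrite -rmorphXn r3_sqr rmorph_nat.
have s9 := @u9 R; have r3i := @r3E R.
case: i => [[|[|[|//]]] ?]; case: j => [[|[|[|//]]] ?] /=;
  try (rewrite -expr2 r32; ring: s9);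
  rewrite -?r3i; ring: s9.
Qed.

Lemma genA_inv (K : comNzRingType) : genA K *m genAV K = 1%:M.
Proof.
apply/mat3P => i j; rewrite !mxE !big_ord_recl big_ord0 !mxE.
case: i => [[|[|[|//]]] ?]; case: j => [[|[|[|//]]] ?] /=;
  by apply: quadP; apply: quadP; rewrite /= /idfun /=; ring.
Qed.

Lemma genB_inv (K : comNzRingType) : genB K *m genBV K = 1%:M.
Proof.
apply/mat3P => i j; rewrite !mxE !big_ord_recl big_ord0 !mxE.
case: i => [[|[|[|//]]] ?]; case: j => [[|[|[|//]]] ?] /=;
  by apply: quadP; apply: quadP; rewrite /= /idfun /=; ring.
Qed.

End Embedding.

Lemma invmx_eq (K : comUnitRingType) n (x y : 'M[K]_n) :
  x *m y = 1%:M -> invmx x = y.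
Proof.
by move=> xy; have [xu _] := mulmx1_unit xy; rewrite -[LHS]mulmx1 -xy mulKmx.
Qed.

(** * The real points as a product of two unitary groups *)

Section AlgebraicGroup.
Context {R : realType}.
Local Notation C := (Cplx R).
Local Notation u := (u : C).
Local Notation m := ((3 + 3) + (3 + 3))%N.
Local Notation conjf := (Num.conj : {rmorphism C -> C}).

Lemma pointsE (F : numFieldType) (x : 'M[F]_m) :
  @points m SU_equations F x <-> x = resE (unresE x) /\ eSU (unresE x).
Proof.
rewrite -(SU_equationsP (ratr : {rmorphism rat -> F}) x).
split=> [[_ h] //|h]; split => //.
have [xE sx] := proj1 (SU_equationsP _ x) h.
have := congr1 resE (eSU_inv sx); rewrite resEM resE1 -xE => e.
by have [] := mulmx1_unit e.
Qed.

Lemma points_group (F : numFieldType) : mx_group (@points m SU_equations F).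
Proof.
split.
- by apply/pointsE; rewrite -resE1 resEK; split; [|exact: eSU1].
- move=> x y /pointsE[xE sx] /pointsE[yE sy]; apply/pointsE.
  have e := resE_closedM xE yE.
  split; first by rewrite {2}e resEK.
  by rewrite e resEK; apply: eSUM.
- by move=> x [].
- move=> x xS; have /pointsE[xE sx] := xS.
  have Yi := eSU_inv sx.
  have : x *m resE (\adj (unresE x)) = 1%:M.
    by have := congr1 resE Yi; rewrite resEM resE1 -xE.
  move=> /invmx_eq ->.
  apply/pointsE.
  rewrite resEK.
  split.
    reflexivity.
  exact: eSUV Yi sx.
Qed.

Lemma conjDM (M N : 'M[C]_3) : conjD (M *m N) = conjD M *m conjD N.
Proof. by rewrite /conjD !mulmxA -(mulmxA _ Dv) DvD mulmx1. Qed.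
Lemma conjD1 : conjD 1%:M = 1%:M :> 'M[C]_3.
Proof. by rewrite /conjD mulmx1 DmV. Qed.

Definition conjV (M : 'M[C]_3) : 'M[C]_3 := Dv *m M *m Dm.
Lemma conjDK : cancel conjD conjV.
Proof. by move=> M; rewrite /conjV /conjD !mulmxA DvD mul1mx -mulmxA DvD mulmx1. Qed.
Lemma conjVK : cancel conjV conjD.
Proof. by move=> M; rewrite /conjV /conjD !mulmxA DmV mul1mx -mulmxA DmV mulmx1. Qed.

Lemma adj_conjD (M : 'M[C]_3) : adj conjf (conjD M) = conjD (adj conjf M).
Proof.
have aD : adj conjf Dm = Dv.
  apply/matrixP => i j; rewrite !mxE rmorphMn rmorphXn /= u_conj -uV exprVn.
  by rewrite eq_sym; case: eqP => // ->.
have aV : adj conjf Dv = Dm.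
  apply/matrixP => i j; rewrite !mxE rmorphMn /= fmorphV rmorphXn /= u_conj -uV.
  by rewrite exprVn invrK eq_sym; case: eqP => // ->.
by rewrite /conjD !adjM aD aV mulmxA.
Qed.

Lemma det_conjD (M : 'M[C]_3) : \det (conjD M) = \det M.
Proof.
rewrite /conjD !det_mulmx mulrAC -det_mulmx DmV det1; exact: mul1r.
Qed.

Definition psi3 : R := 2 * pi / 3.

Lemma SU_conjD (t : embedding) (M : 'M[C]_3) :
  SU_set (Hmx psi3 t) (conjD M) <-> special_unitary conjf (hC t) M.
Proof.
have r0 : r3%:C%C != 0 :> C by rewrite (inj_eq (@complexI R)) gt_eqF ?r3_gt0.
rewrite /SU_set /special_unitary /= det_conjD.
have -> : (conjD M) ^t* = conjD (adj conjf M) by rewrite -adj_conjD /adj map_trmx.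
suff -> : (conjD (adj conjf M) *m Hmx psi3 t *m conjD M = Hmx psi3 t) <->
  (adj conjf M *m hC t *m M = hC t) by [].
have hE := HmxE t.
split=> h.
  apply: (can_inj conjDK); rewrite !conjDM -hE -[RHS]/(_ *: _).
  by rewrite -scalemxAr -scalemxAl h.
apply: (scalerI r0); rewrite scalemxAl scalemxAr hE -!conjDM.
by rewrite h.
Qed.

Definition realf : {rmorphism R -> C} := real_complex R.
Lemma realf_conj a : (realf a)^* = realf a.
Proof. exact: conjc_real. Qed.
Lemma intf_conj a : (@intf R a)^* = intf a.
Proof. by rewrite /intf /= rmorph_int. Qed.

Section Ev.
Context {K : comNzRingType} (f : {rmorphism K -> C}) (cf : forall a, (f a)^* = f a).
Lemma map_ev_adj t (Y : 'M[E K]_3) :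
  map_mx (ev f t) (adj econj Y) = adj conjf (map_mx (ev f t) Y).
Proof. by apply/matrixP => i j; rewrite !mxE ev_conj. Qed.

Lemma special_unitary_ev t (Y : 'M[E K]_3) : eSU Y ->
  special_unitary conjf (hC t) (map_mx (ev f t) Y).
Proof.
move=> [Yh dY]; split; last by rewrite det_map_mx dY rmorph1.
by rewrite -map_ev_adj -(map_ev_eherm t cf) -!map_mxM Yh.
Qed.
End Ev.

Local Notation t1 := (@emb_s4c R).
Local Notation t2 := (@emb_s4 R).

Lemma Im_u6 : complex.Im (u ^+ 6) = r3 / 2.
Proof.
have := congr1 (@complex.Im R) (@r3E R); rewrite u6 u3E /= /r3 => _.
by rewrite -[X in _ = X]/(_ / 2); field.
Qed.

Lemma Re_u6 : complex.Re (u ^+ 6) = - (1 / 2).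
Proof. by rewrite u6 u3E /= cos_pi3; field. Qed.

(** The coordinates of P in the real basis 1, u^6 = (-1 + i sqrt 3) / 2 of C. *)
Definition of_complex (P : C) : quad 1 R :=
  Quad (complex.Re P + complex.Im P / r3) (2 * complex.Im P / r3).

Definition ev1 (x : quad 1 R) : C := realf (qre x) + realf (qim x) * u ^+ 6.

Lemma of_complexK P : ev1 (of_complex P) = P.
Proof.
have r0 : r3 != 0 :> R by rewrite gt_eqF ?r3_gt0.
rewrite /ev1 /= [u ^+ 6](complexE) Re_u6 Im_u6; apply: complexP => /=; field => //.
Qed.

Lemma ev1_inj : injective ev1.
Proof.
have r0 : r3 != 0 :> R by rewrite gt_eqF ?r3_gt0.
apply: (can_inj (g := of_complex)) => -[a b].
rewrite /ev1 /= [u ^+ 6](complexE) Re_u6 Im_u6 /of_complex.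
by apply: quadP => /=; field.
Qed.

Lemma emb_diff : emb t1 - emb t2 != 0.
Proof.
have [_ _ im] := @sigma4_facts R.
have e : complex.Im (sigma4^* : C) = - complex.Im (sigma4 : C).
  by rewrite conjCE; case: sigma4.
rewrite subr_eq0; apply/eqP => /(congr1 (@complex.Im R)).
change (complex.Im (sigma4^* : C) = complex.Im (sigma4 : C) -> False).
by rewrite e; move: im; move: (complex.Im _) => x; lra.
Qed.

(** Linear interpolation: the element p + q s that takes the values w1 and w2 at the two roots of
    x^2 + x + 2. It inverts the isomorphism of [E R] with C x C. *)
Definition inv12 (w1 w2 : C) : E R :=
  let q := (w1 - w2) / (emb t1 - emb t2) in
  Quad (of_complex (w1 - q * emb t1)) (of_complex q).

Lemma ev_ev1 t (x : E R) : ev realf t x = ev1 (qre x) + ev1 (qim x) * emb t.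
Proof. by []. Qed.

Lemma ev1_inv12 w1 w2 : ev realf t1 (inv12 w1 w2) = w1.
Proof. by rewrite ev_ev1 /= !of_complexK subrK. Qed.

Lemma ev2_inv12 w1 w2 : ev realf t2 (inv12 w1 w2) = w2.
Proof.
have d := emb_diff; rewrite ev_ev1 /inv12; set q := _ / _.
change (ev1 (of_complex (w1 - q * emb t1)) + ev1 (of_complex q) * emb t2 = w2).
rewrite !of_complexK /q.
transitivity (w1 - (w1 - w2) / (emb t1 - emb t2) * (emb t1 - emb t2)); first by ring.
by rewrite divfK// opprB addrC subrK.
Qed.

Lemma ev12_inj (x y : E R) :
  ev realf t1 x = ev realf t1 y -> ev realf t2 x = ev realf t2 y -> x = y.
Proof.
have d := emb_diff; rewrite !ev_ev1 => h1 h2.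
have e2 : ev1 (qim x) = ev1 (qim y).
  apply: (mulIf d).
  transitivity (ev1 (qre x) + ev1 (qim x) * emb t1 - (ev1 (qre x) + ev1 (qim x) * emb t2)).
    by ring.
  by rewrite h1 h2; ring.
apply: quadP; apply: ev1_inj => //.
by move: h1; rewrite e2 => /addIr.
Qed.

Definition phi (t : embedding) (X : 'M[R]_m) : 'M[C]_3 :=
  locked_with res_key (conjD (map_mx (ev realf t) (unresE X))).
(* phi t1 and phi t2 identify the real points with SU(H1) x SU(H2); Psi is the inverse. *)
Definition Psi (g1 g2 : 'M[C]_3) : 'M[R]_m := locked_with res_key
  (resE (\matrix_(i, j) inv12 (conjV g1 i j) (conjV g2 i j))).

Lemma phiE t X : phi t X = conjD (map_mx (ev realf t) (unresE X)).
Proof. by rewrite /phi unlock. Qed.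
Lemma Psi_unlock g1 g2 :
  Psi g1 g2 = resE (\matrix_(i, j) inv12 (conjV g1 i j) (conjV g2 i j)).
Proof. by rewrite /Psi unlock. Qed.

Lemma phi1_Psi g1 g2 : phi t1 (Psi g1 g2) = g1.
Proof.
rewrite phiE Psi_unlock resEK -[RHS]conjVK; congr conjD.
by apply/matrixP => i j; rewrite mxE [X in ev _ _ X]mxE ev1_inv12.
Qed.

Lemma phi2_Psi g1 g2 : phi t2 (Psi g1 g2) = g2.
Proof.
rewrite phiE Psi_unlock resEK -[RHS]conjVK; congr conjD.
by apply/matrixP => i j; rewrite mxE [X in ev _ _ X]mxE ev2_inv12.
Qed.

Lemma map_ev12_inj (Y Z : 'M[E R]_3) :
  map_mx (ev realf t1) Y = map_mx (ev realf t1) Z ->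
  map_mx (ev realf t2) Y = map_mx (ev realf t2) Z -> Y = Z.
Proof.
move=> /matrixP h1 /matrixP h2; apply/matrixP => i j.
by apply: ev12_inj; [have := h1 i j|have := h2 i j]; rewrite !mxE.
Qed.

Lemma phi_inj X Y : X = resE (unresE X) -> Y = resE (unresE Y) ->
  phi t1 X = phi t1 Y -> phi t2 X = phi t2 Y -> X = Y.
Proof.
move=> xE yE h1 h2; rewrite xE yE.
apply: (congr1 resE).
rewrite !phiE in h1 h2.
by apply: map_ev12_inj; apply: (can_inj conjDK); [exact: h1|exact: h2].
Qed.

Lemma phiM t X Y : X = resE (unresE X) -> Y = resE (unresE Y) ->
  phi t (X *m Y) = phi t X *m phi t Y.
Proof.
move=> xE yE.
by rewrite (resE_closedM xE yE) !phiE resEK map_mxM conjDM.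
Qed.

Lemma PsiE g1 g2 : Psi g1 g2 = resE (unresE (Psi g1 g2)).
Proof. by rewrite Psi_unlock resEK. Qed.

(** The two embeddings are jointly injective on [E R], so the unitarity equations over [E R] amount
    to those over C at each embedding. *)
Lemma pointsRP X : @points m SU_equations R X <->
  [/\ X = resE (unresE X), SU_set (Hmx psi3 t1) (phi t1 X) & SU_set (Hmx psi3 t2) (phi t2 X)].
Proof.
rewrite pointsE !phiE; split=> [[XE sX]|[XE s1 s2]]; split => //.
- by apply/SU_conjD; apply: special_unitary_ev => //; exact: realf_conj.
- by apply/SU_conjD; apply: special_unitary_ev => //; exact: realf_conj.
- move: s1 s2 => /SU_conjD[h1 d1] /SU_conjD[h2 d2]; split.
    apply: map_ev12_inj; rewrite !map_mxM map_ev_adj; try exact: realf_conj;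
    by rewrite map_ev_eherm//; exact: realf_conj.
  by apply: ev12_inj; rewrite -det_map_mx rmorph1.
Qed.

Lemma Psi_points g1 g2 : SU_set (Hmx psi3 t1) g1 -> SU_set (Hmx psi3 t2) g2 ->
  @points m SU_equations R (Psi g1 g2).
Proof. by move=> s1 s2; apply/pointsRP; rewrite phi1_Psi phi2_Psi -PsiE. Qed.

Lemma PsiM g1 g2 h1 h2 : Psi (g1 *m h1) (g2 *m h2) = Psi g1 g2 *m Psi h1 h2.
Proof.
apply: phi_inj.
- exact: PsiE.
- exact: resE_closed (PsiE g1 g2) (PsiE h1 h2).
- apply: etrans (phi1_Psi _ _) (esym (etrans (phiM _ (PsiE g1 g2) (PsiE h1 h2)) _)).
  exact: f_equal2 (phi1_Psi g1 g2) (phi1_Psi h1 h2).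
- apply: etrans (phi2_Psi _ _) (esym (etrans (phiM _ (PsiE g1 g2) (PsiE h1 h2)) _)).
  exact: f_equal2 (phi2_Psi g1 g2) (phi2_Psi h1 h2).
Qed.

Lemma resE_1 : 1%:M = resE (unresE 1%:M) :> 'M[R]_m.
Proof. by rewrite -resE1 resEK. Qed.

Lemma phi_1 t : phi t 1%:M = 1%:M.
Proof. by rewrite phiE -resE1 resEK map_mx1 conjD1. Qed.

Lemma Psi1 : Psi 1%:M 1%:M = 1%:M.
Proof.
apply: phi_inj; [exact: PsiE|exact: resE_1| |].
- exact: etrans (phi1_Psi _ _) (esym (phi_1 _)).
- exact: etrans (phi2_Psi _ _) (esym (phi_1 _)).
Qed.

End AlgebraicGroup.

(** * The identity component of a matrix group *)

Section IdentityComponent.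
Context {R : realType} {n : nat} (G : set 'M[R]_n).
Hypothesis GG : mx_group G.
Let S0 := connected_component G 1%:M.

Let connected_translate (x : 'M[R]_n) (A : set 'M[R]_n) :
  connected A -> connected [set x *m y | y in A].
Proof.
move=> cA; apply: connected_continuous_connected => //.
apply: continuous_subspaceT; apply: continuous_mulmx => y; [exact: cst_continuous|exact: cvg_id].
Qed.

(** The translate x S0 is connected and contains x, so it lies in the component of x, which is
    S0. *)
Lemma identity_componentM x y : S0 x -> S0 y -> S0 (x *m y).
Proof.
have [G1 GM GU GV] := GG; move=> Sx Sy.
have Gx := connected_component_sub Sx.
rewrite /S0 (same_connected_component Sx).
have : [set x *m y | y in S0] `<=` connected_component G x.
  apply: connected_component_max.
  - by exists 1%:M; [exact: connected_component_refl|rewrite mulmx1].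
  - by move=> _ [z /connected_component_sub Gz <-]; exact: GM.
  - by apply: connected_translate; exact: component_connected.
by apply; exists y.
Qed.

(** The translate of S0 by x^-1 is connected and contains x^-1 x = 1, so it lies in S0; it also
    contains x^-1. *)
Lemma identity_componentV x : S0 x -> S0 (invmx x).
Proof.
have [G1 GM GU GV] := GG; move=> Sx.
have Gx := connected_component_sub Sx.
have : [set invmx x *m y | y in S0] `<=` S0.
  apply: connected_component_max.
  - by exists x => //; rewrite mulVmx//; exact: GU.
  - by move=> _ [z /connected_component_sub Gz <-]; apply: GM => //; exact: GV.
  - by apply: connected_translate; exact: component_connected.
by apply; exists 1%:M; [exact: connected_component_refl|rewrite mulmx1].
Qed.
End IdentityComponent.

(** * Continuity of the two projections and of the inverse identification *)

Lemma continuous_block (R : realType) (T : topologicalType) n (a b c d : T -> 'M[R]_n) :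
  continuous a -> continuous b -> continuous c -> continuous d ->
  continuous (fun x => block_mx (a x) (b x) (c x) (d x)).
Proof.
move=> /continuous_mxP ca /continuous_mxP cb /continuous_mxP cc /continuous_mxP cd.
apply/continuous_mxP => i j.
case: (split_ordP i) => i' ->; case: (split_ordP j) => j' ->.
- by rewrite (_ : (fun=> _) = (fun x => a x i' j'))//; apply/funext => x; rewrite block_mxEul.
- by rewrite (_ : (fun=> _) = (fun x => b x i' j'))//; apply/funext => x; rewrite block_mxEur.
- by rewrite (_ : (fun=> _) = (fun x => c x i' j'))//; apply/funext => x; rewrite block_mxEdl.
- by rewrite (_ : (fun=> _) = (fun x => d x i' j'))//; apply/funext => x; rewrite block_mxEdr.
Qed.

Lemma continuous_addf (K : numFieldType) (T : topologicalType) (f g : T -> K) :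
  continuous f -> continuous g -> continuous (fun x => f x + g x).
Proof. by move=> cf cg x; apply: cvgD; [exact: cf|exact: cg]. Qed.

Lemma continuous_mulf (K : numFieldType) (T : topologicalType) (f g : T -> K) :
  continuous f -> continuous g -> continuous (fun x => f x * g x).
Proof. by move=> cf cg x; apply: cvgM; [exact: cf|exact: cg]. Qed.

Section Continuity.
Context {R : realType}.
Local Notation C := (Cplx R).
Local Notation u := (u : C).
Local Notation m := ((3 + 3) + (3 + 3))%N.
Local Notation t1 := (@emb_s4c R).
Local Notation t2 := (@emb_s4 R).

Lemma continuous_resE (T : topologicalType) (Y : T -> 'M[E R]_3) :
  (forall i j, continuous (fun x => qre (qre (Y x i j)))) ->
  (forall i j, continuous (fun x => qim (qre (Y x i j)))) ->
  (forall i j, continuous (fun x => qre (qim (Y x i j)))) ->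
  (forall i j, continuous (fun x => qim (qim (Y x i j)))) ->
  continuous (fun x => resE (Y x)).
Proof.
move=> ca cb cc cd.
pose a x := \matrix_(i, j) qre (qre (Y x i j)).
pose b x := \matrix_(i, j) qim (qre (Y x i j)).
pose c x := \matrix_(i, j) qre (qim (Y x i j)).
pose d x := \matrix_(i, j) qim (qim (Y x i j)).
have Ca : continuous a.
  by apply/continuous_mxP => i j; rewrite (_ : (fun=> _) = (fun x => qre (qre (Y x i j))))//; apply/funext => x; rewrite mxE.
have Cb : continuous b.
  by apply/continuous_mxP => i j; rewrite (_ : (fun=> _) = (fun x => qim (qre (Y x i j))))//; apply/funext => x; rewrite mxE.
have Cc : continuous c.
  by apply/continuous_mxP => i j; rewrite (_ : (fun=> _) = (fun x => qre (qim (Y x i j))))//; apply/funext => x; rewrite mxE.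
have Cd : continuous d.
  by apply/continuous_mxP => i j; rewrite (_ : (fun=> _) = (fun x => qim (qim (Y x i j))))//; apply/funext => x; rewrite mxE.
have mulc k n (f : T -> 'M[R]_n) : continuous f -> continuous (fun x => k *: f x).
  move=> cf; rewrite (_ : (fun=> _) = (fun x => k%:M *m f x)).
    by apply: continuous_mulmx; [move=> x; exact: cst_continuous|exact: cf].
  by apply/funext => x; rewrite mul_scalar_mx.
have block n (k : R) (f g : T -> 'M[R]_n) : continuous f -> continuous g ->
    continuous (fun x => block_mx (f x) ((- k) *: g x) (g x) (f x + (-1) *: g x)).
  move=> cf cg; apply: continuous_block; [exact: cf|exact: mulc|exact: cg|].
  by apply: continuous_addmx; [exact: cf|exact: mulc].
pose X x := block_mx (a x) ((- 2) *: c x) (c x) (a x + (-1) *: c x).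
pose Z x := block_mx (b x) ((- 2) *: d x) (d x) (b x + (-1) *: d x).
rewrite (_ : (fun=> _) = (fun x => block_mx (X x) ((- 1) *: Z x) (Z x) (X x + (-1) *: Z x))).
  by apply: (block _ 1 X Z); apply: (block _ 2); [exact: Ca|exact: Cc|exact: Cb|exact: Cd].
apply/funext => x; rewrite resE_unlock /res_mx.
have n2 (y : quad 1 R) : 2 * y = y + y by ring.
have -> : map_mx qre (block_mx (map_mx qre (Y x)) (- (2 *: map_mx qim (Y x))) (map_mx qim (Y x))
     (map_mx qre (Y x) - map_mx qim (Y x))) = X x.
  by rewrite map_block_mx; congr block_mx; apply/matrixP => i j; rewrite !mxE ?n2 //=; ring.
have -> : map_mx qim (block_mx (map_mx qre (Y x)) (- (2 *: map_mx qim (Y x))) (map_mx qim (Y x))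
     (map_mx qre (Y x) - map_mx qim (Y x))) = Z x.
  by rewrite map_block_mx; congr block_mx; apply/matrixP => i j; rewrite !mxE ?n2 //=; ring.
by rewrite !scaleN1r scale1r.
Qed.

Lemma continuous_of_complex (T : topologicalType) (f : T -> C) : continuous f ->
  continuous (fun x => qre (of_complex (f x))) /\
  continuous (fun x => qim (of_complex (f x))).
Proof.
move=> cf.
have cre : continuous (fun x => complex.Re (f x)).
  by move=> x; apply: (@continuous_comp _ _ _ f (fun z : C => complex.Re z)); [exact: cf|exact: continuous_Re].
have cim : continuous (fun x => complex.Im (f x)).
  by move=> x; apply: (@continuous_comp _ _ _ f (fun z : C => complex.Im z)); [exact: cf|exact: continuous_Im].
split=> x /=.
  by apply: cvgD; [exact: cre|apply: cvgM; [exact: cim|exact: cvg_cst]].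
by apply: cvgM; [apply: cvgM; [exact: cvg_cst|exact: cim]|exact: cvg_cst].
Qed.

Lemma continuous_conjV (T : topologicalType) (f : T -> 'M[C]_3) :
  continuous f -> continuous (fun x => conjV (f x)).
Proof.
move=> cf; apply: continuous_mulmx; last by move=> x; exact: cst_continuous.
by apply: continuous_mulmx; [move=> x; exact: cst_continuous|exact: cf].
Qed.

Lemma continuous_Psi (T : topologicalType) (f g : T -> 'M[C]_3) :
  continuous f -> continuous g -> continuous (fun x => Psi (f x) (g x)).
Proof.
move=> /continuous_conjV/continuous_mxP cf /continuous_conjV/continuous_mxP cg.
pose q i j x := (conjV (f x) i j - conjV (g x) i j) / (emb t1 - emb t2).
have cq i j : continuous (q i j).
  by move=> x; apply: cvgM; [apply: cvgB; [exact: cf|exact: cg]|exact: cvg_cst].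
pose p i j x := conjV (f x) i j - q i j x * emb t1.
have cp i j : continuous (p i j).
  by move=> x; apply: cvgB; [exact: cf|apply: cvgM; [exact: cq|exact: cvg_cst]].
pose Y x := \matrix_(i, j) inv12 (conjV (f x) i j) (conjV (g x) i j).
have YE x i j : Y x i j = Quad (of_complex (p i j x)) (of_complex (q i j x)).
  by rewrite mxE.
rewrite (_ : (fun=> _) = (fun x => resE (Y x))).
  apply: continuous_resE => i j.
  - rewrite (_ : (fun=> _) = (fun x => qre (of_complex (p i j x)))).
      by case: (continuous_of_complex (@cp i j)).
    by apply/funext => x; rewrite YE.
  - rewrite (_ : (fun=> _) = (fun x => qim (of_complex (p i j x)))).
      by case: (continuous_of_complex (@cp i j)).
    by apply/funext => x; rewrite YE.
  - rewrite (_ : (fun=> _) = (fun x => qre (of_complex (q i j x)))).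
      by case: (continuous_of_complex (@cq i j)).
    by apply/funext => x; rewrite YE.
  - rewrite (_ : (fun=> _) = (fun x => qim (of_complex (q i j x)))).
      by case: (continuous_of_complex (@cq i j)).
    by apply/funext => x; rewrite YE.
by apply/funext => x; rewrite Psi_unlock.
Qed.

Lemma continuous_phi t : continuous (@phi R t).
Proof.
rewrite (_ : @phi R t = (fun X => conjD (map_mx (ev realf t) (unresE X)))); last first.
  by apply/funext => X; rewrite phiE.
apply: continuous_mulmx; last by move=> x; exact: cst_continuous.
apply: continuous_mulmx; first by move=> x; exact: cst_continuous.
apply/continuous_mxP => i j.
pose l k := lshift 3 (lshift 0 k) .
pose c (a b : 'I_m) (X : 'M[R]_m) : C := realf (X a b).
have cc a b : continuous (c a b).
  move=> X; apply: (@continuous_comp _ _ _ (fun X : 'M[R]_m => X a b) (fun x : R => x%:C%C : C)).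
    exact: coord_continuous.
  exact: continuous_real_complex.
rewrite (_ : (fun=> _) = (fun X =>
  c (lshift _ (lshift _ i)) (lshift _ (lshift _ j)) X
  + c (rshift _ (lshift _ i)) (lshift _ (lshift _ j)) X * u ^+ 6
  + (c (lshift _ (rshift _ i)) (lshift _ (lshift _ j)) X
  + c (rshift _ (rshift _ i)) (lshift _ (lshift _ j)) X * u ^+ 6) * emb t)).
  have cst (k : C) : continuous (fun _ : 'M[R]_m => k) by exact: cst_continuous.
  have lin a b a' b' k : continuous (fun X => c a b X + c a' b' X * k).
    apply: continuous_addf; first exact: cc.
    by apply: continuous_mulf; [exact: cc|exact: cst].
  apply: continuous_addf; first exact: lin.
  by apply: continuous_mulf; [exact: lin|exact: cst].
by apply/funext => X; rewrite mxE evE unresE_unlock !mxE.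
Qed.

Lemma closed_points : closed (@points m SU_equations R).
Proof.
have cSU t : closed (@phi R t @^-1` SU (Hmx psi3 t)).
  apply: closed_comp => [X _|]; [exact: continuous_phi|exact: closed_SU].
have cE : closed [set X : 'M[R]_m | X = resE (unresE X)].
  have cc a b : continuous (fun X : 'M[R]_m => X a b) by exact: coord_continuous.
  apply: closed_eq_mx; first by move=> X; exact: cvg_id.
  apply: continuous_resE => i j.
  - rewrite (_ : (fun=> _) = (fun X : 'M[R]_m => X (lshift _ (lshift _ i)) (lshift _ (lshift _ j)))).
      exact: cc.
    by apply/funext => X; rewrite unresE_unlock !mxE.
  - rewrite (_ : (fun=> _) = (fun X : 'M[R]_m => X (rshift _ (lshift _ i)) (lshift _ (lshift _ j)))).
      exact: cc.
    by apply/funext => X; rewrite unresE_unlock !mxE.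
  - rewrite (_ : (fun=> _) = (fun X : 'M[R]_m => X (lshift _ (rshift _ i)) (lshift _ (lshift _ j)))).
      exact: cc.
    by apply/funext => X; rewrite unresE_unlock !mxE.
  - rewrite (_ : (fun=> _) = (fun X : 'M[R]_m => X (rshift _ (rshift _ i)) (lshift _ (lshift _ j)))).
      exact: cc.
    by apply/funext => X; rewrite unresE_unlock !mxE.
rewrite (_ : @points m SU_equations R = [set X | X = resE (unresE X)] `&`
  ((@phi R t1) @^-1` (SU (Hmx psi3 t1)) `&` (@phi R t2) @^-1` (SU (Hmx psi3 t2)))).
  by apply: closedI; [exact: cE|apply: closedI; exact: cSU].
apply/seteqP; split => X.
  by move=> /pointsRP[h1 h2 h3]; split; [exact: h1|split; [exact: h2|exact: h3]].
by move=> [h1 [h2 h3]]; apply/pointsRP; split; [exact: h1|exact: h2|exact: h3].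
Qed.

End Continuity.

(** * One-parameter groups through the generators *)

Lemma det3 (K : comNzRingType) (M : 'M[K]_3) : let c i j := M (inord i) (inord j) in
  \det M = c 0 0 * (c 1 1 * c 2 2 - c 1 2 * c 2 1)
    - c 0 1 * (c 1 0 * c 2 2 - c 1 2 * c 2 0)
    + c 0 2 * (c 1 0 * c 2 1 - c 1 1 * c 2 0).
Proof.
have E (i j : 'I_3) : M i j = M (inord i) (inord j) by rewrite !inord_val.
rewrite (expand_det_row _ ord0) !big_ord_recl big_ord0 /cofactor.
rewrite !(expand_det_row _ ord0) !big_ord_recl !big_ord0 /cofactor !det_mx11.
rewrite !mxE !(E (lift _ _)) !(E ord0) /= /bump /=; ring.
Qed.

Lemma det_mat3 (K : comNzRingType) (a b c d e f g h i : K) :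
  \det (mat3 [:: [:: a; b; c]; [:: d; e; f]; [:: g; h; i]]) =
  a * (e * i - f * h) - b * (d * i - f * g) + c * (d * h - e * g).
Proof. by rewrite det3 /= !mxE !inordK. Qed.

Section Paths.
Context {R : realType}.
Local Notation C := (Cplx R).
Local Notation u := (u : C).
Local Notation m := ((3 + 3) + (3 + 3))%N.
Local Notation conjf := (Num.conj : {rmorphism C -> C}).

Definition S0 : set 'M[R]_m := identity_component SU_equations.

(* The complex reflection of angle l with the same mirror as R_1. *)
Definition reflection (W s l : C) : 'M[C]_3 :=
  let k := (l - 1) * (- W - 2) / 3 in
  mat3 [:: [:: l; k * ((- W - 1) * s); - (k * (W * (-1 - s)))]; [:: 0; 1; 0]; [:: 0; 0; 1]].

(** This is [hC] with free parameters, so that its invariance becomes an identity modulo the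
    quadratic relations of W and s. *)
Definition herm (W s : C) : 'M[C]_3 :=
  let th := 1 + 2 * W in
  mat3 [:: [:: 3; th * s; - (th * (- W - 1) * (-1 - s))];
           [:: - (th * (-1 - s)); 3; th * s];
           [:: th * W * s; - (th * (-1 - s)); 3] ].

Lemma reflection_unitary (W s l : C) : W ^+ 2 = - W - 1 -> s ^+ 2 = - s - 2 ->
  l * l^* = 1 -> W^* = - W - 1 -> s^* = -1 - s ->
  adj conjf (reflection W s l) *m herm W s *m reflection W s l = herm W s.
Proof.
(* The conjugate of l becomes a separate variable, tied to l only by l l' = 1. *)
move=> hW hs; have [l' l'E] : exists l', l' = l^* by exists l^*.
rewrite -l'E => hl cW cs.
have aE : adj conjf (reflection W s l) = let k := (l' - 1) * (W - 1) / 3 in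
    mat3 [:: [:: l'; 0; 0]; [:: k * (W * (-1 - s)); 1; 0]; [:: - (k * ((- W - 1) * s)); 0; 1]].
  apply/mat3P => i j; rewrite !mxE.
  case: i => [[|[|[|//]]] ?]; case: j => [[|[|[|//]]] ?] /=;
    rewrite ?(rmorph0, rmorph1, rmorphN, rmorphM, rmorphB, fmorphV, rmorph_nat) /= ?cW ?cs -?l'E //; by field.
rewrite aE; apply/mat3P => i j.
rewrite !mxE !big_ord_recl big_ord0 !mxE !big_ord_recl !big_ord0 !mxE.
case: i => [[|[|[|//]]] ?]; case: j => [[|[|[|//]]] ?] /=; by field: hW hs hl.
Qed.

Lemma u6_conj : (u ^+ 6)^* = - u ^+ 6 - 1.
Proof.
rewrite rmorphXn /= u_conj -exprM (_ : (8 * 6 = 9 * 5 + 3)%N)// exprD exprM u9.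
by rewrite expr1n mul1r u6; ring.
Qed.
Lemma u12 : (u ^+ 6) ^+ 2 = - u ^+ 6 - 1.
Proof. by rewrite -exprM (_ : (6 * 2 = 9 + 3)%N)// exprD u9 mul1r u6; ring. Qed.
Lemma emb_sqr (t : @embedding R) : emb t ^+ 2 = - emb t - 2.
Proof. by apply/eqP; rewrite -subr_eq0 -(emb_root t); apply/eqP; ring. Qed.

Lemma hC_herm (t : @embedding R) : hC t = herm (u ^+ 6) (emb t).
Proof. by rewrite /hC /herm (_ : u ^+ 12 = - u ^+ 6 - 1)// -u12 -exprM. Qed.

(** The reflection by exp(3ix) has that number as its determinant; the scalar exp(-ix) makes the
    determinant 1. The value at x = 2 pi / 9 is R_1. *)
Definition R1path (t : @embedding R) (x : R) : 'M[C]_3 :=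
  conjD (expi (- x) *: reflection (u ^+ 6) (emb t) (expi (3%:R * x))).

Lemma R1path_SU (t : @embedding R) x : SU_set (Hmx psi3 t) (R1path t x).
Proof.
apply/SU_conjD; set l := expi (3%:R * x); set e := expi (- x).
have l0 : l * l^* = 1 by rewrite expi_conj mulfV// expi_neq0.
have el : e ^+ 3 * l = 1 by rewrite /l expiMn -exprMn -expiD addNr expi0 expr1n.
have e0 : e^* * e = 1 by rewrite expi_conj mulVf// expi_neq0.
split; last first.
  by rewrite detZ det_mat3; transitivity (e ^+ 3 * l); [ring|exact: el].
have -> : adj conjf (e *: reflection (u ^+ 6) (emb t) l) = e^* *: adj conjf (reflection (u ^+ 6) (emb t) l).
  by apply/matrixP => i j; rewrite !mxE rmorphM.
rewrite -!scalemxAl -scalemxAr scalerA e0 scale1r hC_herm.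
apply: reflection_unitary; [exact: u12|exact: emb_sqr|exact: l0|exact: u6_conj|exact: emb_conj].
Qed.

Lemma R1path0 t : R1path t 0 = 1%:M.
Proof.
rewrite /R1path oppr0 mulr0 !expi0 scale1r /reflection subrr !mul0r oppr0.
rewrite -[RHS]conjD1; congr conjD; apply/mat3P => i j; rewrite !mxE.
by case: i => [[|[|[|//]]] ?]; case: j => [[|[|[|//]]] ?].
Qed.

Lemma R1path1 t : R1path t (2 * pi / 9) = R1mx psi3 (emb t).
Proof.
rewrite R1mxE /R1path.
have -> : expi (- (2 * pi / 9)) = u ^+ 7.
  rewrite expiN (_ : 2 * pi / 9 = 2%:R * (pi / 9)); last by field.
  rewrite expiMn -[expi _]opprK sqrrN -/u -exprVn uV -exprM.
  by rewrite (_ : (8 * 2 = 9 + 7)%N)// exprD u9 mul1r.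
have -> : expi (3%:R * (2 * pi / 9)) = u ^+ 6.
  rewrite (_ : 3%:R * (2 * pi / 9) = 6%:R * (pi / 9)); last by field.
  by rewrite expiMn /u; ring.
have -> (M : 'M[C]_3) : conjD (u ^+ 7 *: M) = u ^+ 7 *: conjD M.
  by rewrite /conjD -scalemxAr -scalemxAl.
(* Since (-W - 2) / 3 is the inverse of W - 1 for W = u^6, the coefficient k of the reflection
   equals 1 at l = W. *)
congr (_ *: conjD _); rewrite map_mat3 /= !(rmorph0, rmorph1, rmorphXn, rmorphN, rmorphM).
rewrite (ev_conj _ _ intf_conj) !ev_w !ev_s emb_conj u12 /reflection.
have h12 := u12; have h : (u ^+ 6 - 1) * (- u ^+ 6 - 2) / 3 = 1.
  by move: h12; move: (u ^+ 6) => W hW; field: hW.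
by rewrite h !mul1r.
Qed.

(** The circulant matrix with eigenvalues 1, exp(ix), exp(-ix). It commutes with the circulant form
    H for all parameters, and at x = 2 pi / 3 its eigenvalues become those of J. *)
Definition Jpath (x : R) : 'M[C]_3 :=
  let W := u ^+ 6 in let e := expi x in let f := expi (- x) in
  let a := (1 + e + f) / 3 in
  let b := (1 + (- W - 1) * e + W * f) / 3 in
  let c := (1 + W * e + (- W - 1) * f) / 3 in
  mat3 [:: [:: a; c; b]; [:: b; a; c]; [:: c; b; a]].

Lemma Jpath_SU psi tau x : SU_set (Hmx psi tau) (Jpath x).
Proof.
rewrite /Jpath; have h12 := u12; have h6 := u6_conj.
have ee : expi x * expi (- x) = 1 :> C by rewrite -expiD subrr expi0.
have eC : (expi x)^* = expi (- x) :> C by rewrite expi_conj expiN.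
have fC : (expi (- x))^* = expi x :> C by rewrite expi_conj expiN invrK.
move: ee eC fC h12 h6; move: (u ^+ 6) (expi x) (expi (- x)) => W e f ee eC fC hW WC.
split=> /=; last by rewrite det_mat3; field: hW ee.
set a := (1 + e + f) / 3; set b := (1 + _ * e + W * f) / 3; set c := (1 + W * e + _) / 3.
have aC : a^* = a by rewrite /a !(rmorphD, rmorphM, rmorph1, fmorphV, rmorph_nat) /= eC fC; field.
have bC : b^* = b.
  by rewrite /b !(rmorphD, rmorphM, rmorph1, fmorphV, rmorph_nat, rmorphB, rmorphN) /= eC fC WC; field.
have cC : c^* = c.
  by rewrite /c !(rmorphD, rmorphM, rmorph1, fmorphV, rmorph_nat, rmorphB, rmorphN) /= eC fC WC; field.
(* The entries are real; this relation and the next say that the circulant matrix is orthogonal. *)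
have h1 : a ^+ 2 + b ^+ 2 + c ^+ 2 = 1 by rewrite /a /b /c; field: hW ee.
have h2 : a * b = - b * c - a * c by rewrite /a /b /c; field: hW ee.
have h1' : a ^+ 2 = 1 - b ^+ 2 - c ^+ 2 by rewrite -h1; ring.
clearbody a b c; rewrite /Hmx; move: (_%:C%C) (- _) (_ * tau^*) => p q r.
apply/mat3P => i j.
rewrite !mxE !big_ord_recl big_ord0 !mxE !big_ord_recl !big_ord0 !mxE.
case: i => [[|[|[|//]]] ?]; case: j => [[|[|[|//]]] ?] /=;
  rewrite ?aC ?bC ?cC; by ring: h1' h2.
Qed.

Lemma Jpath0 : Jpath 0 = 1%:M.
Proof.
rewrite /Jpath oppr0 !expi0; apply/mat3P => i j; rewrite !mxE.
by case: i => [[|[|[|//]]] ?]; case: j => [[|[|[|//]]] ?] /=; field.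
Qed.

Lemma Jpath1 : Jpath (2 * pi / 3) = Jmx.
Proof.
rewrite /Jpath.
have e6 : expi (2 * pi / 3) = u ^+ 6.
  rewrite (_ : 2 * pi / 3 = 6%:R * (pi / 9)); last by field.
  by rewrite expiMn /u; ring.
have -> : expi (- (2 * pi / 3)) = - u ^+ 6 - 1 :> C.
  by rewrite expiN -expi_conj e6 u6_conj.
rewrite e6; have := u12; move: (u ^+ 6) => W hW.
apply/mat3P => i j; rewrite !mxE.
by case: i => [[|[|[|//]]] ?]; case: j => [[|[|[|//]]] ?] /=; field: hW.
Qed.
End Paths.

(** * The triangle group inside the arithmetic group *)

Section Lifting.
Context {R : realType}.
Local Notation C := (Cplx R).
Local Notation u := (u : C).
Local Notation m := ((3 + 3) + (3 + 3))%N.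
Local Notation t1 := (@emb_s4c R).
Local Notation t2 := (@emb_s4 R).
Local Notation H1 := (Hmx psi3 (emb t1)).
Local Notation H2 := (Hmx psi3 (emb t2)).

Lemma continuous_expi (k : R) : continuous (fun x : R => expi (k * x) : C).
Proof.
have ck : continuous (fun x : R => k * x).
  by apply: continuous_mulf; [exact: cst_continuous|move=> x; exact: cvg_id].
apply: continuous_complexP => /= x.
  by apply: (@continuous_comp _ _ _ (fun x : R => k * x) cos); [exact: ck|exact: continuous_cos].
by apply: (@continuous_comp _ _ _ (fun x : R => k * x) sin); [exact: ck|exact: continuous_sin].
Qed.

Lemma continuous_expiN : continuous (fun x : R => expi (- x) : C).
Proof.
rewrite (_ : (fun=> _) = (fun x => expi (-1 * x))); first exact: continuous_expi.
by apply/funext => x; rewrite mulN1r.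
Qed.

Lemma continuous_affine (T : topologicalType) (f : T -> C) (a b : C) :
  continuous f -> continuous (fun x => a * f x + b).
Proof.
move=> cf; apply: continuous_addf; last exact: cst_continuous.
by apply: continuous_mulf; [exact: cst_continuous|exact: cf].
Qed.

Lemma continuous_R1path t : continuous (@R1path R t).
Proof.
have cst (M : 'M[C]_3) : continuous (fun _ : R => M) by exact: cst_continuous.
apply: continuous_mulmx; last exact: cst.
apply: continuous_mulmx; first exact: cst.
apply/continuous_mxP => i j.
have cl := @continuous_expi 3%:R; have ce := continuous_expiN.
have [a [b ab]] : exists a b, forall l, reflection (u ^+ 6) (emb t) l i j = a * l + b.
  set W := u ^+ 6; set s := emb t.
  case: i => [[|[|[|//]]] ?]; case: j => [[|[|[|//]]] ?].
  - by exists 1, 0 => l; rewrite !mxE /=; ring.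
  - exists ((- W - 2) / 3 * ((- W - 1) * s)), (- ((- W - 2) / 3 * ((- W - 1) * s))) => l.
    by rewrite !mxE /=; field.
  - exists (- ((- W - 2) / 3 * (W * (-1 - s)))), ((- W - 2) / 3 * (W * (-1 - s))) => l.
    by rewrite !mxE /=; field.
  - by exists 0, 0 => l; rewrite !mxE /=; ring.
  - by exists 0, 1 => l; rewrite !mxE /=; ring.
  - by exists 0, 0 => l; rewrite !mxE /=; ring.
  - by exists 0, 0 => l; rewrite !mxE /=; ring.
  - by exists 0, 0 => l; rewrite !mxE /=; ring.
  - by exists 0, 1 => l; rewrite !mxE /=; ring.
rewrite (_ : (fun=> _) = (fun x : R => expi (- x) * (a * expi (3%:R * x) + b))).
  by apply: continuous_mulf; [exact: ce|exact: (@continuous_affine _ _ a b cl)].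
by apply/funext => x; rewrite mxE ab.
Qed.

Lemma continuous_Jpath : continuous (@Jpath R).
Proof.
have cl := @continuous_expi 1; have ce := continuous_expiN.
have lin (a b : C) : continuous (fun x : R => (1 + a * expi x + b * expi (- x)) / 3).
  rewrite (_ : (fun=> _) = (fun x : R => a / 3 * expi (1 * x) + (b / 3 * expi (- x) + 1 / 3))).
    apply: continuous_addf; last exact: (@continuous_affine _ _ (b / 3) (1 / 3) ce).
    by apply: continuous_mulf; [exact: cst_continuous|exact: cl].
  by apply/funext => x; rewrite mul1r; field.
have ca := lin 1 1; have cb := lin (- u ^+ 6 - 1) (u ^+ 6).
have cc := lin (u ^+ 6) (- u ^+ 6 - 1).
apply/continuous_mxP => i j.
have [a [b ab]] : exists a b : C, forall x : R, Jpath x i j = (1 + a * expi x + b * expi (- x)) / 3.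
  case: i => [[|[|[|//]]] ?]; case: j => [[|[|[|//]]] ?].
  - by exists 1, 1 => x; rewrite !mxE /= !mul1r.
  - by exists (u ^+ 6), (- u ^+ 6 - 1) => x; rewrite !mxE /=.
  - by exists (- u ^+ 6 - 1), (u ^+ 6) => x; rewrite !mxE /=.
  - by exists (- u ^+ 6 - 1), (u ^+ 6) => x; rewrite !mxE /=.
  - by exists 1, 1 => x; rewrite !mxE /= !mul1r.
  - by exists (u ^+ 6), (- u ^+ 6 - 1) => x; rewrite !mxE /=.
  - by exists (u ^+ 6), (- u ^+ 6 - 1) => x; rewrite !mxE /=.
  - by exists (- u ^+ 6 - 1), (u ^+ 6) => x; rewrite !mxE /=.
  - by exists 1, 1 => x; rewrite !mxE /= !mul1r.
rewrite (_ : (fun=> _) = (fun x : R => (1 + a * expi x + b * expi (- x)) / 3)); first exact: lin.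
by apply/funext => x; exact: ab.
Qed.

(** The image of the segment [0, x] is a connected set of real points that contains 1. Each
    generator and its Galois conjugate are joined to 1 by such a pair of paths. *)
Lemma S0_path (f g : R -> 'M[C]_3) x : continuous f -> continuous g ->
  f 0 = 1%:M -> g 0 = 1%:M -> (forall y, SU_set H1 (f y)) -> (forall y, SU_set H2 (g y)) ->
  0 <= x -> S0 (Psi (f x) (g x)).
Proof.
move=> cf cg f0 g0 Sf Sg x0.
have cP := @continuous_Psi R _ f g cf cg.
have : [set Psi (f y) (g y) | y in `[0, x]] `<=` S0.
  apply: connected_component_max.
  - by exists 0; [rewrite /= in_itv /= lexx|rewrite f0 g0; exact: Psi1].
  - by move=> _ [y _ <-]; apply: Psi_points; [exact: Sf|exact: Sg].
  - apply: connected_continuous_connected; first exact: segment_connected.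
    apply: continuous_subspaceT; exact: cP.
by apply; exists x; [rewrite /= in_itv /= x0 lexx|].
Qed.

(* Elements of the group are, up to a power of u, conjugate by Dm to matrices Y
   over the ring of integers, and lie with their Galois conjugate g2 in the
   identity component. *)
Definition lifted_at k (g : 'M[C]_3) : Prop := exists g2 (Y Y' : 'M[E int]_3),
  [/\ SU_set H1 g /\ SU_set H2 g2, g = u ^+ k *: conjD (map_mx (ev intf t1) Y),
   g2 = u ^+ k *: conjD (map_mx (ev intf t2) Y), Y *m Y' = 1%:M & S0 (Psi g g2)].

Definition lifted (g : 'M[C]_3) : Prop := exists k, lifted_at k g.

Lemma lifted_R1 : lifted (R1mx psi3 (emb t1)).
Proof.
exists 7%N, (R1mx psi3 (emb t2)), (genA _), (genAV _); split.
- by rewrite -!R1path1; split; exact: R1path_SU.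
- exact: R1mxE.
- exact: R1mxE.
- exact: genA_inv.
- rewrite -!R1path1; apply: (@S0_path (R1path t1) (R1path t2)).
  - exact: continuous_R1path.
  - exact: continuous_R1path.
  - exact: R1path0.
  - exact: R1path0.
  - by move=> y; exact: R1path_SU.
  - by move=> y; exact: R1path_SU.
  - by have := pi_gt0 R; lra.
Qed.

Lemma lifted_J : lifted Jmx.
Proof.
exists 8%N, Jmx, (genB _), (genBV _); split.
- by rewrite -Jpath1; split; exact: Jpath_SU.
- exact: JmxE.
- exact: JmxE.
- exact: genB_inv.
- rewrite -Jpath1; apply: (@S0_path (@Jpath R) (@Jpath R)).
  - exact: continuous_Jpath.
  - exact: continuous_Jpath.
  - exact: Jpath0.
  - exact: Jpath0.
  - by move=> y; exact: Jpath_SU.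
  - by move=> y; exact: Jpath_SU.
  - by have := pi_gt0 R; lra.
Qed.

Lemma scale_conjDM (a b : C) (M N : 'M[C]_3) :
  (a *: conjD M) *m (b *: conjD N) = (a * b) *: conjD (M *m N).
Proof. by rewrite conjDM -scalemxAl -scalemxAr scalerA. Qed.

Lemma lift_mul t k l (Y Z : 'M[E int]_3) :
  (u ^+ k *: conjD (map_mx (ev intf t) Y)) *m (u ^+ l *: conjD (map_mx (ev intf t) Z))
  = u ^+ (k + l) *: conjD (map_mx (ev intf t) (Y *m Z)).
Proof. by rewrite scale_conjDM exprD (map_mxM (ev intf t) Y Z). Qed.

Lemma lift1 t k (Y Z : 'M[E int]_3) : Y *m Z = 1%:M ->
  (u ^+ k *: conjD (map_mx (ev intf t) Y)) *m
  (u ^+ (8 * k) *: conjD (map_mx (ev intf t) Z)) = 1%:M.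
Proof.
by move=> YZ; rewrite lift_mul YZ map_mx1 conjD1 -mulSn exprM u9 expr1n scale1r.
Qed.

Lemma lifted_at1 : lifted_at 0 1%:M.
Proof.
have [H11 _ _ _] := mxgroupP (SU H1); have [H21 _ _ _] := mxgroupP (SU H2).
exists 1%:M, 1%:M, 1%:M; rewrite !map_mx1 !conjD1 expr0 !scale1r; split.
- by split; [exact: H11|exact: H21].
- by [].
- by [].
- by rewrite mulmx1.
- rewrite Psi1; apply: connected_component_refl.
  by have [h _ _ _] := points_group R; exact: h.
Qed.

Lemma lifted_atM k l x y : lifted_at k x -> lifted_at l y -> lifted_at (k + l) (x *m y).
Proof.
have [_ H1M _ _] := mxgroupP (SU H1); have [_ H2M _ _] := mxgroupP (SU H2).
move=> [x2 [Y [Y' [[x1S x2S] xE x2E YY xS]]]] [y2 [Z [Z' [[y1S y2S] yE y2E ZZ yS]]]].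
exists (x2 *m y2), (Y *m Z), (Z' *m Y'); split.
- by split; [exact: H1M|exact: H2M].
- by rewrite xE yE; exact: lift_mul.
- by rewrite x2E y2E; exact: lift_mul.
- by rewrite mulmxA -(mulmxA Y) ZZ mulmx1.
- by rewrite PsiM; exact: (identity_componentM (points_group R) xS yS).
Qed.

Lemma lifted_atV k x : lifted_at k x -> lifted_at (8 * k) (invmx x).
Proof.
have [_ _ H1U H1V] := mxgroupP (SU H1); have [_ _ H2U H2V] := mxgroupP (SU H2).
move=> [x2 [Y [Y' [[x1S x2S] xE x2E YY xS]]]].
have inv t (z : 'M[C]_3) : z = u ^+ k *: conjD (map_mx (ev intf t) Y) ->
    invmx z = u ^+ (8 * k) *: conjD (map_mx (ev intf t) Y').
  by move=> ->; apply: invmx_eq; exact: lift1.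
exists (invmx x2), Y', Y; split.
- by split; [exact: H1V|exact: H2V].
- exact: inv.
- exact: inv.
- exact: mulmx1C.
- suff -> : Psi (invmx x) (invmx x2) = invmx (Psi x x2).
    exact: (identity_componentV (points_group R) xS).
  by apply/esym/invmx_eq; rewrite -PsiM !mulmxV; [exact: Psi1|exact: H2U|exact: H1U].
Qed.

(** Only nine exponents matter. This bounds the index of the elements of exponent 0, and the number
    of lifted matrices of bounded size. *)
Lemma lifted_at_mod k x : lifted_at k x -> lifted_at (k %% 9) x.
Proof.
by rewrite /lifted_at (expr_mod k (@u9 R)).
Qed.

Lemma lifted_group : mx_group lifted.
Proof.
have [_ _ H1U _] := mxgroupP (SU H1); split.
- by exists 0%N; exact: lifted_at1.
- by move=> x y [k xk] [l yl]; exists (k + l)%N; exact: lifted_atM.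
- by move=> x [k [x2 [Y [Y' [[x1S _] _ _ _ _]]]]]; exact: H1U.
- by move=> x [k xk]; exists (8 * k)%N; exact: lifted_atV.
Qed.

Lemma triangle_lifted : triangle_group psi3 (emb t1) `<=` lifted.
Proof.
apply: smallest_sub; first exact: lifted_group.
by move=> x /= [->|->]; [exact: lifted_R1|exact: lifted_J].
Qed.

End Lifting.

(** * A certified covering of a shell in R^4 *)

Section ZtoField.
Context {F : realFieldType}.

(** The certificates are computed in the binary integers [Z]; this map carries their outcome to the
    ordered field. *)
Definition zr (z : Z) : F := (int_of_Z z)%:~R.

Lemma zr0 : zr 0 = 0. Proof. by []. Qed.
Lemma zrD x y : zr (x + y)%ZZ = zr x + zr y.
Proof. by rewrite /zr -rmorphD; congr (_ %:~R); lia. Qed.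
Lemma zrM x y : zr (x * y)%ZZ = zr x * zr y.
Proof. by rewrite /zr -rmorphM; congr (_ %:~R); lia. Qed.
Lemma zrN x : zr (- x)%ZZ = - zr x.
Proof. by rewrite /zr -rmorphN; congr (_ %:~R); lia. Qed.
Lemma zrB x y : zr (x - y)%ZZ = zr x - zr y.
Proof. by rewrite /zr -rmorphB; congr (_ %:~R); lia. Qed.
Lemma zr_le x y : (x <= y)%ZZ -> zr x <= zr y.
Proof. by move=> xy; rewrite ler_int; lia. Qed.
Lemma zr_lt x y : (x < y)%ZZ -> zr x < zr y.
Proof. by move=> xy; rewrite ltr_int; lia. Qed.
Lemma zr_abs x : zr (Z.abs x) = `|zr x|.
Proof. by rewrite /zr -intr_norm; congr (_ %:~R); lia. Qed.
Lemma zr_max0 x : zr (Z.max 0 x) = Num.max 0 (zr x).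
Proof.
case: (Z.le_ge_cases 0 x) => h.
  by have := zr_le h; rewrite zr0 Z.max_r// => ?; rewrite max_r.
by have := zr_le h; rewrite zr0 Z.max_l// => ?; rewrite max_l.
Qed.

Lemma zr_div x q : (0 < q)%ZZ -> zr q * zr (x / q)%ZZ <= zr x < zr q * zr (x / q)%ZZ + zr q.
Proof.
move=> q0; have h := Z.div_mod x q; have b := Z.mod_pos_bound x q q0.
apply/andP; split.
  by rewrite -zrM; apply: zr_le; lia.
by rewrite -zrM -zrD; apply: zr_lt; lia.
Qed.

Lemma mul_approx (x y a b r s : F) : `|x - a| <= r -> `|y - b| <= s ->
  `|x * y - a * b| <= `|a| * s + r * `|b| + r * s.
Proof.
move=> xa yb; have r0 : 0 <= r := le_trans (normr_ge0 _) xa.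
rewrite (_ : x * y - a * b = a * (y - b) + (x - a) * b + (x - a) * (y - b)); last by ring.
apply: (le_trans (ler_normD _ _)); apply: lerD.
  apply: (le_trans (ler_normD _ _)); rewrite !normrM; apply: lerD.
    by rewrite ler_wpM2l.
  by rewrite ler_wpM2r.
by rewrite normrM ler_pM.
Qed.

Lemma sum_approx (x y a b r s : F) : `|x - a| <= r -> `|y - b| <= s ->
  `|x + y - (a + b)| <= r + s.
Proof.
move=> xa yb; rewrite (_ : _ - _ = (x - a) + (y - b)); last by ring.
by rewrite (le_trans (ler_normD _ _)) ?lerD.
Qed.

End ZtoField.

(* Midpoint-radius arithmetic: (m, r) encloses x when |S x - m| <= r, where the
   scale S is fixed. *)
Definition mr : Type := Z * Z.

Section MidRad.
Variable S : Z.
Hypothesis S0 : (0 < S)%ZZ.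

Definition mr_add (i j : mr) : mr := (i.1 + j.1, i.2 + j.2)%ZZ.
Definition mr_opp (i : mr) : mr := (- i.1, i.2)%ZZ.
(** The radius gains 2 because each of the two floor divisions loses less than one unit. *)
Definition mr_mul (i j : mr) : mr := ((i.1 * j.1) / S,
  (Z.abs i.1 * j.2 + i.2 * Z.abs j.1 + i.2 * j.2) / S + 2)%ZZ.
Definition cmr_add (i j : mr * mr) : mr * mr := (mr_add i.1 j.1, mr_add i.2 j.2).
Definition cmr_opp (i : mr * mr) : mr * mr := (mr_opp i.1, mr_opp i.2).
Definition cmr_mul (i j : mr * mr) : mr * mr :=
  (mr_add (mr_mul i.1 j.1) (mr_opp (mr_mul i.2 j.2)),
   mr_add (mr_mul i.1 j.2) (mr_mul i.2 j.1)).

Context {F : realFieldType}.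
Local Notation zr := (@zr F).
Definition encl (i : mr) (x : F) := `|zr S * x - zr i.1| <= zr i.2.

Lemma zrS_gt0 : 0 < zr S.
Proof. by have := @zr_lt F _ _ S0; rewrite zr0. Qed.

Lemma encl_add i j x y : encl i x -> encl j y -> encl (mr_add i j) (x + y).
Proof. by move=> ix jy; rewrite /encl /= !zrD mulrDr; exact: sum_approx. Qed.

Lemma encl_opp i x : encl i x -> encl (mr_opp i) (- x).
Proof. by rewrite /encl /= zrN mulrN -opprD normrN. Qed.

Lemma encl_mul i j x y : encl i x -> encl j y -> encl (mr_mul i j) (x * y).
Proof.
rewrite /encl => ix jy; have := mul_approx ix jy; cbn [fst snd mr_mul].
set e := (_ * _ + _ + _)%ZZ; set m := (i.1 * j.1)%ZZ.
have -> : `|zr i.1| * zr j.2 + zr i.2 * `|zr j.1| + zr i.2 * zr j.2 = zr e.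
  by rewrite /e !zrD !zrM !zr_abs.
rewrite -zrM -/m.
have /andP[e1 e2] := @zr_div F e _ S0; have /andP[m1 m2] := @zr_div F m _ S0.
have s0 := zrS_gt0.
rewrite zrD (_ : zr 2 = 2)// => h.
rewrite -(ler_pM2l s0) -[X in X * `|_|](gtr0_norm s0) -normrM.
move: h e1 e2 m1 m2 s0; rewrite !ler_norml.
move: (zr (m / S)) (zr (e / S)) (zr e) (zr m) (zr S) => a b c d s.
by move=> /andP[h1 h2] *; apply/andP; split; nra.
Qed.

End MidRad.

(** Polynomial expressions in u and in the root t, with one evaluation in midpoint-radius arithmetic
    and one in C. *)
Inductive cexpr := EU | ET | E1 | EAdd of cexpr & cexpr | EOpp of cexpr
  | EMul of cexpr & cexpr.
Fixpoint EPow e n := if n is n'.+1 then EMul e (EPow e n') else E1.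

Fixpoint evalI S (iu it : mr * mr) e := match e with
  | EU => iu | ET => it | E1 => ((S, 0%ZZ), (0%ZZ, 0%ZZ))
  | EAdd a b => cmr_add (evalI S iu it a) (evalI S iu it b)
  | EOpp a => cmr_opp (evalI S iu it a)
  | EMul a b => cmr_mul S (evalI S iu it a) (evalI S iu it b)
  end.

Fixpoint evalC (C : pzRingType) (u t : C) e := match e with
  | EU => u | ET => t | E1 => 1
  | EAdd a b => evalC u t a + evalC u t b
  | EOpp a => - evalC u t a
  | EMul a b => evalC u t a * evalC u t b
  end.

Inductive letter := LA | LV | LJ.

(* Row vectors times R_1 (LA), its inverse (LV) and J (LJ). *)
Definition act (r : cexpr * cexpr * cexpr) (l : letter) :=
  let: (a, b, c) := r in match l with
  | LA => (EMul a (EPow EU 4), EAdd (EMul a ET) (EMul b (EPow EU 7)),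
      EAdd (EMul a (EMul (EPow EU 2) (EAdd E1 ET))) (EMul c (EPow EU 7)))
  | LV => (EMul a (EPow EU 5),
      EAdd (EOpp (EMul a (EMul (EPow EU 7) ET))) (EMul b (EPow EU 2)),
      EAdd (EOpp (EMul a (EAdd E1 ET))) (EMul c (EPow EU 2)))
  | LJ => (b, c, a)
  end.

Definition word_row (w : seq letter) := foldl act (E1, E1, E1) w.

(* The values of a row vector at the three eigenvectors (1, W^k, W^2k) of H. *)
Definition fourier (r : cexpr * cexpr * cexpr) :=
  let: (a, b, c) := r in let W := EPow EU 6 in
  (EAdd a (EAdd b c), EAdd a (EAdd (EMul b W) (EMul c (EMul W W))),
   EAdd a (EAdd (EMul b (EMul W W)) (EMul c W))).

(* Found by numerical search: R_1^{+-1} and (R_1 J R_1)^{+-1}, times the powers of J. *)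
Definition words : seq (seq letter) :=
  [:: [:: LA]; [:: LA; LJ]; [:: LA; LJ; LJ]; [:: LV]; [:: LV; LJ]; [:: LV; LJ; LJ];
      [:: LA; LJ; LA]; [:: LA; LJ; LA; LJ]; [:: LA; LJ; LA; LJ; LJ];
      [:: LV; LJ; LJ; LV]; [:: LV; LJ; LJ; LV; LJ]; [:: LV; LJ; LJ; LV; LJ; LJ] ].

(* The function (ra + i rb) + (rp + i rq) v1 + (rs + i rt) v2 of (v1, v2). *)
Record irow := IRow { ra : Z; rb : Z; rp : Z; rq : Z; rs : Z; rt : Z }.

Section Cover.
Local Open Scope Z_scope.
Variables (K T : Z) (rows : seq irow) (a1 a1' a2 a2' : Z).

(** Bounds the squared modulus of the row over the whole box, at scale K T. The error e allows each
    coefficient to be off by one unit at scale K, and the terms with radii account for the extent of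
    the box. *)
Definition row_ok (b1 b2 b3 b4 : mr) (r : irow) : bool :=
  let e := T + (Z.abs b1.1 + b1.2) + (Z.abs b2.1 + b2.2) + (Z.abs b3.1 + b3.2)
    + (Z.abs b4.1 + b4.2) in
  let x := T * ra r + rp r * b1.1 + - rq r * b2.1 + rs r * b3.1 + - rt r * b4.1 in
  let y := T * rb r + rq r * b1.1 + rp r * b2.1 + rt r * b3.1 + rs r * b4.1 in
  let p := Z.abs (rp r) in let q := Z.abs (rq r) in
  let s := Z.abs (rs r) in let t := Z.abs (rt r) in
  let dx := Z.abs x + e + p * b1.2 + q * b2.2 + s * b3.2 + t * b4.2 in
  let dy := Z.abs y + e + q * b1.2 + p * b2.2 + t * b3.2 + s * b4.2 in
  100 * (dx * dx + dy * dy) <=? 99 * (K * T * (K * T)).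

Definition sqr_lo (b : mr) := let d := Z.max 0 (Z.abs b.1 - b.2) in d * d.
Definition sqr_hi (b : mr) := let d := Z.abs b.1 + b.2 in d * d.

Definition outside (b1 b2 b3 b4 : mr) : bool :=
  if 1000 * (T * T) <? a1 * (sqr_lo b1 + sqr_lo b2) + a2 * (sqr_lo b3 + sqr_lo b4)
  then true else
  100 * (a1' * (sqr_hi b1 + sqr_hi b2) + a2' * (sqr_hi b3 + sqr_hi b4)) <? 99 * (1000 * (T * T)).

(** The conditional instead of a boolean disjunction makes call-by-value evaluation stop at the
    first row that works; [outside] and [cover] follow the same pattern. *)
Fixpoint has_ok (b1 b2 b3 b4 : mr) (l : seq irow) : bool :=
  if l is r :: l' then if row_ok b1 b2 b3 b4 r then true else has_ok b1 b2 b3 b4 l'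
  else false.

Definition halves (b : mr) : mr * mr :=
  let h := b.2 / 2 in ((b.1 - h, h), (b.1 + h, h)).

(** An even radius makes the two halves cover the box without rounding. The initial radius 64 allows
    six bisections of each coordinate, and the fuel 20 spends at most five. *)
Definition even_box (b : mr) := 2 * (b.2 / 2) =? b.2.

(* Bisects a box of R^4 until every piece either misses the shell
   99/100 <= A1 (x1^2 + x2^2) + A2 (x3^2 + x4^2) <= 1, for all 1000 A1 in [a1, a1'] and
   1000 A2 in [a2, a2'], or is contracted by one of the rows; n is the fuel and d
   the next coordinate to bisect. *)
Fixpoint cover (n d : nat) (b1 b2 b3 b4 : mr) : bool :=
  if outside b1 b2 b3 b4 then true else
  if has_ok b1 b2 b3 b4 rows then true else
  if n is n'.+1 then match d with
  | 0%nat => if even_box b1 then let: (l, r) := halves b1 in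
      if cover n' 1%nat l b2 b3 b4 then cover n' 1%nat r b2 b3 b4 else false else false
  | 1%nat => if even_box b2 then let: (l, r) := halves b2 in
      if cover n' 2%nat b1 l b3 b4 then cover n' 2%nat b1 r b3 b4 else false else false
  | 2%nat => if even_box b3 then let: (l, r) := halves b3 in
      if cover n' 3%nat b1 b2 l b4 then cover n' 3%nat b1 b2 r b4 else false else false
  | _ => if even_box b4 then let: (l, r) := halves b4 in
      if cover n' 0%nat b1 b2 b3 l then cover n' 0%nat b1 b2 b3 r else false else false
  end else false.

End Cover.

Definition scale : Z := 10000000000.
(* u = - exp(i pi / 9) and sigma4^* = (-1 - i sqrt 7) / 2. *)
Definition u_encl : mr * mr := ((-9396926208, 1), (-3420201433, 4))%ZZ.
Definition t1_encl : mr * mr := ((-5000000000, 0), (-13228756555, 1))%ZZ.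
Definition row_scale : Z := 1024.
Definition box_scale : Z := 64.

(** Coefficients are rounded to the nearest integer at the coarse scale 1024, which keeps the
    numbers in the covering small; [close] certifies that the true value is within one unit. *)
Definition rnd (num den : Z) (i : mr) : Z := ((2 * row_scale * num * i.1 + den * scale) / (2 * den * scale))%ZZ.
Definition close (num den : Z) (i : mr) : bool :=
  (Z.abs (row_scale * num * i.1 - rnd num den i * den * scale) + row_scale * num * i.2 <=? den * scale)%ZZ.

Definition rowI (w : seq letter) : (mr * mr) * (mr * mr) * (mr * mr) :=
  let: (x, y, z) := fourier (word_row w) in
  (evalI scale u_encl t1_encl x, evalI scale u_encl t1_encl y, evalI scale u_encl t1_encl z).

(* The coordinates of the shell are v1 = 3/5 (x1 + i x2), v2 = 31/100 (x3 + i x4), which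
   makes it nearly round, and rows are divided by 3. *)
Definition row_of w : irow := let: (x, y, z) := rowI w in
  IRow (rnd 1 3 x.1) (rnd 1 3 x.2) (rnd 1 5 y.1) (rnd 1 5 y.2) (rnd 31 300 z.1) (rnd 31 300 z.2).
Definition row_close w : bool := let: (x, y, z) := rowI w in
  [&& close 1 3 x.1, close 1 3 x.2, close 1 5 y.1, close 1 5 y.2, close 31 300 z.1 & close 31 300 z.2].

Definition box1 : mr := (0, 64)%ZZ.
Definition rows := map row_of words.

Lemma rows_close : all row_close words.
Proof. by vm_cast_no_check (erefl true). Qed.

(** The weights are A1 = (3/5)^2 l1 and A2 = (31/100)^2 l2, where l1 and l2 are the ratios of the
    positive eigenvalues of H to the modulus of the negative one. The four numbers are integer
    bounds for 1000 A1 and 1000 A2. *)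
Lemma sphere_covered :
  cover row_scale box_scale rows 1054 1055 1026 1027 20 0 box1 box1 box1 box1.
Proof. by vm_cast_no_check (erefl true). Qed.

(** * Soundness of the covering *)

Section CoverSound.
Context {F : realFieldType}.
Local Notation zr := (@zr F).
Variables (K T : Z) (rows : seq irow) (a1 a1' a2 a2' : Z).
Hypotheses (K0 : (0 < K)%ZZ) (T0 : (0 < T)%ZZ).
Hypotheses (a1_ge0 : (0 <= a1)%ZZ) (a2_ge0 : (0 <= a2)%ZZ).

Record row_encl (r : irow) (a b p q s t : F) : Prop := RowEncl {
  _ : encl K (ra r, 1%ZZ) a; _ : encl K (rb r, 1%ZZ) b;
  _ : encl K (rp r, 1%ZZ) p; _ : encl K (rq r, 1%ZZ) q;
  _ : encl K (rs r, 1%ZZ) s; _ : encl K (rt r, 1%ZZ) t }.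

(** All coefficients enclosed by the integer row are allowed, so that the computation never handles
    the exact ones. *)
Definition small (r : irow) (x1 x2 x3 x4 : F) : Prop := forall a b p q s t,
  row_encl r a b p q s t ->
  (a + p * x1 - q * x2 + s * x3 - t * x4) ^+ 2
  + (b + q * x1 + p * x2 + t * x3 + s * x4) ^+ 2 <= 99 / 100.

Lemma zr1 : zr 1 = 1. Proof. by []. Qed.

Lemma term_approx k x (c : Z) (b : mr) : encl K (c, 1%ZZ) k -> encl T b x ->
  `|zr (K * T)%ZZ * (k * x) - zr (c * b.1)%ZZ| <= zr (Z.abs b.1 + b.2 + Z.abs c * b.2)%ZZ.
Proof.
move=> kc xb; have := mul_approx kc xb; rewrite zr1 /=.
rewrite !zrD !zrM !zr_abs (_ : zr K * zr T * (k * x) = zr K * k * (zr T * x)); last by ring.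
by move=> h; apply: (le_trans h); rewrite !mul1r; lra.
Qed.

Lemma const_approx k (c : Z) : encl K (c, 1%ZZ) k ->
  `|zr (K * T)%ZZ * k - zr (T * c)%ZZ| <= zr T.
Proof.
rewrite /encl /= zr1 !zrM => h; have t0 : 0 < zr T by have := @zr_lt F _ _ T0; rewrite zr0.
rewrite (_ : _ - _ = zr T * (zr K * k - zr c)); last by ring.
by rewrite normrM gtr0_norm// -[leRHS]mulr1 ler_pM2l.
Qed.

Lemma encl_neg S i e (x : F) : encl S (i, e) x -> encl S ((- i)%ZZ, e) (- x).
Proof. exact: encl_opp. Qed.

Lemma row_okP b1 b2 b3 b4 r x1 x2 x3 x4 : row_ok K T b1 b2 b3 b4 r ->
  encl T b1 x1 -> encl T b2 x2 -> encl T b3 x3 -> encl T b4 x4 -> small r x1 x2 x3 x4.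
Proof.
move=> /Z.leb_le ok e1 e2 e3 e4 a b p q s t [ea eb ep eq es et].
have kt0 : 0 < zr (K * T)%ZZ.
  by have := @zr_lt F _ _ (Z.mul_pos_pos _ _ K0 T0); rewrite zr0.
have nrm (x : F) (z e : Z) : `|x - zr z| <= zr e -> `|x| <= zr (Z.abs z + e)%ZZ.
  move=> h; rewrite -(subrK (zr z) x) (le_trans (ler_normD _ _))// zrD zr_abs.
  by rewrite addrC lerD2l.
have hx := sum_approx (sum_approx (sum_approx (sum_approx (const_approx ea)
  (term_approx ep e1)) (term_approx (encl_neg eq) e2)) (term_approx es e3))
  (term_approx (encl_neg et) e4).
have hy := sum_approx (sum_approx (sum_approx (sum_approx (const_approx eb)
  (term_approx eq e1)) (term_approx ep e2)) (term_approx et e3))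
  (term_approx es e4).
rewrite -!mulrDr -!zrD !mulNr in hx; rewrite -!mulrDr -!zrD in hy.
have {}hx := nrm _ _ _ hx; have {}hy := nrm _ _ _ hy.
move: ok => /(@zr_le F).
move: hx hy; set vx := a + _ + _ + _ + _; set vy := b + _ + _ + _ + _.
set dx := (_ + _)%ZZ; set dy := (_ + _)%ZZ => hx hy.
(* [row_ok] adds up the same error terms in a different order; the two matches below identify the
   sums. *)
rewrite !Z.abs_opp in dx hx.
match goal with |- is_true (zr (_ * (?dx' * _ + ?dy' * _)) <= _) -> _ =>
  have -> : dx' = dx by rewrite /dx; ring end.
match goal with |- is_true (zr (_ * (_ * _ + ?dy' * _)) <= _) -> _ =>
  have -> : dy' = dy by rewrite /dy; ring end.
rewrite [zr (99 * _)%ZZ]zrM [zr (100 * _)%ZZ]zrM [zr (_ + _)%ZZ]zrD.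
rewrite [zr (dx * dx)%ZZ]zrM [zr (dy * dy)%ZZ]zrM [zr (K * T * _)%ZZ]zrM.
rewrite (_ : zr 100 = 100)// (_ : zr 99 = 99)//.
move: hx hy kt0; rewrite !normrM => hx hy kt0 h.
have k2 : 0 < zr (K * T)%ZZ * zr (K * T)%ZZ by rewrite mulr_gt0.
rewrite -(ler_pM2l k2).
have sx : (zr (K * T)%ZZ * vx) ^+ 2 <= zr dx * zr dx.
  by rewrite -real_normK ?num_real// normrM expr2 ler_pM// mulr_ge0.
have sy : (zr (K * T)%ZZ * vy) ^+ 2 <= zr dy * zr dy.
  by rewrite -real_normK ?num_real// normrM expr2 ler_pM// mulr_ge0.
by move: sx sy h; rewrite !exprMn !expr2 mulrDr; lra.
Qed.

Lemma sqr_loP b (x : F) : encl T b x -> zr (sqr_lo b) <= (zr T * x) ^+ 2.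
Proof.
rewrite /encl /sqr_lo zrM zr_max0 zrB zr_abs => h.
have : Num.max 0 (`|zr b.1| - zr b.2) <= `|zr T * x|.
  rewrite ge_max normr_ge0 /= lerBlDr.
  rewrite -[zr b.1](subKr (zr T * x)) (le_trans (ler_normB _ _))//.
  by rewrite lerD2l.
by move=> m; rewrite -real_normK ?num_real// expr2 ler_pM// le_max lexx.
Qed.

Lemma sqr_hiP b (x : F) : encl T b x -> (zr T * x) ^+ 2 <= zr (sqr_hi b).
Proof.
rewrite /encl /sqr_hi zrM zrD zr_abs => h.
have m : `|zr T * x| <= `|zr b.1| + zr b.2.
  rewrite -(subrK (zr b.1) (zr T * x)) (le_trans (ler_normD _ _))// addrC.
  by rewrite lerD2l.
by rewrite -real_normK ?num_real// expr2 ler_pM.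
Qed.

(** The first test combines the lower weights with the point of the box nearest to the origin and
    finds a value above 1; the second combines the upper weights with the farthest point and finds a
    value below 99/100. *)
Lemma outsideP b1 b2 b3 b4 (x1 x2 x3 x4 A1 A2 : F) :
  outside T a1 a1' a2 a2' b1 b2 b3 b4 ->
  encl T b1 x1 -> encl T b2 x2 -> encl T b3 x3 -> encl T b4 x4 ->
  zr a1 <= 1000 * A1 <= zr a1' -> zr a2 <= 1000 * A2 <= zr a2' ->
  99 / 100 <= A1 * (x1 ^+ 2 + x2 ^+ 2) + A2 * (x3 ^+ 2 + x4 ^+ 2) <= 1 -> False.
Proof.
have fin (s t : F) : 100 * s < 99 * t -> t * (99 / 100) <= s -> False by lra.
move=> out e1 e2 e3 e4 /andP[h1 h1'] /andP[h2 h2'] /andP[lo hi].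
have l1 := sqr_loP e1; have l2 := sqr_loP e2; have l3 := sqr_loP e3; have l4 := sqr_loP e4.
have g1 := sqr_hiP e1; have g2 := sqr_hiP e2; have g3 := sqr_hiP e3; have g4 := sqr_hiP e4.
have lo0 b : 0 <= zr (sqr_lo b) by rewrite /sqr_lo zrM -expr2 sqr_ge0.
have t0 : 0 < zr T by have := @zr_lt F _ _ T0; rewrite zr0.
have t2 : 0 < zr T * zr T by rewrite mulr_gt0.
have t1000 : 0 < 1000 * (zr T * zr T) by exact: mulr_gt0 (ltr0n F 1000) t2.
have ineq1 (a A p q x y : F) : 0 <= a -> a <= 1000 * A ->
    p <= (zr T * x) ^+ 2 -> q <= (zr T * y) ^+ 2 -> 0 <= p -> 0 <= q ->
    a * (p + q) <= 1000 * (zr T * zr T) * (A * (x ^+ 2 + y ^+ 2)).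
  move=> a0 aA px qy p0 q0.
  have -> : 1000 * (zr T * zr T) * (A * (x ^+ 2 + y ^+ 2)) =
    1000 * A * ((zr T * x) ^+ 2 + (zr T * y) ^+ 2) by ring.
  exact: (ler_pM a0 (addr_ge0 p0 q0) aA (lerD px qy)).
have ineq2 (a A p q x y : F) : 0 <= A -> 1000 * A <= a ->
    (zr T * x) ^+ 2 <= p -> (zr T * y) ^+ 2 <= q ->
    1000 * (zr T * zr T) * (A * (x ^+ 2 + y ^+ 2)) <= a * (p + q).
  move=> a0 aA px qy.
  have -> : 1000 * (zr T * zr T) * (A * (x ^+ 2 + y ^+ 2)) =
    1000 * A * ((zr T * x) ^+ 2 + (zr T * y) ^+ 2) by ring.
  exact: (ler_pM (mulr_ge0 (ler0n F 1000) a0) (addr_ge0 (sqr_ge0 _) (sqr_ge0 _)) aA (lerD px qy)).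
have z1 := @zr_le F _ _ a1_ge0; have z2 := @zr_le F _ _ a2_ge0.
rewrite zr0 in z1 z2.
have A10 : 0 <= A1 by rewrite -(pmulr_rge0 _ (ltr0n F 1000)) (le_trans z1).
have A20 : 0 <= A2 by rewrite -(pmulr_rge0 _ (ltr0n F 1000)) (le_trans z2).
have i1 := ineq1 _ _ _ _ _ _ z1 h1 l1 l2 (lo0 _) (lo0 _).
have i2 := ineq1 _ _ _ _ _ _ z2 h2 l3 l4 (lo0 _) (lo0 _).
have j1 := ineq2 _ _ _ _ _ _ A10 h1' g1 g2.
have j2 := ineq2 _ _ _ _ _ _ A20 h2' g3 g4.
move: lo hi i1 i2 j1 j2.
move: (A1 * _) (A2 * _) => S1 S2 lo hi i1 i2 j1 j2.
have hi' : 1000 * (zr T * zr T) * (S1 + S2) <= 1000 * (zr T * zr T).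
  by rewrite -[X in _ <= X]mulr1 (ler_pM2l t1000).
have lo' : 1000 * (zr T * zr T) * (99 / 100) <= 1000 * (zr T * zr T) * (S1 + S2).
  by rewrite (ler_pM2l t1000).
move: out; rewrite /outside; case: Z.ltb_spec => [/(@zr_lt F)|_ /Z.ltb_lt/(@zr_lt F)].
  rewrite [zr (_ + _)%ZZ]zrD !(@zrM F _ (_ + _)%ZZ) !(@zrD F (sqr_lo _)).
  rewrite [zr (1000 * _)%ZZ]zrM [zr (T * T)%ZZ]zrM (_ : zr 1000 = 1000)// => out _.
  have := lt_le_trans out (lerD i1 i2).
  by rewrite -mulrDr => /lt_le_trans/(_ hi'); rewrite ltxx.
rewrite [zr (100 * _)%ZZ]zrM [zr (a1' * _ + _)%ZZ]zrD !(@zrM F _ (_ + _)%ZZ) !(@zrD F (sqr_hi _)).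
rewrite [zr (99 * _)%ZZ]zrM [zr (1000 * _)%ZZ]zrM [zr (T * T)%ZZ]zrM.
rewrite (_ : zr 99 = 99)// (_ : zr 1000 = 1000)// (_ : zr 100 = 100)// => out.
have := lerD j1 j2; rewrite -mulrDr => /(le_trans lo').
exact: fin out.
Qed.

Lemma halvesP b (x : F) : even_box b -> encl T b x ->
  encl T (halves b).1 x \/ encl T (halves b).2 x.
Proof.
move=> /Z.eqb_eq he; rewrite /encl /halves /= !zrD zrN.
have -> : zr b.2 = zr (b.2 / 2)%ZZ + zr (b.2 / 2)%ZZ.
  by rewrite -zrD; congr zr; lia.
move: (zr T * x) (zr b.1) (zr (b.2 / 2)%ZZ) => y c h.
rewrite !ler_norml => /andP[y1 y2].
by case: (lerP y c) => yc; [left|right]; apply/andP; split; lra.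
Qed.

Lemma has_okP b1 b2 b3 b4 l (x1 x2 x3 x4 : F) : has_ok K T b1 b2 b3 b4 l ->
  encl T b1 x1 -> encl T b2 x2 -> encl T b3 x3 -> encl T b4 x4 ->
  exists2 i, (i < size l)%N & small (nth (IRow 0 0 0 0 0 0)%ZZ l i) x1 x2 x3 x4.
Proof.
move=> + e1 e2 e3 e4; elim: l => //= r l IH.
case: ifP => [ok _|_ /IH[i il si]]; last by exists i.+1.
by exists 0%N => //; exact: (row_okP ok).
Qed.

Lemma coverP n d b1 b2 b3 b4 (x1 x2 x3 x4 A1 A2 : F) :
  cover K T rows a1 a1' a2 a2' n d b1 b2 b3 b4 ->
  encl T b1 x1 -> encl T b2 x2 -> encl T b3 x3 -> encl T b4 x4 ->
  zr a1 <= 1000 * A1 <= zr a1' -> zr a2 <= 1000 * A2 <= zr a2' ->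
  99 / 100 <= A1 * (x1 ^+ 2 + x2 ^+ 2) + A2 * (x3 ^+ 2 + x4 ^+ 2) <= 1 ->
  exists2 i, (i < size rows)%N & small (nth (IRow 0 0 0 0 0 0)%ZZ rows i) x1 x2 x3 x4.
Proof.
move=> + + + + + h1 h2 h; elim: n d b1 b2 b3 b4 => [|n IH] d b1 b2 b3 b4 /=.
  case: ifP => [out _ e1 e2 e3 e4|_].
    by case: (outsideP out e1 e2 e3 e4 h1 h2 h).
  by case: ifP => // ok _; exact: has_okP.
case: ifP => [out _ e1 e2 e3 e4|_].
  by case: (outsideP out e1 e2 e3 e4 h1 h2 h).
case: ifP => [ok _|_]; first exact: has_okP.
case: d => [|[|[|d]]]; case: ifP => // ev; case: ifP => // c1 c2 e1 e2 e3 e4.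
- by case: (halvesP ev e1) => e; [apply: (IH _ _ _ _ _ c1)|apply: (IH _ _ _ _ _ c2)].
- by case: (halvesP ev e2) => e; [apply: (IH _ _ _ _ _ c1)|apply: (IH _ _ _ _ _ c2)].
- by case: (halvesP ev e3) => e; [apply: (IH _ _ _ _ _ c1)|apply: (IH _ _ _ _ _ c2)].
- by case: (halvesP ev e4) => e; [apply: (IH _ _ _ _ _ c1)|apply: (IH _ _ _ _ _ c2)].
Qed.
End CoverSound.

(** * From the integer certificate to complex vectors *)

Section Enclosures.
Context {R : rcfType}.
Local Notation C := R[i].
Local Notation zr := (@zr R).

Definition enclC (i : mr * mr) (x : C) :=
  encl scale i.1 (complex.Re x) /\ encl scale i.2 (complex.Im x).

Lemma scale_gt0 : (0 < scale)%ZZ. Proof. by []. Qed.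

Lemma evalIP iu it (u t : C) e : enclC iu u -> enclC it t ->
  enclC (evalI scale iu it e) (evalC u t e).
Proof.
move=> hu ht; elim: e => //=.
- by split; rewrite /encl /= ?mulr1 ?mulr0 subrr normr0.
- move=> a [a1 a2] b [b1 b2]; move: (evalC u t a) (evalC u t b) a1 a2 b1 b2.
  by move=> [x y] [x' y'] /= *; split; exact: encl_add.
- by move=> a; case: (evalC u t a) => x y [/= *]; split; exact: encl_opp.
- move=> a [a1 a2] b [b1 b2]; move: (evalC u t a) (evalC u t b) a1 a2 b1 b2.
  move=> [x y] [x' y'] /= *; split; apply: encl_add.
  + exact: (encl_mul scale_gt0).
  + by apply: encl_opp; exact: (encl_mul scale_gt0).
  + exact: (encl_mul scale_gt0).
  + exact: (encl_mul scale_gt0).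
Qed.

Lemma closeP num den i (x : R) : (0 < den)%ZZ -> (0 <= num)%ZZ -> close num den i ->
  encl scale i x -> encl row_scale (rnd num den i, 1%ZZ) (zr num / zr den * x).
Proof.
have fieldeq (k n d z s y a : R) : d != 0 ->
    d * s * (k * (n / d * y) - z) = k * n * (s * y - a) + (k * n * a - z * d * s).
  by move=> d0; field.
move=> d0 n0 /Z.leb_le/(@zr_le R); rewrite /encl; cbn [fst snd].
have sp : 0 < zr scale by have := @zr_lt R _ _ scale_gt0; rewrite zr0.
rewrite zrD zr_abs zrB !zrM zr1; move: (zr (rnd num den i)) (zr scale) sp => z s sp.
have dp : 0 < zr den by have := @zr_lt R _ _ d0; rewrite zr0.
have np : 0 <= zr num by have := @zr_le R _ _ n0; rewrite zr0.
have kp : 0 <= zr row_scale by have := @zr_le R 0 row_scale; rewrite zr0; apply.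
move=> h e.
have ds : 0 < zr den * s by rewrite mulr_gt0.
rewrite -(ler_pM2l ds) mulr1.
rewrite -[X in X * `|_|](gtr0_norm ds) -normrM.
have -> : zr den * s * (zr row_scale * (zr num / zr den * x) - z) =
  (zr row_scale * zr num) * (s * x - zr i.1) + (zr row_scale * zr num * zr i.1 - z * zr den * s).
  by apply: fieldeq; rewrite gt_eqF.
apply: le_trans (ler_normD _ _) _; apply: (le_trans _ h); rewrite [leLHS]addrC. rewrite lerD2l.
by rewrite normrM ger0_norm ?mulr_ge0// ler_wpM2l// mulr_ge0.
Qed.

Definition normsq (x : C) : R := complex.Re x ^+ 2 + complex.Im x ^+ 2.

Definition row_value (u t : C) (w : seq letter) (v0 v1 v2 : C) : C :=
  let: (x, y, z) := fourier (word_row w) in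
  evalC u t x * v0 + evalC u t y * v1 + evalC u t z * v2.

(** With both weights at least 1, the shell lies in the cube [-1, 1]^4 from which the bisection
    starts. *)
Lemma weighted_le1 (A B p q r s : R) : 1 <= A -> 1 <= B ->
  0 <= p -> 0 <= q -> 0 <= r -> 0 <= s -> A * (p + q) + B * (r + s) <= 1 ->
  [/\ p <= 1, q <= 1, r <= 1 & s <= 1].
Proof.
move=> A1 B1 p0 q0 r0 s0 h.
have hp : p + q <= A * (p + q) by rewrite ler_peMl// addr_ge0.
have hr : r + s <= B * (r + s) by rewrite ler_peMl// addr_ge0.
by split; lra.
Qed.

Lemma leZ x : (0 <=? x)%ZZ = true -> (0 <= x)%ZZ.
Proof. by move/Z.leb_le. Qed.

(** The factor 9 undoes the division of the rows by 3. It is also the value for the empty word,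
    since the row (1, 1, 1) is 3 at the eigenvector (1, 1, 1) and 0 at the other two; the bound is
    thus a contraction by 99/100. *)
Lemma cap_cover (u t : C) (l1 l2 : R) (v1 v2 : C) : enclC u_encl u -> enclC t1_encl t ->
  1054 <= 360 * l1 <= 1055 -> 1026 <= 961 / 10 * l2 <= 1027 ->
  99 / 100 <= l1 * normsq v1 + l2 * normsq v2 <= 1 ->
  exists2 i, (i < size words)%N &
    normsq (row_value u t (nth [::] words i) 1 v1 v2) <= 9 * (99 / 100).
Proof.
move=> hu ht hl1 hl2; case: v1 v2 => [y1 y2] [y3 y4]; rewrite /normsq /= => hv.
pose x1 := 5 / 3 * y1; pose x2 := 5 / 3 * y2.
pose x3 := 100 / 31 * y3; pose x4 := 100 / 31 * y4.
have hx : 99 / 100 <= 9 / 25 * l1 * (x1 ^+ 2 + x2 ^+ 2) + (961 / 10000 * l2) * (x3 ^+ 2 + x4 ^+ 2) <= 1.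
  suff -> : 9 / 25 * l1 * (x1 ^+ 2 + x2 ^+ 2) + (961 / 10000 * l2) * (x3 ^+ 2 + x4 ^+ 2) =
    l1 * (y1 ^+ 2 + y2 ^+ 2) + l2 * (y3 ^+ 2 + y4 ^+ 2) by [].
  by rewrite /x1 /x2 /x3 /x4; field.
have box (x : R) : x ^+ 2 <= 1 -> encl box_scale box1 x.
  move=> x1p; suff : `|64 * x - 0| <= 64 by [].
  rewrite subr0 normrM.
  rewrite ger0_norm// -[leRHS]mulr1 ler_pM2l//.
  by rewrite -(expr_le1 (n := 2))// real_normK ?num_real.
have [s1 s2 s3 s4] : [/\ 0 <= x1 ^+ 2, 0 <= x2 ^+ 2, 0 <= x3 ^+ 2 & 0 <= x4 ^+ 2].
  by rewrite !sqr_ge0.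
have sq : [/\ x1 ^+ 2 <= 1, x2 ^+ 2 <= 1, x3 ^+ 2 <= 1 & x4 ^+ 2 <= 1].
  case/andP: hx => _; apply: weighted_le1 => //.
    by case/andP: hl1 => h _; clear -h; lra.
  by case/andP: hl2 => h _; clear -h; lra.
have [b1 b2 b3 b4] := sq.
have h1 : zr 1054 <= 1000 * (9 / 25 * l1) <= zr 1055.
  by rewrite (_ : 1000 * (9 / 25 * l1) = 360 * l1)//; field.
have h2 : zr 1026 <= 1000 * (961 / 10000 * l2) <= zr 1027.
  by rewrite (_ : 1000 * (961 / 10000 * l2) = 961 / 10 * l2)//; field.
have [k] := @coverP R row_scale box_scale rows 1054 1055 1026 1027 erefl erefl (@leZ 1054%ZZ erefl)
  (@leZ 1026%ZZ erefl) 20 0 box1 box1 box1 box1 x1 x2 x3 x4 _ _ sphere_covered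
  (box _ b1) (box _ b2) (box _ b3) (box _ b4) h1 h2 hx.
rewrite size_map => iw; rewrite (nth_map [::])//; set w := nth _ _ _ => hs.
exists k => //; rewrite -/w.
have := all_nthP [::] rows_close _ iw; rewrite -/w /row_close /row_value.
move: hs; rewrite /row_of /rowI; case: (fourier (word_row w)) => [[ex ey] ez] hs.
have [px1 px2] := evalIP ex hu ht; have [py1 py2] := evalIP ey hu ht.
have [pz1 pz2] := evalIP ez hu ht.
move=> /andP[c1 /andP[c2 /andP[c3 /andP[c4 /andP[c5 c6]]]]].
have z3 : zr 1 / zr 3 = 1 / 3 by [].
have z5 : zr 1 / zr 5 = 1 / 5 by [].
have z31 : zr 31 / zr 300 = 31 / 300 by [].
have q1 := closeP (erefl : (0 < 3)%ZZ) (@leZ 1%ZZ erefl) c1 px1.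
have q2 := closeP (erefl : (0 < 3)%ZZ) (@leZ 1%ZZ erefl) c2 px2.
have q3 := closeP (erefl : (0 < 5)%ZZ) (@leZ 1%ZZ erefl) c3 py1.
have q4 := closeP (erefl : (0 < 5)%ZZ) (@leZ 1%ZZ erefl) c4 py2.
have q5 := closeP (erefl : (0 < 300)%ZZ) (@leZ 31%ZZ erefl) c5 pz1.
have q6 := closeP (erefl : (0 < 300)%ZZ) (@leZ 31%ZZ erefl) c6 pz2.
have := hs _ _ _ _ _ _ (@RowEncl R row_scale (IRow _ _ _ _ _ _) _ _ _ _ _ _ q1 q2 q3 q4 q5 q6).
rewrite z3 z5 z31; move: (evalC u t ex) (evalC u t ey) (evalC u t ez).
move=> [A B] [P Q] [S U] /=.
rewrite /x1 /x2 /x3 /x4 => h.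
move: h; set L := (X in X <= _) => h.
have h9 : 9 * L <= 9 * (99 / 100) by apply: ler_wpM2l.
apply: (le_trans _ h9).
by rewrite le_eqVlt /L; apply/orP; left; apply/eqP; field.
Qed.

End Enclosures.

(** * Eigenvalues of the Hermitian form and the descent *)

Section Constants.
Context {R : realType}.
Local Notation C := (Cplx R).
Local Notation u := (u : C).
Local Notation zr := (@zr R).

Let c := cos (pi / 9 : R).
Let d := sin (pi / 9 : R).

(** The triple angle formula at pi / 9, with cos(pi / 3) = 1 / 2. *)
Lemma cos_pi9_cubic : 8 * c ^+ 3 - 6 * c - 1 = 0.
Proof.
have e : expi (pi / 3) = expi (pi / 9) ^+ 3 :> C.
  by rewrite -expiMn; congr expi; field.
have := congr1 (@complex.Re R) e; rewrite !exprS expr0 mulr1 /= cos_pi3 -/c -/d => h.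
have := cos2Dsin2 (pi / 9 : R); rewrite -/c -/d => hd.
have d2 : d ^+ 2 = 1 - c ^+ 2 by rewrite -hd; ring.
transitivity (2 * (c * (c * c - d * d) - d * (c * d + d * c)) - 1); last first.
  by rewrite -h; field.
by ring: d2.
Qed.

Lemma cos_pi9_gt : 1 / 2 < c.
Proof.
rewrite -cos_pi3 ltr_cos; have := pi_gt0 R; rewrite ?in_itv /=; lra.
Qed.

Lemma sin_pi9_gt0 : 0 < d.
Proof. by apply: sin_gt0_pi; have := pi_gt0 R; lra. Qed.

Lemma zr_leP x y : (x <=? y)%ZZ = true -> zr x <= zr y.
Proof. by move/Z.leb_le/(@zr_le R). Qed.

Lemma zr_gtP0 x : (0 <? x)%ZZ = true -> 0 < zr x.
Proof. by move/Z.ltb_lt/(@zr_lt R); rewrite zr0. Qed.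

Lemma zr_ltP0 x : (x <? 0)%ZZ = true -> zr x < 0.
Proof. by move/Z.ltb_lt/(@zr_lt R); rewrite zr0. Qed.

Lemma zr_scale_gt0 : 0 < zr scale.
Proof. exact: zr_gtP0. Qed.

(** The cubic increases for y >= A / 2, so a change of sign there brackets its root. Homogenized
    with A the scale, the signs at integer points are integer computations. *)
Lemma cubic_between (A l h y : R) : 0 < A -> A <= 2 * l -> A <= 2 * h -> A <= 2 * y ->
  8 * y ^+ 3 - 6 * y * A ^+ 2 - A ^+ 3 = 0 ->
  8 * l ^+ 3 - 6 * l * A ^+ 2 - A ^+ 3 < 0 -> 0 < 8 * h ^+ 3 - 6 * h * A ^+ 2 - A ^+ 3 ->
  l <= y <= h.
Proof.
move=> A0 lA hA yA y0 ln hp.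
have mono (x z : R) : A <= 2 * x -> A <= 2 * z -> x <= z ->
    8 * x ^+ 3 - 6 * x * A ^+ 2 - A ^+ 3 <= 8 * z ^+ 3 - 6 * z * A ^+ 2 - A ^+ 3.
  move=> xA zA xz.
  have sq : 6 * A ^+ 2 <= 8 * (x ^+ 2 + x * z + z ^+ 2) by nra.
  rewrite -subr_ge0 (_ : _ - _ = (z - x) * (8 * (x ^+ 2 + x * z + z ^+ 2) - 6 * A ^+ 2)); last by ring.
  by rewrite mulr_ge0 ?subr_ge0.
apply/andP; split; rewrite leNgt; apply/negP => /ltW bad.
- by have := mono _ _ yA lA bad; rewrite y0 leNgt ln.
- by have := mono _ _ hA yA bad; rewrite y0 leNgt hp.
Qed.

Lemma encl_between l h m e (x : R) : (m - e = l)%ZZ -> (m + e = h)%ZZ ->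
  zr l <= zr scale * x <= zr h -> encl scale (m, e) x.
Proof.
move=> <- <-; rewrite zrB zrD /encl; cbn [fst snd].
by move: (zr scale) (zr m) (zr e) => A a b /andP[h1 h2]; rewrite ler_norml; apply/andP; split; lra.
Qed.

Lemma scale_cubic (A x : R) : 0 < A -> 1 / 2 < x -> 8 * x ^+ 3 - 6 * x - 1 = 0 ->
  A <= 2 * (A * x) /\ 8 * (A * x) ^+ 3 - 6 * (A * x) * A ^+ 2 - A ^+ 3 = 0.
Proof.
move=> A0 x2 e; split; first by rewrite mulrCA -[leLHS]mulr1 ler_pM2l//; lra.
transitivity (A ^+ 3 * (8 * x ^+ 3 - 6 * x - 1)); first by ring.
by rewrite e mulr0.
Qed.

Definition cubicZ (a x : Z) := (8 * (x * x * x) - 6 * (x * a * a) - a * a * a)%ZZ.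

Lemma zr_cubic a x : zr (cubicZ a x) = 8 * zr x ^+ 3 - 6 * zr x * zr a ^+ 2 - zr a ^+ 3.
Proof.
rewrite /cubicZ !zrB !zrM (_ : zr 8 = 8)// (_ : zr 6 = 6)//.
by move: (zr x) (zr a) => y A; ring.
Qed.

Lemma zr2 x : zr (2 * x)%ZZ = 2 * zr x.
Proof. by rewrite zrM. Qed.

Lemma cos_pi9_between : zr 9396926207 <= zr scale * c <= zr 9396926209.
Proof.
have [h1 h2] := scale_cubic zr_scale_gt0 cos_pi9_gt cos_pi9_cubic.
apply: (cubic_between zr_scale_gt0 _ _ h1 h2).
- by rewrite -zr2; apply: zr_leP; vm_compute.
- by rewrite -zr2; apply: zr_leP; vm_compute.
- by rewrite -zr_cubic; apply: zr_ltP0; vm_compute.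
- by rewrite -zr_cubic; apply: zr_gtP0; vm_compute.
Qed.

Lemma encl_cos : encl scale (9396926208, 1)%ZZ c.
Proof.
exact: (@encl_between 9396926207 9396926209 9396926208 1 c erefl erefl cos_pi9_between).
Qed.

Lemma sqr_between (l h x : R) : 0 <= l -> 0 <= h -> 0 <= x ->
  l ^+ 2 <= x ^+ 2 <= h ^+ 2 -> l <= x <= h.
Proof. by move=> l0 h0 x0; rewrite !ler_sqr ?nnegrE. Qed.

Lemma zr_sq x : zr (x * x)%ZZ = zr x ^+ 2.
Proof. by rewrite zrM expr2. Qed.

Lemma zr_ge0 x : (0 <=? x)%ZZ = true -> 0 <= zr x.
Proof. by move/zr_leP; rewrite zr0. Qed.

Lemma zr_sq_add_le x y z : (x * x + y * y <=? z * z)%ZZ = true ->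
  zr x ^+ 2 + zr y ^+ 2 <= zr z ^+ 2.
Proof. by rewrite -!zr_sq -zrD; exact: zr_leP. Qed.

Lemma zr_sq_le_add x y z : (z * z <=? x * x + y * y)%ZZ = true ->
  zr z ^+ 2 <= zr x ^+ 2 + zr y ^+ 2.
Proof. by rewrite -!zr_sq -zrD; exact: zr_leP. Qed.

Lemma zr_sq_quarter x y : (4 * (x * x) <=? 7 * (y * y))%ZZ = true ->
  zr x ^+ 2 <= zr y ^+ 2 * (7 / 4).
Proof. by move/zr_leP; rewrite !zrM (_ : zr 4 = 4)// (_ : zr 7 = 7)//; lra. Qed.

Lemma zr_quarter_sq x y : (7 * (y * y) <=? 4 * (x * x))%ZZ = true ->
  zr y ^+ 2 * (7 / 4) <= zr x ^+ 2.
Proof. by move/zr_leP; rewrite !zrM (_ : zr 4 = 4)// (_ : zr 7 = 7)//; lra. Qed.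

(** Obtained from sin^2 = 1 - cos^2. The radius grows from 1 to 4 because the error of the cosine is
    multiplied by cos / sin, about 2.75 at pi / 9. *)
Lemma encl_sin : encl scale (3420201433, 4)%ZZ d.
Proof.
apply: (@encl_between 3420201429 3420201437 3420201433 4) => //.
have A0 := ltW zr_scale_gt0.
apply: sqr_between; [exact: zr_ge0|exact: zr_ge0|exact: mulr_ge0 A0 (ltW sin_pi9_gt0)|].
have /andP[c1 c2] := cos_pi9_between.
have c0 : 0 <= zr 9396926207 by exact: zr_ge0.
have sq1 := lerXn2r 2 c0 (le_trans c0 c1) c1.
have sq2 := lerXn2r 2 (le_trans c0 c1) (le_trans c0 (le_trans c1 c2)) c2.
have dE : (zr scale * d) ^+ 2 = zr scale ^+ 2 - (zr scale * c) ^+ 2.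
  have hd : d ^+ 2 = 1 - c ^+ 2.
    by have := cos2Dsin2 (pi / 9 : R); rewrite -/c -/d => <-; rewrite addrC addKr.
  by rewrite !exprMn hd mulrBr mulr1.
rewrite dE; apply/andP; split.
- rewrite lerBrDr; apply: (le_trans (lerD (lexx _) sq2)).
  by apply: zr_sq_add_le; vm_compute.
- rewrite lerBlDr; apply: (le_trans _ (lerD (lexx _) sq1)).
  by apply: zr_sq_le_add; vm_compute.
Qed.

Lemma enclC_u : enclC u_encl u.
Proof. split; [exact: encl_neg encl_cos|exact: encl_neg encl_sin]. Qed.

Lemma sigma4_Re : complex.Re (sigma4 : C) = - (1 / 2).
Proof.
have [_ h _] := @sigma4_facts R; have := congr1 (@complex.Re R) h.
case: (sigma4 : C) => x y /=; lra.
Qed.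

Lemma sigma4_Im2 : complex.Im (sigma4 : C) ^+ 2 = 7 / 4.
Proof.
have [h _ _] := @sigma4_facts R; have := congr1 (@complex.Re R) h.
have := sigma4_Re; case: (sigma4 : C) => x y /= ->; rewrite expr2; lra.
Qed.

Lemma encl_half : encl scale (-5000000000, 0)%ZZ (- (1 / 2) : R).
Proof.
apply: (@encl_between (-5000000000) (-5000000000) (-5000000000) 0) => //.
suff -> : zr scale * - (1 / 2) = zr (-5000000000) by rewrite lexx.
have -> : zr scale = 2 * - zr (-5000000000) by rewrite -zrN -zr2.
by move: (zr _) => x; field.
Qed.

Lemma encl_sigma4_Im : encl scale (13228756555, 1)%ZZ (complex.Im (sigma4 : C)).
Proof.
have [_ _ p] := @sigma4_facts R.
apply: (@encl_between 13228756554 13228756556 13228756555 1) => //.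
have A0 := zr_scale_gt0.
apply: sqr_between; [exact: zr_ge0|exact: zr_ge0|exact: mulr_ge0 (ltW A0) (ltW p)|].
rewrite exprMn sigma4_Im2; apply/andP; split.
- by apply: zr_sq_quarter; vm_compute.
- by apply: zr_quarter_sq; vm_compute.
Qed.

Definition t2_encl : mr * mr := ((-5000000000, 0), (13228756555, 1))%ZZ.

Lemma enclC_s4 : enclC t2_encl (sigma4 : C).
Proof.
by split; [rewrite sigma4_Re; exact: encl_half|exact: encl_sigma4_Im].
Qed.

Lemma enclC_s4c : enclC t1_encl (sigma4^* : C).
Proof.
have := sigma4_Re; have := encl_sigma4_Im; case: (sigma4 : C) => x y /= h ->.
by split; [exact: encl_half|exact: encl_neg h].
Qed.

End Constants.

(* 'i times the eigenvalue of the circulant matrix H for the eigenvector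
   (1, w^k, w^2k), w = u^6. *)
Definition eigenE k : cexpr :=
  EAdd (EAdd E1 (EAdd (EPow EU 6) (EPow EU 6)))
    (EOpp (EAdd (EMul (EPow EU 8) (EMul ET (EPow EU (6 * k))))
       (EMul EU (EMul (EAdd E1 ET) (EPow EU (12 * k)))))).

Lemma evalC_pow (K : comPzRingType) (x t : K) e n : evalC x t (EPow e n) = evalC x t e ^+ n.
Proof. by elim: n => //= n ->; rewrite exprS. Qed.

(** * Eigenvalues of H and their signs *)

Section Eigen.
Context {R : realType}.
Local Notation C := (Cplx R).
Local Notation u := (u : C).
Local Notation psi := (2 * pi / 3 : R).
Implicit Types t : @embedding R.

Lemma eigenEE t k : evalC u (emb t) (eigenE k) =
  1 + 2 * u ^+ 6 - u ^+ 8 * emb t * u ^+ (6 * k) - u * (1 + emb t) * u ^+ (6 * k) ^+ 2.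
Proof.
rewrite [evalC _ _ _]/= -/(evalC _ _ _) !evalC_pow /= -exprM (_ : (6 * k * 2 = 12 * k)%N); last by lia.
ring.
Qed.

Lemma cube_root k : (u ^+ (6 * k)) ^+ 3 = 1.
Proof. by rewrite -exprM (_ : (6 * k * 3 = 9 * (2 * k))%N) ?exprM ?u9 ?expr1n//; lia. Qed.

Lemma cube_root_conj k : (u ^+ (6 * k))^* = (u ^+ (6 * k)) ^+ 2.
Proof.
rewrite rmorphXn /= u_conj -!exprM (_ : (8 * (6 * k) = 9 * (4 * k) + 6 * k * 2)%N); last by lia.
by rewrite exprD exprM u9 expr1n mul1r.
Qed.

Definition eigen t k : R := complex.Im (evalC u (emb t) (eigenE k)).

(** The expression equals minus its own conjugate, hence is i times a real number. *)
Lemma eigenP t k : (eigen t k)%:C%C * 'i%C = evalC u (emb t) (eigenE k).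
Proof.
have h : (evalC u (emb t) (eigenE k))^* = - evalC u (emb t) (eigenE k).
  apply/eqP; rewrite -subr_eq0 opprK eigenEE; apply/eqP.
  have x3 := cube_root k; have cx := cube_root_conj k.
  have ca := @u6_conj R; have ct := emb_conj t; have cu := @u_conj R.
  have cb : (u ^+ 8)^* = u by rewrite -cu conjCK.
  move: u (emb t) (u ^+ 8) (u ^+ 6) (u ^+ (6 * k)) x3 cx ca ct cu cb.
  move=> v s b a x x3 cx ca ct cv cb.
  rewrite [x ^+ 2]expr2 !(rmorphB, rmorphD, rmorphM, rmorph1) /= cx ca ct cv cb.
  by ring: x3.
rewrite /eigen; move: h; case: (evalC _ _ _) => x y /= [h].
have -> : x = 0 by lra.
by apply/complexP; simpc.
Qed.

(** Column j is the eigenvector for k = j + 1. The exponent 3 stands in for 0, so that (1, 1, 1),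
    the negative direction at the first embedding, comes last as in signature (2, 1). *)
Definition Fm : 'M[C]_3 := let w := u ^+ 6 in
  mat3 [:: [:: 1; 1; 1]; [:: w; - w - 1; 1]; [:: - w - 1; w; 1]].

Definition eigs t : 'rV[C]_3 := \row_j (eigen t j.+1)%:C%C.

Lemma HmxEu t : Hmx psi (emb t) = let b := 'i%C * u ^+ 8 * emb t in
  let c := - ('i%C * u * (-1 - emb t)) in
  mat3 [:: [:: r3%:C%C; b; c]; [:: c; r3%:C%C; b]; [:: b; c; r3%:C%C]].
Proof.
have em1 : expi (- (psi / 6)) = - u ^+ 8 :> C.
  rewrite (_ : psi / 6 = pi / 9); last by field.
  by rewrite expiN -uV /u invrN opprK.
have e1 : expi (psi / 6) = - u :> C.
  rewrite (_ : psi / 6 = pi / 9); last by field.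
  by rewrite /u opprK.
have rE : 2 * sin (psi / 2) = r3 by rewrite /r3; congr (_ * sin _); field.
by rewrite /Hmx em1 e1 rE emb_conj /= !mulrN !mulNr opprK.
Qed.

Lemma FmE i j : Fm i j = (u ^+ (6 * j.+1)) ^+ i.
Proof.
rewrite !exprM; have w2 := @u12 R.
have w3 : (u ^+ 6) ^+ 3 = 1 by have := cube_root 1; rewrite muln1.
rewrite !mxE; move: (u ^+ 6) w2 w3 => w w2 w3.
case: j => [[|[|[|//]]] ?]; rewrite [nat_of_ord _]/= ?expr1 ?w2 ?w3; case: i => [[|[|[|//]]] ?] /=; ring: w2.
Qed.

Lemma HmxFm t : Hmx psi (emb t) *m Fm = Fm *m diag_mx (eigs t).
Proof.
rewrite HmxEu; have i0 : 'i%C != 0 :> C by apply/eqP => -[] /eqP; rewrite oner_eq0.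
have i2 : ('i%C : C) ^+ 2 = -1 by exact: sqr_i.
have r3i := @r3E R; move: ('i%C : C) (r3%:C%C : C) (@eigenP t) i0 i2 r3i => I r e i0 i2 r3i.
(* Multiplication by i turns each eigenvalue into the polynomial expression [eigenE]. *)
apply/mat3P => i j; apply: (mulIf i0); rewrite mul_mx_diag [in RHS]mxE [eigs t 0 j]mxE -[RHS]mulrA.
rewrite [Fm i j]FmE e eigenEE -r3i !mxE !big_ord_recl big_ord0 !FmE !mxE.
move: (u ^+ (6 * j.+1)) (cube_root j.+1) (u ^+ 8) (emb t) => x x3 b s.
move: u => v.
case: i => [[|[|[|//]]] ?]; rewrite [nat_of_ord _]/= [X in nth X]/=; rewrite /= ?expr0 ?expr1 addr0.
- by ring: i2 x3.
- by ring: i2 x3.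
- by ring: i2 x3.
Qed.

Lemma FmFm : Fm ^t* *m Fm = 3%:M.
Proof.
apply/mat3P => i j; rewrite !mxE !big_ord_recl big_ord0 !mxE /=.
have w2 := @u12 R; have wc := @u6_conj R; move: (u ^+ 6) w2 wc => w w2 wc.
case: i => [[|[|[|//]]] ?]; case: j => [[|[|[|//]]] ?];
  rewrite /= ?(rmorphB, rmorphN, rmorph1) /= ?wc; ring: w2.
Qed.

Lemma adj_Fm_HmxFm t : Fm ^t* *m Hmx psi (emb t) *m Fm = 3 *: diag_mx (eigs t).
Proof. by rewrite -mulmxA HmxFm mulmxA FmFm mul_scalar_mx. Qed.

Local Notation zr := (@zr R).

Lemma encl_lower i (x : R) : encl scale i x -> zr (i.1 - i.2)%ZZ <= zr scale * x.
Proof. rewrite /encl zrB; move: (zr scale * x) (zr i.1) (zr i.2) => y a b.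
by rewrite ler_norml => /andP[h _]; lra. Qed.

Lemma encl_upper i (x : R) : encl scale i x -> zr scale * x <= zr (i.1 + i.2)%ZZ.
Proof. rewrite /encl zrD; move: (zr scale * x) (zr i.1) (zr i.2) => y a b.
by rewrite ler_norml => /andP[_ h]; lra. Qed.

Lemma encl_gt0 i (x : R) : encl scale i x -> (0 <? i.1 - i.2)%ZZ = true -> 0 < x.
Proof.
move=> /encl_lower h /(@zr_gtP0 R) /lt_le_trans/(_ h).
by rewrite (pmulr_rgt0 _ (@zr_scale_gt0 R)); apply.
Qed.

Lemma encl_lt0 i (x : R) : encl scale i x -> (i.1 + i.2 <? 0)%ZZ = true -> x < 0.
Proof.
move=> /encl_upper h /(@zr_ltP0 R) /(le_lt_trans h).
by rewrite (pmulr_rlt0 _ (@zr_scale_gt0 R)); apply.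
Qed.

Lemma encl_le i j a b (x y : R) : encl scale i x -> encl scale j y ->
  (0 <=? a)%ZZ = true -> (0 <=? b)%ZZ = true ->
  (a * (i.1 + i.2) <=? b * (j.1 - j.2))%ZZ = true -> zr a * x <= zr b * y.
Proof.
move=> /encl_upper hx /encl_lower hy /(@zr_ge0 R) a0 /(@zr_ge0 R) b0 /(@zr_leP R).
rewrite !zrM => h; rewrite -(ler_pM2l (@zr_scale_gt0 R)) mulrCA [leRHS]mulrCA.
exact: (le_trans (ler_wpM2l a0 hx) (le_trans h (ler_wpM2l b0 hy))).
Qed.

Lemma encl_eigen t i k : enclC i (emb t) ->
  encl scale (evalI scale u_encl i (eigenE k)).2 (eigen t k).
Proof. by move=> h; have [] := evalIP (eigenE k) (enclC_u (R := R)) h. Qed.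

Local Notation t1 := (@emb_s4c R).
Local Notation t2 := (@emb_s4 R).

(** Since w^3 = 1, the shorter expression with k = 0 can be enclosed instead. *)
Lemma eigen3 t : eigen t 3 = eigen t 0.
Proof. by rewrite /eigen !eigenEE (exprM _ 9 2) u9 muln0 expr0 !expr1n. Qed.

(** Definiteness at the second embedding, the source of the compact factor and of all the finiteness
    statements. *)
Lemma eigen_t2_gt0 (j : 'I_3) : 0 < eigen t2 j.+1.
Proof.
have h := @encl_eigen t2 t2_encl j.+1 enclC_s4.
apply: (encl_gt0 h); case: j {h} => [[|[|[|//]]] ?]; by vm_compute.
Qed.

Lemma eigen_t1_signs : [/\ 0 < eigen t1 1, 0 < eigen t1 2 & eigen t1 3 < 0].
Proof.
have h k := @encl_eigen t1 t1_encl k enclC_s4c.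
rewrite eigen3; split; [apply: (encl_gt0 (h _))|apply: (encl_gt0 (h _))|apply: (encl_lt0 (h _))]; by vm_compute.
Qed.

(** The number 360 is 1000 (3/5)^2; the next ratio has 961/10 = 1000 (31/100)^2. Both come from the
    rescaling that makes the shell nearly round. *)
Lemma eigen_t1_ratio1 : 1054 * - eigen t1 3 <= 360 * eigen t1 1 <= 1055 * - eigen t1 3.
Proof.
have h k := @encl_eigen t1 t1_encl k enclC_s4c.
rewrite eigen3; have h3 := encl_opp (h 0%N).
apply/andP; split.
- by apply: (@encl_le _ _ 1054%ZZ 360%ZZ _ _ h3 (h 1%N)); vm_compute.
- by apply: (@encl_le _ _ 360%ZZ 1055%ZZ _ _ (h 1%N) h3); vm_compute.
Qed.

Lemma eigen_t1_ratio2 : 1026 * - eigen t1 3 <= 961 / 10 * eigen t1 2 <= 1027 * - eigen t1 3.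
Proof.
have h k := @encl_eigen t1 t1_encl k enclC_s4c.
rewrite eigen3; have h3 := encl_opp (h 0%N).
have up := @encl_le _ _ (10 * 1026)%ZZ 961%ZZ _ _ h3 (h 2%N).
have dn := @encl_le _ _ 961%ZZ (10 * 1027)%ZZ _ _ (h 2%N) h3.
have {}up : zr (10 * 1026)%ZZ * - eigen t1 0 <= zr 961 * eigen t1 2 by apply: up; vm_compute.
have {}dn : zr 961 * eigen t1 2 <= zr (10 * 1027)%ZZ * - eigen t1 0 by apply: dn; vm_compute.
move: up dn; rewrite !zrM (_ : zr 10 = 10)// (_ : zr 1026 = 1026)// (_ : zr 1027 = 1027)// (_ : zr 961 = 961)//.
have e (a x : R) : a / 10 * x = a * x / 10 by ring.
move=> up dn; rewrite e; apply/andP; split.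
  by rewrite ler_pdivlMr//; move: up; rewrite -mulrA mulrC; apply.
by rewrite ler_pdivrMr//; move: dn; rewrite -[leRHS]mulrA [leRHS]mulrC; apply.
Qed.

End Eigen.

(** * Words in the generators acting on row vectors *)

Section Words.
Context {R : realType}.
Local Notation C := (Cplx R).
Local Notation u := (u : C).
Implicit Types t : @embedding R.

Lemma R1mxEu t : R1mx psi3 (emb t) =
  mat3 [:: [:: u ^+ 4; emb t; u ^+ 2 * (1 + emb t)]; [:: 0; u ^+ 7; 0]; [:: 0; 0; u ^+ 7]].
Proof.
have e2 : expi (psi3 / 3 : R) = u ^+ 2.
  rewrite (_ : psi3 / 3 = 2%:R * (pi / 9)); last by rewrite /psi3; field.
  by rewrite expiMn /u sqrrN.
have e4 : expi (2 * psi3 / 3 : R) = u ^+ 4.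
  rewrite (_ : 2 * psi3 / 3 = 2%:R * (psi3 / 3)); last by field.
  by rewrite expiMn e2 -exprM.
have em2 : expi (- (psi3 / 3) : R) = u ^+ 7.
  by rewrite expiN e2 -exprVn uV -exprM (_ : (8 * 2 = 9 + 7)%N)// exprD u9 mul1r.
rewrite /R1mx e2 e4 em2 emb_conj; congr (mat3 [:: [:: _; _; _]; _; _]).
by rewrite -mulrN opprB opprK addrC.
Qed.

Lemma invR1mxE t : invmx (R1mx psi3 (emb t)) =
  mat3 [:: [:: u ^+ 5; - (u ^+ 7 * emb t); - (1 + emb t)]; [:: 0; u ^+ 2; 0]; [:: 0; 0; u ^+ 2]].
Proof.
apply: invmx_eq; rewrite R1mxEu; apply/mat3P => i j; rewrite !mxE !big_ord_recl big_ord0 !mxE.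
have s9 := @u9 R.
case: i => [[|[|[|//]]] ?]; case: j => [[|[|[|//]]] ?] /=; ring: s9.
Qed.

Definition letter_mx t (l : letter) : 'M[C]_3 := match l with
  | LA => R1mx psi3 (emb t) | LV => invmx (R1mx psi3 (emb t)) | LJ => Jmx end.

Definition word_mx t w : 'M[C]_3 := foldr (fun l M => letter_mx t l *m M) 1%:M w.

Lemma word_mx_group t w : (triangle_group psi3 (emb t) : set _) (word_mx t w).
Proof.
have [G1 GM _ GV] := mxgroupP (triangle_group psi3 (emb t)).
have gA : (triangle_group psi3 (emb t) : set _) (R1mx psi3 (emb t)).
  by move=> H [_ HA]; apply: HA; left.
have gJ : (triangle_group psi3 (emb t) : set _) Jmx.
  by move=> H [_ HA]; apply: HA; right.
elim: w => [|l w IH]; first exact: G1.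
by apply: (GM _ _ _ IH); case: l; [exact: gA|exact: (GV _ gA)|exact: gJ].
Qed.

Definition rowC t (r : cexpr * cexpr * cexpr) : 'rV[C]_3 :=
  \row_j nth 0 [:: evalC u (emb t) r.1.1; evalC u (emb t) r.1.2; evalC u (emb t) r.2] j.

Lemma rowC_act t r l : rowC t (act r l) = rowC t r *m letter_mx t l.
Proof.
case: r => [[a b] c]; apply/rowP => j; rewrite !mxE !big_ord_recl big_ord0.
case: l; rewrite /letter_mx ?invR1mxE ?R1mxEu !mxE /=; case: j => [[|[|[|//]]] ?];
  rewrite /= -?/(evalC _ _ _); ring.
Qed.

Lemma rowC_word t r w : rowC t (foldl act r w) = rowC t r *m word_mx t w.
Proof.
elim: w r => [|l w IH] r; first by rewrite /= mulmx1.
by rewrite /= IH rowC_act mulmxA.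
Qed.

(** [fourier] lists the value at (1, 1, 1) first, whereas [Fm] has this eigenvector as its last
    column; hence the rotation to (y, z, x). *)
Lemma rowC_Fm t r : let: (x, y, z) := fourier r in
  rowC t r *m Fm = rowC t (y, z, x).
Proof.
case: r => [[a b] c] /=; apply/rowP => j; rewrite !mxE !big_ord_recl big_ord0 !mxE.
have w2 : u ^+ 12 = - u ^+ 6 - 1 by rewrite -u12 -exprM.
case: j => [[|[|[|//]]] ?] /=; move: (evalC _ _ a) (evalC _ _ b) (evalC _ _ c) => x y z; ring: w2.
Qed.

End Words.

(** * The descent *)

Section Descent.
Context {R : realType}.
Local Notation C := (Cplx R).
Local Notation u := (u : C).
Local Notation t1 := (@emb_s4c R).
Local Notation H1 := (Hmx psi3 (emb t1)).
Implicit Types t : @embedding R.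

Lemma normsqE (z : C) : (normsq z)%:C%C = z * z^*.
Proof. by rewrite -normCK normCE -rmorphXn /= sqr_sqrtr// addr_ge0 ?sqr_ge0. Qed.

Lemma normsq_ge0 (z : C) : 0 <= normsq z.
Proof. by rewrite /normsq addr_ge0 ?sqr_ge0. Qed.

Lemma normsqM (x y : C) : normsq (x * y) = normsq x * normsq y.
Proof. by apply: complexI; rewrite rmorphM /= !normsqE rmorphM /= mulrACA. Qed.

Lemma normsq_div (x y : C) : y != 0 -> normsq (x / y) = normsq x / normsq y.
Proof.
move=> y0; have n0 : normsq y != 0.
  by rewrite -(inj_eq (@complexI R)) normsqE mulf_neq0// conjC_eq0.
by apply: (mulIf n0); rewrite -normsqM divfK// divfK.
Qed.

(** Division of the invariance relation by -a0 n: in projective coordinates a vector on the level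
    set lies just inside the unit ball of the form, at depth 1 / n. *)
Lemma ratio_identity (a1 a2 a0 m k n : R) : a0 < 0 -> 0 < n ->
  a1 * m + a2 * k + a0 * n = a0 -> a1 / - a0 * (m / n) + a2 / - a0 * (k / n) = 1 - n^-1.
Proof.
move=> a00 n0 E; have [a1' n1] : a0 != 0 /\ n != 0 by rewrite ltr0_neq0// lt0r_neq0.
apply: (mulIf (mulf_neq0 a1' n1)); transitivity (- (a1 * m + a2 * k)); first by field; rewrite a1' n1.
by rewrite -[a1 * m + _](addrK (a0 * n)) E; field.
Qed.

(** The sum of the entries is x0^* g x0 for x0 = (1, 1, 1); this is the height N. *)
Definition size_sq (g : 'M[C]_3) : R := normsq (\sum_i \sum_j g i j).

(* The matrix of g in the orthogonal basis of eigenvectors of H. *)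
Definition eig_coord (g : 'M[C]_3) : 'M[C]_3 := 3^-1 *: (Fm ^t* *m g *m Fm).

Lemma Fm_unitl : 3^-1 *: Fm ^t* *m Fm = 1%:M :> 'M[C]_3.
Proof. by rewrite -scalemxAl FmFm scale_scalar_mx mulVf// pnatr_eq0. Qed.

Lemma Fm_eig_coord (g : 'M[C]_3) : Fm *m eig_coord g = g *m Fm.
Proof.
have /mulmx1C e := Fm_unitl.
by rewrite /eig_coord -!mulmxA scalemxAl mulmxA e mul1mx.
Qed.

Lemma trmxCM m n p (A : 'M[C]_(m, n)) (B : 'M[C]_(n, p)) : (A *m B) ^t* = B ^t* *m A ^t*.
Proof. by rewrite trmx_mul map_mxM. Qed.

Lemma unitary_basis n (F c g H D : 'M[C]_n) : F *m c = g *m F ->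
  g ^t* *m H *m g = H -> F ^t* *m H *m F = D -> c ^t* *m D *m c = D.
Proof.
move=> Fc gH FD; rewrite -FD !mulmxA -trmxCM -mulmxA Fc.
by rewrite trmxCM -[RHS]mulmxA -[in RHS]gH !mulmxA.
Qed.

Lemma eig_coord_unitary t g : SU_set (Hmx psi3 (emb t)) g ->
  (eig_coord g) ^t* *m diag_mx (eigs t) *m eig_coord g = diag_mx (eigs t).
Proof.
move=> [gH _]; apply: (@scalerI C _ 3); first by rewrite pnatr_eq0.
rewrite scalemxAl scalemxAr; exact: unitary_basis (Fm_eig_coord g) gH (adj_Fm_HmxFm t).
Qed.

Lemma Fm2 (j : 'I_3) : Fm j (inord 2) = 1 :> C.
Proof. by rewrite !mxE inordK//; case: j => [[|[|[|//]]] ?]. Qed.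

Lemma eig_coord22 (g : 'M[C]_3) : 3 * eig_coord g (inord 2) (inord 2) = \sum_i \sum_j g i j.
Proof.
rewrite mxE mulrA mulfV ?pnatr_eq0// mul1r mxE exchange_big /=.
apply: eq_bigr => j _; rewrite Fm2 mulr1 mxE; apply: eq_bigr => i _.
by rewrite mxE mxE Fm2 rmorph1 mul1r.
Qed.

Lemma sum_rowC t (M : 'M[C]_3) :
  \sum_i \sum_j M i j = (rowC t (E1, E1, E1) *m M *m Fm) ord0 (inord 2).
Proof.
rewrite exchange_big mxE; apply: eq_bigr => j _; rewrite Fm2 mulr1 mxE.
by apply: eq_bigr => i _; rewrite mxE; case: i => [[|[|[|//]]] ?]; rewrite mul1r.
Qed.

(** The word turns the row (1, 1, 1) into [word_row w], and the last column of [eig_coord g] holds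
    the coordinates of g x0; the sum of the entries is the pairing of the two. *)
Lemma size_word t w g : size_sq (word_mx t w *m g) =
  normsq (let: (x, y, z) := fourier (word_row w) in
    evalC u (emb t) x * eig_coord g (inord 2) (inord 2) + evalC u (emb t) y * eig_coord g (inord 0) (inord 2)
    + evalC u (emb t) z * eig_coord g (inord 1) (inord 2)).
Proof.
rewrite /size_sq (sum_rowC t) mulmxA -rowC_word -mulmxA -Fm_eig_coord mulmxA -/(word_row w).
have := rowC_Fm t (word_row w); case: (fourier _) => [[x y] z] ->; congr normsq.
have e0 : ord0 = inord 0 :> 'I_3 by apply/val_inj; rewrite /= inordK.
have e1 : lift ord0 ord0 = inord 1 :> 'I_3 by apply/val_inj; rewrite /= inordK.
have e2 : lift ord0 (lift ord0 ord0) = inord 2 :> 'I_3 by apply/val_inj; rewrite /= inordK.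
rewrite mxE !big_ord_recl big_ord0 addr0 e2 e1 e0 [rowC _ _ _ (inord 0)]mxE [rowC _ _ _ (inord 1)]mxE [rowC _ _ _ (inord 2)]mxE !inordK//=.
by rewrite addrA addrC addrA.
Qed.

Lemma size_sqE g : size_sq g = 9 * normsq (eig_coord g (inord 2) (inord 2)).
Proof.
rewrite /size_sq -eig_coord22 normsqM; congr (_ * _).
by apply: complexI; rewrite normsqE !rmorph_nat -natrM.
Qed.

(** The form takes the same value at g x0 as at x0; in the eigenbasis x0 has the coordinates (0, 0,
    1). *)
Lemma eig_coord_col2 t g : SU_set (Hmx psi3 (emb t)) g ->
  let y k := normsq (eig_coord g (inord k) (inord 2)) in
  eigen t 1 * y 0 + eigen t 2 * y 1 + eigen t 3 * y 2 = eigen t 3.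
Proof.
move=> /eig_coord_unitary /matrixP /(_ (inord 2) (inord 2)).
move: (eig_coord g) => c; rewrite mul_mx_diag [RHS]mxE eqxx [eigs t _ _]mxE inordK// => e.
apply: complexI; rewrite -[RHS]e !rmorphD !rmorphM /= !normsqE.
have e0 : ord0 = inord 0 :> 'I_3 by apply/val_inj; rewrite /= inordK.
have e1 : lift ord0 ord0 = inord 1 :> 'I_3 by apply/val_inj; rewrite /= inordK.
have e2 : lift ord0 (lift ord0 ord0) = inord 2 :> 'I_3 by apply/val_inj; rewrite /= inordK.
rewrite mxE !big_ord_recl big_ord0 addr0 e2 e1 e0.
rewrite !(mxE, inordK)//.
have assoc (l x y : C) : l * (x * y) = y * l * x by ring.
by rewrite !assoc addrA.
Qed.

(* One step of the descent: cap_cover applied to the normalized coordinates of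
   the vector g (1, 1, 1). *)
Lemma size_descent g : SU_set H1 g -> 900 <= size_sq g ->
  exists2 c, (triangle_group psi3 (emb t1) : set _) c & size_sq (c *m g) <= 99 / 100 * size_sq g.
Proof.
move=> /eig_coord_col2; rewrite size_sqE /=.
set y0 := eig_coord g (inord 2) (inord 2); set y1 := eig_coord g _ _; set y2 := eig_coord g _ _.
(* As N = 9 |y0|^2, the threshold 900 means |y0|^2 >= 100, that is 1 - 1 / |y0|^2 >= 99/100: the
   inner boundary of the covered shell. *)
have e9 : 900 = 9 * 100 :> R by rewrite -natrM.
move=> E; rewrite e9 ler_pM2l// => b.
have [p1 p2 n0] := eigen_t1_signs (R := R).
have q0 : 0 < normsq y0 by exact: lt_le_trans b.
have y0n : y0 != 0 by apply: contraTneq q0 => ->; rewrite /normsq /= expr0n addr0 ltxx.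
have sw w : size_sq (word_mx t1 w *m g) = normsq (let: (x, y, z) := fourier (word_row w) in
    evalC u (emb t1) x * y0 + evalC u (emb t1) y * y1 + evalC u (emb t1) z * y2).
  exact: size_word.
clearbody y0 y1 y2; have r1 := eigen_t1_ratio1 (R := R); have r2 := eigen_t1_ratio2 (R := R).
move: (eigen t1 1) (eigen t1 2) (eigen t1 3) p1 p2 n0 r1 r2 E => a1 a2 a0.
move=> _ _ n0 /andP[r1 r1'] /andP[r2 r2'] E.
have na0 : 0 < - a0 by rewrite oppr_gt0.
have h : a1 / - a0 * normsq (y1 / y0) + a2 / - a0 * normsq (y2 / y0) = 1 - (normsq y0)^-1.
  by rewrite !normsq_div//; exact: ratio_identity.
have [|||i _ hi] := @cap_cover R u (emb t1) (a1 / - a0) (a2 / - a0) (y1 / y0) (y2 / y0)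
  (enclC_u (R := R)) (enclC_s4c (R := R)).
- by rewrite mulrA ler_pdivlMr// ler_pdivrMr// r1 r1'.
- by rewrite mulrA ler_pdivlMr// ler_pdivrMr// r2 r2'.
- rewrite h; have : 0 <= (normsq y0)^-1 by rewrite invr_ge0 ltW.
  have : (normsq y0)^-1 <= 100^-1 by rewrite lef_pV2 ?posrE.
  by move: (_^-1) => z; lra.
exists (word_mx t1 (nth [::] words i)); first by apply (@word_mx_group R t1 (nth [::] words i)).
move: hi; rewrite sw /row_value; case: (fourier _) => [[x y] z].
set v := (X in normsq X) => hi.
set v' := (X in normsq X <= _); have -> : v' = v * y0.
  have dv p q : p * (q / y0) * y0 = p * q by rewrite -mulrA divfK.
  by rewrite /v' /v !mulrDl !dv mulr1.
rewrite normsqM (_ : 99 / 100 * (9 * normsq y0) = 9 * (99 / 100) * normsq y0); last by ring.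
by rewrite ler_pM2r.
Qed.

Lemma triangle_SU g : (triangle_group psi3 (emb t1) : set _) g -> SU_set H1 g.
Proof. by move=> /triangle_lifted[k [g2 [Y [Y' [[]]]]]]. Qed.

(** Above 900 one step lowers the size by at least 900 / 100 = 9, so n steps deal with all sizes up
    to 900 + 9 n. *)
Lemma size_bounded g : SU_set H1 g ->
  exists2 c, (triangle_group psi3 (emb t1) : set _) c & size_sq (c *m g) <= 900.
Proof.
have [G1 GM _ _] := mxgroupP (triangle_group psi3 (emb t1)).
have [_ SUM _ _] := SU_group H1.
have descend n h : SU_set H1 h -> size_sq h <= 900 + 9 * n%:R ->
    exists2 c, (triangle_group psi3 (emb t1) : set _) c & size_sq (c *m h) <= 900.
  elim: n h => [|n IH] h Hh hb.
    by exists 1%:M => //; rewrite mul1mx; move: hb; rewrite mulr0 addr0.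
  have [small|/ltW big] := leP (size_sq h) 900; first by exists 1%:M => //; rewrite mul1mx.
  have [c Gc hc] := size_descent Hh big.
  have [|d Gd hd] := IH (c *m h) (SUM _ _ (triangle_SU Gc) Hh).
    move: big hb hc; rewrite -(natr1 n); move: (size_sq _) (size_sq _) n%:R => x y z; lra.
  by exists (d *m c); [exact: GM|rewrite -mulmxA].
move=> Hg; apply: (descend (Num.bound (size_sq g)) g Hg).
have := archi_boundP (normsq_ge0 (\sum_i \sum_j g i j)); rewrite -/(size_sq g).
have : 0 <= (Num.bound (size_sq g))%:R :> R by [].
by move: _%:R => x; lra.
Qed.

End Descent.

(** * Compactness, finiteness and commensurability *)

Section Bounds.
Context {R : realType}.
Local Notation C := (Cplx R).

Lemma ge0_complexE (z : C) : 0 <= z -> z = (complex.Re z)%:C%C.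
Proof. by case: z => x y; rewrite lecE /= => /andP[/eqP -> _]. Qed.

(** The entries of P c P^-1 are estimated term by term; B is chosen before c and g, which gives the
    uniformity that compactness requires. *)
Lemma bounded_conj n (P : 'M[C]_n) (M : R) : exists B : R, forall c g : 'M[C]_n,
  P *m c = g *m P -> P \in unitmx -> (forall i j, `|c i j| <= M%:C%C) ->
  forall i j, `|g i j| <= B%:C%C.
Proof.
pose s := \sum_i \sum_j `|P i j| : C; pose s' := \sum_i \sum_j `|invmx P i j| : C.
have le_s (A : 'M[C]_n) i j : `|A i j| <= \sum_i \sum_j `|A i j|.
  rewrite (bigD1 i)//= (bigD1 j)//= -addrA lerDl.
  by rewrite addr_ge0 ?sumr_ge0 // => *; rewrite ?sumr_ge0.
have s0 (A : 'M[C]_n) : 0 <= \sum_i \sum_j `|A i j|.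
  by apply: sumr_ge0 => *; apply: sumr_ge0.
exists (complex.Re (\sum_(k < n) (\sum_(l < n) s * M%:C%C) * s')) => c g Pc Pu cM i j.
have gE : g = P *m c *m invmx P by rewrite Pc mulmxK.
have M0 : 0 <= (M%:C%C : C) by apply: le_trans (cM i j).
rewrite -ge0_complexE; last first.
  apply: sumr_ge0 => k _; apply: mulr_ge0; last exact: s0.
  by apply: sumr_ge0 => l _; apply: mulr_ge0; [exact: s0|exact: M0].
rewrite gE mxE (le_trans (ler_norm_sum _ _ _))// ler_sum// => k _.
rewrite normrM; apply: ler_pM; [exact: normr_ge0|exact: normr_ge0| |exact: le_s].
rewrite mxE (le_trans (ler_norm_sum _ _ _))// ler_sum// => l _.
by rewrite normrM; apply: ler_pM; [exact: normr_ge0|exact: normr_ge0|exact: le_s|exact: cM].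
Qed.

Lemma norm_le_normsq (z : C) (M : R) : normsq z <= M -> `|z| <= (1 + M)%:C%C.
Proof.
rewrite normCE lecR -/(normsq z) => h; have n0 := normsq_ge0 z.
have h0 : 0 <= 1 + M by lra.
by rewrite -(ler_sqr (sqrtr_ge0 _)) ?nnegrE// sqr_sqrtr//; nra.
Qed.

Lemma unitary_col n (c : 'M[C]_n) (s : 'rV[R]_n) (j : 'I_n) :
  c ^t* *m diag_mx (map_mx (real_complex R) s) *m c = diag_mx (map_mx (real_complex R) s) ->
  \sum_i s 0 i * normsq (c i j) = s 0 j.
Proof.
move=> /matrixP/(_ j j) e; apply: complexI; rewrite rmorph_sum /=.
move: e; rewrite mul_mx_diag mxE [RHS]mxE eqxx mxE mulr1n => <-.
by apply: eq_bigr => i _; rewrite !mxE rmorphM /= normsqE; ring.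
Qed.

(** As D^2 = 1, the relation c^* D c = D makes D c^* D the inverse of c, whence c D c^* = D and the
    rows obey the same relations as the columns. *)
Lemma unitary_row n (c : 'M[C]_n) (s : 'rV[R]_n) (i : 'I_n) : (forall j, s 0 j ^+ 2 = 1) ->
  c ^t* *m diag_mx (map_mx (real_complex R) s) *m c = diag_mx (map_mx (real_complex R) s) ->
  \sum_j s 0 j * normsq (c i j) = s 0 i.
Proof.
set D := diag_mx _ => s2 e.
have DD : D *m D = 1%:M.
  by apply/matrixP => k l; rewrite mul_diag_mx !mxE; case: eqP => [->|]; rewrite ?mulr0// mulr1n -expr2 -rmorphXn s2.
have /mulmx1C e' : D *m c ^t* *m D *m c = 1%:M by rewrite -!mulmxA (mulmxA _ D c) e DD.
have {}e : c *m D *m c ^t* = D.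
  by rewrite -[LHS]mulmx1 -DD !mulmxA -(mulmxA c) -(mulmxA c) e' mul1mx.
move/matrixP: e => /(_ i i) e; apply: complexI; rewrite rmorph_sum /=.
move: e; rewrite /D mul_mx_diag mxE [RHS]mxE eqxx mxE mulr1n => <-.
by apply: eq_bigr => j _; rewrite !mxE rmorphM /= normsqE; ring.
Qed.

End Bounds.

Section Diagonal.
Context {R : realType}.
Local Notation C := (Cplx R).
Local Notation t1 := (@emb_s4c R).
Local Notation t2 := (@emb_s4 R).
Local Notation H1 := (Hmx psi3 (emb t1)).
Local Notation H2 := (Hmx psi3 (emb t2)).
Local Notation rc := (map_mx (real_complex R)).
Implicit Types t : @embedding R.

(** The form takes the value 3 times the eigenvalue at a column of [Fm], so this scaling leaves only
    its sign. *)
Definition eig_scale t : 'rV[R]_3 := \row_j (Num.sqrt (3 * `|eigen t j.+1|))^-1.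
Definition eig_sign t : 'rV[R]_3 := \row_j Num.sg (eigen t j.+1).
Definition Pm t : 'M[C]_3 := Fm *m diag_mx (rc (eig_scale t)).

Lemma diag_adj (d : 'rV[R]_3) : diag_mx (rc d) ^t* = diag_mx (rc d) :> 'M[C]_3.
Proof.
rewrite tr_diag_mx map_diag_mx -map_mx_comp; congr diag_mx; apply: eq_map_mx => x /=.
by rewrite conjCE /= oppr0.
Qed.

Lemma Pm_diag t : (forall j : 'I_3, eigen t j.+1 != 0) ->
  (Pm t) ^t* *m Hmx psi3 (emb t) *m Pm t = diag_mx (rc (eig_sign t)).
Proof.
move=> nz; rewrite /Pm trmxCM diag_adj.
have -> : diag_mx (rc (eig_scale t)) *m Fm ^t* *m Hmx psi3 (emb t) *m (Fm *m diag_mx (rc (eig_scale t))) =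
  diag_mx (rc (eig_scale t)) *m (Fm ^t* *m Hmx psi3 (emb t) *m Fm) *m diag_mx (rc (eig_scale t)).
  by rewrite !mulmxA.
rewrite adj_Fm_HmxFm; apply/matrixP => i j; rewrite mul_mx_diag mul_diag_mx !mxE.
case: eqP => [->|_]; last by rewrite !(mulr0n, mulr0, mul0r).
rewrite !mulr1n -(rmorph_nat (real_complex R)) -!rmorphM; congr (real_complex R).
have p0 : 0 < 3 * `|eigen t j.+1| by rewrite mulr_gt0// normr_gt0.
have e : (Num.sqrt (3 * `|eigen t j.+1|))^-1 ^+ 2 = (3 * `|eigen t j.+1|)^-1.
  by rewrite exprVn sqr_sqrtr// ltW.
have n0 : `|eigen t j.+1| != 0 by rewrite normr_eq0.
move: (Num.sqrt _)^-1 e => x e; rewrite -[RHS]mulr1.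
transitivity (x ^+ 2 * (3 * eigen t j.+1)); first by ring.
by rewrite e {2}[eigen t j.+1]numEsg; move: (Num.sg _) (`|_|) n0 => y z z0; field.
Qed.

Lemma Pm_unit t : (forall j : 'I_3, eigen t j.+1 != 0) -> Pm t \in unitmx.
Proof.
move=> nz; have [_ Fu] := mulmx1_unit (@Fm_unitl R).
rewrite unitmx_mul Fu unitmxE det_diag unitfE /=; apply/prodf_neq0 => j _.
by rewrite !mxE (inj_eq (@complexI R)) invr_eq0 gt_eqF// sqrtr_gt0 mulr_gt0// normr_gt0.
Qed.

Lemma sg_t2 j : eig_sign t2 0 j = 1.
Proof. by rewrite mxE gtr0_sg// eigen_t2_gt0. Qed.

Lemma eigen_t2_neq0 (j : 'I_3) : eigen t2 j.+1 != 0.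
Proof. by rewrite lt0r_neq0// eigen_t2_gt0. Qed.

Lemma eigen_t1_neq0 (j : 'I_3) : eigen t1 j.+1 != 0.
Proof.
have [a b c] := eigen_t1_signs (R := R).
by case: j => [[|[|[|//]]] ?]; [exact: (lt0r_neq0 a)|exact: (lt0r_neq0 b)|exact: (ltr0_neq0 c)].
Qed.

Lemma sg_t1 (j : 'I_3) : eig_sign t1 0 j = if (j < 2)%N then 1 else -1.
Proof.
have [a b c] := eigen_t1_signs (R := R).
by rewrite mxE; case: j => [[|[|[|//]]] ?]; [exact: (gtr0_sg a)|exact: (gtr0_sg b)|exact: (ltr0_sg c)].
Qed.

Lemma signature_H1 : has_signature (p := 2) (q := 1) H1.
Proof.
exists (Pm t1); first exact: Pm_unit eigen_t1_neq0.
rewrite (Pm_diag eigen_t1_neq0); apply/matrixP => i j; rewrite [LHS]mxE [rc _ _ _]mxE sg_t1.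
rewrite !mxE; case: splitP => k ik; rewrite !mxE; case: splitP => l jl; rewrite !mxE -(inj_eq val_inj) /= ik jl.
- by rewrite ltn_ord.
- by rewrite (ord1 l) ltn_eqF ?ltn_addr//.
- by rewrite (ord1 k) gtn_eqF ?ltn_addr//.
- by rewrite !ord1 ltnn rmorphN1.
Qed.

Lemma coord_bounded (A : set 'M[C]_3) (P : 'M[C]_3) (M : R) : P \in unitmx ->
  (forall g c, A g -> P *m c = g *m P -> forall i j, normsq (c i j) <= M) ->
  exists B : R, forall g i j, A g -> `|g i j| <= B%:C%C.
Proof.
move=> Pu b; have [B hB] := bounded_conj P (1 + M).
exists B => g i j Ag.
have e : P *m (invmx P *m (g *m P)) = g *m P by rewrite mulKVmx.
by apply: (hB _ _ e Pu) => k l; apply: norm_le_normsq; exact: b e _ _.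
Qed.

(** In the normalized eigenbasis the form at the second embedding is the identity, so the columns of
    c are unit vectors. *)
Lemma SU2_bounded : exists B : R, forall g i j, SU_set H2 g -> `|g i j| <= B%:C%C.
Proof.
apply: (@coord_bounded _ (Pm t2) 1); first exact: Pm_unit eigen_t2_neq0.
move=> g c [gH _] e i j.
have := unitary_col j (unitary_basis e gH (Pm_diag eigen_t2_neq0)); rewrite sg_t2 => <-.
rewrite (bigD1 i)//= sg_t2 mul1r lerDl sumr_ge0// => k _.
by rewrite sg_t2 mul1r normsq_ge0.
Qed.

Lemma compact_SU2 : compact (SU_set H2).
Proof. by have [B bB] := SU2_bounded; exact: compact_mx (closed_SU (H := H2)) bB. Qed.

(** The bases [Pm t] and [Fm] differ by a diagonal matrix, and conjugation by it fixes diagonal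
    entries. *)
Lemma Pm_coord22 t g c : (forall j : 'I_3, eigen t j.+1 != 0) -> Pm t *m c = g *m Pm t ->
  c (inord 2) (inord 2) = eig_coord g (inord 2) (inord 2).
Proof.
move=> nz e; have [_ Fu] := mulmx1_unit (@Fm_unitl R).
have : diag_mx (rc (eig_scale t)) *m c = eig_coord g *m diag_mx (rc (eig_scale t)).
  by apply: (can_inj (mulKmx Fu)); rewrite [LHS]mulmxA [LHS]e [RHS]mulmxA Fm_eig_coord /Pm mulmxA.
move=> /matrixP/(_ (inord 2) (inord 2)); rewrite mul_diag_mx mul_mx_diag [LHS]mxE [RHS]mxE mulrC.
apply: mulIf; rewrite mxE (inj_eq (@complexI R)) mxE invr_eq0 gt_eqF// sqrtr_gt0 mulr_gt0//.
by rewrite normr_gt0.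
Qed.

Lemma continuous_size_sq : continuous (@size_sq R).
Proof.
have cs : continuous (fun g : 'M[C]_3 => \sum_i \sum_j g i j).
  by apply: continuous_sumr => i _; apply: continuous_sumr => j _; exact: coord_continuous.
have cRe : continuous (fun g : 'M[C]_3 => complex.Re (\sum_i \sum_j g i j)).
  by move=> g; apply: continuous_comp; [exact: cs|exact: continuous_Re].
have cIm : continuous (fun g : 'M[C]_3 => complex.Im (\sum_i \sum_j g i j)).
  by move=> g; apply: continuous_comp; [exact: cs|exact: continuous_Im].
rewrite (_ : @size_sq R = fun g => complex.Re (\sum_i \sum_j g i j) * complex.Re (\sum_i \sum_j g i j)
  + complex.Im (\sum_i \sum_j g i j) * complex.Im (\sum_i \sum_j g i j)); last first.
  by apply/funext => g; rewrite /size_sq /normsq !expr2.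
exact: (continuous_addf (continuous_mulf cRe cRe) (continuous_mulf cIm cIm)).
Qed.

(** The height bounds the entry c22. The relation of the last row then bounds the rest of that row,
    and the column relations bound the other two rows. *)
Lemma size_sq_entries M : exists B : R, forall g i j,
  (SU_set H1 g /\ size_sq g <= M) -> `|g i j| <= B%:C%C.
Proof.
apply: (@coord_bounded [set g | SU_set H1 g /\ size_sq g <= M] (Pm t1) (1 + M)); first exact: Pm_unit eigen_t1_neq0.
move=> g c [[gH _] gM] e.
have cD := unitary_basis e gH (Pm_diag eigen_t1_neq0).
have i0 : ord0 = inord 0 :> 'I_3 by apply/val_inj; rewrite /= inordK.
have i1 : lift ord0 ord0 = inord 1 :> 'I_3 by apply/val_inj; rewrite /= inordK.
have i2 : lift ord0 (lift ord0 ord0) = inord 2 :> 'I_3 by apply/val_inj; rewrite /= inordK.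
have s2 (j : 'I_3) : eig_sign t1 0 j ^+ 2 = 1 by rewrite sg_t1; case: ifP => _; rewrite ?sqrrN expr1n.
have col (j : 'I_3) : normsq (c (inord 0) j) + normsq (c (inord 1) j) - normsq (c (inord 2) j) = eig_sign t1 0 j.
  rewrite -(unitary_col j cD) !big_ord_recl big_ord0 addr0 i2 i1 i0 !sg_t1 !inordK//=.
  by rewrite !mul1r mulN1r [RHS]addrA.
have row : normsq (c (inord 2) (inord 0)) + normsq (c (inord 2) (inord 1)) - normsq (c (inord 2) (inord 2)) = - 1.
  have := unitary_row (inord 2) s2 cD.
  rewrite !big_ord_recl big_ord0 addr0 i2 i1 i0 !sg_t1 !inordK//= => <-.
  by rewrite !mul1r mulN1r [RHS]addrA.
have c22 : 9 * normsq (c (inord 2) (inord 2)) <= M.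
  by rewrite (Pm_coord22 eigen_t1_neq0 e) -size_sqE.
have pos i j := normsq_ge0 (c i j).
have b2 (j : 'I_3) : normsq (c (inord 2) j) <= M.
  rewrite -(inord_val j); have := pos (inord 2) (inord 0); have := pos (inord 2) (inord 1).
  have := pos (inord 2) (inord 2); case: j => [[|[|[|//]]] ?] /=; move: row c22; lra.
move=> i j; rewrite -(inord_val i).
have s1 : eig_sign t1 0 j <= 1 by rewrite sg_t1; case: ifP => _ //; lra.
have := b2 j; have := col j; have := pos (inord 0) j; have := pos (inord 1) j.
by case: i => [[|[|[|//]]] ?] /=; move: s1; lra.
Qed.

Lemma compact_size_sq M : compact [set g | SU_set H1 g /\ size_sq g <= M].
Proof.
have [B bB] := size_sq_entries M; apply: compact_mx bB.
apply: closedI; first exact: closed_SU.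
exact: (proj1 (continuous_closedP _) continuous_size_sq [set x | x <= M] (@closed_le R M)).
Qed.

End Diagonal.

(** * Finitely many integral matrices of bounded size *)

Lemma finite_int n : finite_set [set a : int | (`|a| <= n)%N].
Proof.
apply: (sub_finite_set _ (finite_image (fun k : nat => (k%:Z - n%:Z)%R) (finite_II n.*2.+1))).
move=> a /= an; exists (`|(a + n%:Z)%R|)%N; rewrite /= ?/II /=; lia.
Qed.

(** Such matrices are images of matrices of indices into a list of A, and these form a finite
    type. *)
Lemma finite_mx (T : nmodType) m n (A : set T) : finite_set A ->
  finite_set [set M : 'M[T]_(m, n) | forall i j, A (M i j)].
Proof.
move=> /finite_seqP[s sA].
have fin : finite_set (range (fun M : 'M['I_(size s).+1]_(m, n) => map_mx (fun k : 'I__ => nth 0 s k) M)).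
  by apply: finite_image; exact: finite_finset.
apply: (sub_finite_set _ fin) => M MA.
exists (\matrix_(i, j) inord (index (M i j) s)) => //.
apply/matrixP => i j; rewrite !mxE inordK; last by rewrite ltnS index_size.
by rewrite nth_index//; have := MA i j; rewrite sA.
Qed.

Lemma finite_E n : finite_set [set x : E int | [/\ (`|qre (qre x)| <= n)%N,
  (`|qim (qre x)| <= n)%N, (`|qre (qim x)| <= n)%N & (`|qim (qim x)| <= n)%N]].
Proof.
have f2 := finite_setX (finite_setX (finite_int n) (finite_int n)) (finite_setX (finite_int n) (finite_int n)).
apply: (sub_finite_set _ (finite_image (fun p : (int * int) * (int * int) =>
  (Quad (Quad p.1.1 p.1.2) (Quad p.2.1 p.2.2) : E int)) f2)).
by move=> [[a b] [c d]] /= [*]; exists ((a, b), (c, d)).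
Qed.

Section Finiteness.
Context {R : realType}.
Local Notation C := (Cplx R).
Local Notation u := (u : C).
Local Notation intf := (@intf R).
Local Notation t1 := (@emb_s4c R).
Local Notation t2 := (@emb_s4 R).

Lemma int_norm_bound (a : int) (B : R) : `|intf a| <= B%:C%C -> (`|a| <= Num.bound B)%N.
Proof.
rewrite /intf -intr_norm -abszE -pmulrn -(rmorph_nat (real_complex R)) lecR => h.
have B0 : 0 <= B by apply: le_trans h.
by have := archi_boundP B0 => /(le_lt_trans h); rewrite ltr_nat => /ltnW.
Qed.

(** Applied to 1 + 2 w and to the difference of the two roots of x^2 + x + 2, which are square roots
    of -3 and -7. *)
Lemma norm_ge1 (z : C) n : z ^+ 2 = - n.+1%:R -> 1 <= `|z|.
Proof.
move=> z2; rewrite -(expr_ge1 (n := 2))// -normrX z2 normrN normr_nat.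
by rewrite ler1n.
Qed.

(** The difference z - z^* is b sqrt(-3), which bounds b; then a = z - b u^6 is bounded too. *)
Lemma norm_pair (y : C) (a b : int) : let z := intf a + intf b * u ^+ 6 in
  `|z| <= y -> `|intf b| <= 2 * y /\ `|intf a| <= 3 * y.
Proof.
move=> z zy; have zc : z - z^* = intf b * (1 + 2 * u ^+ 6).
  rewrite /z; have := intf_conj (R := R) a; have := intf_conj (R := R) b; have := @u6_conj R.
  move: (intf a) (intf b) (u ^+ 6) => x v w wc vc xc.
  by rewrite rmorphD rmorphM /= wc vc xc; ring.
have w1 : `|u ^+ 6| = 1.
  apply/eqP; rewrite -sqrp_eq1// normCK u6_conj; apply/eqP; have := @u12 R.
  by rewrite expr2 => e; rewrite mulrBr mulrN e mulr1; ring.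
have w3 : 1 <= `|1 + 2 * u ^+ 6 : C|.
  apply: (@norm_ge1 _ 2); have w2 := @u12 R; move: (u ^+ 6) w2 => w w2; ring: w2.
have hb : `|intf b| <= 2 * y.
  apply: le_trans (_ : `|intf b| * `|1 + 2 * u ^+ 6| <= _); first by rewrite ler_peMr.
  rewrite -normrM -zc (le_trans (ler_normB _ _))// norm_conjC.
  by rewrite mulr2n mulrDl mul1r lerD.
split=> //; have -> : intf a = z - intf b * u ^+ 6 by rewrite /z addrK.
rewrite (le_trans (ler_normB _ _))// normrM w1 mulr1 (_ : 3 * y = y + 2 * y); last by ring.
exact: lerD.
Qed.

Lemma emb_norm (t : @embedding R) : `|emb t| <= 2.
Proof.
rewrite -(@ler_pXn2r _ 2)// ?nnegrE//; have -> : `|emb t| ^+ 2 = 2 :> C.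
  by rewrite normCK emb_conj; have e := emb_sqr t; ring: e.
by rewrite -natrX ler_nat.
Qed.

(** The difference of the two values is q times a square root of -7, which bounds q and then p;
    [norm_pair] bounds their integer coordinates. The constant 20 dominates the factors 15, 10, 6
    and 4 that arise. *)
Lemma E_bounded (x : E int) (B : C) : `|ev (intf) t1 x| <= B -> `|ev (intf) t2 x| <= B ->
  let b a := `|intf a| <= 20 * B in
  [/\ b (qre (qre x)), b (qim (qre x)), b (qre (qim x)) & b (qim (qim x))].
Proof.
rewrite !evE; set p := intf _ + intf _ * _; set q := intf _ + intf _ * _ => h1 h2.
have B0 : 0 <= B by apply: le_trans h1.
have dt : 1 <= `|emb t1 - emb t2|.
  apply: (@norm_ge1 _ 6).
  have e := @emb_sqr R t2; have [_ h _] := @sigma4_facts R.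
  by rewrite /= h; rewrite /= in e; ring: e.
have hq : `|q| <= 2 * B.
  apply: le_trans (_ : `|q| * `|emb t1 - emb t2| <= _); first by rewrite ler_peMr.
  rewrite -normrM mulrBr (_ : _ - _ = (p + q * emb t1) - (p + q * emb t2)); last by ring.
  by rewrite (le_trans (ler_normB _ _))// (_ : 2 * B = B + B) ?lerD//; ring.
have hp : `|p| <= 5 * B.
  rewrite (_ : p = (p + q * emb t1) - q * emb t1); last by rewrite addrK.
  rewrite (le_trans (ler_normB _ _))// normrM (_ : 5 * B = B + 2 * B * 2); last by ring.
  by rewrite lerD// ler_pM// emb_norm.
have [p1 p2] := norm_pair hp; have [q1 q2] := norm_pair hq.
have le20 (k : nat) (y : C) : (k <= 20)%N -> y <= k%:R * B -> y <= 20 * B.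
  by move=> k20 /le_trans; apply; rewrite ler_wpM2r// ler_nat.
split.
- by apply: (@le20 15%N) => //; move: p2; rewrite mulrA -natrM.
- by apply: (@le20 10%N) => //; move: p1; rewrite mulrA -natrM.
- by apply: (@le20 6%N) => //; move: q2; rewrite mulrA -natrM.
- by apply: (@le20 4%N) => //; move: q1; rewrite mulrA -natrM.
Qed.

(** As |u| = 1, neither the scalar nor the diagonal conjugation changes the modulus of an entry. *)
Lemma norm_lift (T : Type) (f : T -> C) k (M : 'M[T]_3) i j :
  `|(u ^+ k *: conjD (map_mx f M)) i j| = `|f (M i j)|.
Proof.
have u1 : `|u| = 1 by apply/eqP; rewrite -(sqrp_eq1 (normr_ge0 _)) normCK u_conj -exprS u9.
by rewrite mxE DmE mxE !normrM !normrX u1 !expr1n !mul1r mulr1.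
Qed.

(** The bound x controls Y at the first embedding, and [SU2_bounded] controls it at the second for
    every g; so Y has bounded integer coordinates, and the exponent may be taken below 9. *)
Lemma finite_lifted (x : C) : finite_set [set g | lifted g /\ forall i j, `|g i j| <= x].
Proof.
have [B bB] := @SU2_bounded R.
pose n := Num.bound (20 * (complex.Re x + B)).
have fin := finite_image (fun p : nat * 'M[E int]_3 => u ^+ p.1 *: conjD (map_mx (ev intf t1) p.2))
  (finite_setX (finite_II 9) (finite_mx 3 3 (finite_E n))).
apply: (sub_finite_set _ fin) => g [[k /lifted_at_mod]] [g2 [Y [Y' [[_ S2] gE g2E _ _]]]] gx.
exists ((k %% 9)%N, Y); last exact: esym gE.
split; first by rewrite /= ltn_pmod.
move=> i j /=.
have x0 : 0 <= x by apply: le_trans (gx i j).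
have B0 : 0 <= (B%:C%C : C) by apply: le_trans (bB g2 i j S2).
have e1 : `|ev intf t1 (Y i j)| <= x + B%:C%C.
  by rewrite -(norm_lift (ev intf t1) (k %% 9) Y) -gE (le_trans (gx i j))// lerDl.
have e2 : `|ev intf t2 (Y i j)| <= x + B%:C%C.
  by rewrite -(norm_lift (ev intf t2) (k %% 9) Y) -g2E (le_trans (bB _ i j S2))// lerDr.
have bE : 20 * (x + B%:C%C) = (20 * (complex.Re x + B))%:C%C :> C.
  by rewrite {1}(ge0_complexE x0) -(rmorph_nat (real_complex R) 20) -rmorphD -rmorphM.
have [h1 h2 h3 h4] := E_bounded e1 e2; rewrite bE in h1 h2 h3 h4.
by split; exact: int_norm_bound.
Qed.

End Finiteness.

(** Elements of A are given labels in a finite set; two elements with a common label differ by an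
    element of B, so each label belongs to at most one coset. *)
Lemma finite_index_classes (F : fieldType) n (A B : set 'M[F]_n) (I : Type)
    (D : set I) (r : 'M[F]_n -> I -> Prop) :
  A `<=` [set a | a \in unitmx] -> (forall b c, B b -> B c -> B (b *m c)) ->
  finite_set D -> (forall a, A a -> exists2 i, D i & r a i) ->
  (forall a c i, A a -> A c -> r a i -> r c i -> B (invmx a *m c)) ->
  finite_index B A.
Proof.
move=> AU BM fD Ar rB.
pose X i := [set [set a *m b | b in B] | a in [set a | A a /\ r a i]].
apply: (sub_finite_set (B := \bigcup_(i in D) X i)).
  by move=> _ [a Aa <-]; have [i Di ri] := Ar _ Aa; exists i => //; exists a.
apply: bigcup_finite => // i _.
have [e|/set0P[a [Aa ra]]] := eqVneq [set a | A a /\ r a i] set0.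
  by rewrite /X e image_set0.
apply: (sub_finite_set _ (finite_set1 [set a *m b | b in B])) => _ [c [Ac rc] <-] /=.
have sub x y : A x -> A y -> r x i -> r y i -> [set x *m b | b in B] `<=` [set y *m b | b in B].
  move=> Ax Ay rx ry _ [b Bb <-]; exists (invmx y *m x *m b).
    by apply: BM => //; exact: rB ry rx.
  by rewrite !mulmxA mulmxV ?mul1mx//; exact: AU.
by apply/seteqP; split; apply: sub.
Qed.

(** * Commensurability and the compact kernel *)

Section Arithmetic.
Context {R : realType}.
Local Notation C := (Cplx R).
Local Notation m := ((3 + 3) + (3 + 3))%N.
Local Notation intf := (@intf R).
Local Notation intR := (intr : {rmorphism int -> R}).
Local Notation realf := (@realf R).
Local Notation t1 := (@emb_s4c R).
Local Notation t2 := (@emb_s4 R).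
Local Notation H1 := (Hmx psi3 (emb t1)).
Local Notation H2 := (Hmx psi3 (emb t2)).
Local Notation Gam := (triangle_group psi3 (emb t1)).

Lemma ev_emap t x : ev realf t (emap intR x) = ev intf t x.
Proof.
have e a : realf (intR a) = intf a by rewrite /intf rmorph_int.
by rewrite !evE /= -!e.
Qed.

Lemma phi_int t (Y : 'M[E int]_3) : phi t (map_mx intR (resE Y)) = conjD (map_mx (ev intf t) Y).
Proof.
rewrite phiE map_resE resEK -map_mx_comp; congr conjD.
by apply: eq_map_mx => x; exact: ev_emap.
Qed.

Lemma int_closed (Y : 'M[E int]_3) :
  map_mx intR (resE Y) = resE (unresE (map_mx intR (resE Y))).
Proof. by rewrite map_resE resEK. Qed.

Lemma Psi_int (Y : 'M[E int]_3) :
  Psi (conjD (map_mx (ev intf t1) Y)) (conjD (map_mx (ev intf t2) Y)) = map_mx intR (resE Y).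
Proof.
apply: phi_inj; [exact: PsiE|exact: int_closed| |].
- exact: etrans (phi1_Psi _ _) (esym (phi_int _ _)).
- exact: etrans (phi2_Psi _ _) (esym (phi_int _ _)).
Qed.

Lemma Psi_phi (X : 'M[R]_m) : X = resE (unresE X) -> Psi (phi t1 X) (phi t2 X) = X.
Proof.
move=> hX; apply: phi_inj; [exact: PsiE|exact: hX|exact: phi1_Psi|exact: phi2_Psi].
Qed.

Lemma int_resE (x : 'M[int]_m) : map_mx intR x = resE (unresE (map_mx intR x)) ->
  x = resE (unresE x).
Proof.
rewrite -map_unresE -map_resE => /matrixP h; apply/matrixP => i j.
have := h i j; rewrite [LHS]mxE [RHS]mxE => /eqP; rewrite /= eqr_int => /eqP; exact.
Qed.

(** With exponent 0 a lifted g and its conjugate come from one integral matrix Y, so [Psi] sends the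
    pair to an integral point. Conversely, an integral point and its inverse supply Y and Y'. *)
Lemma lifted0E : lifted_at 0 =
  phi t1 @` (@integral_points R m SU_equations `&` S0) :> set 'M[C]_3.
Proof.
apply/seteqP; split => [g|_ [X [[XP [x xU xE]] XS] <-]].
- move=> [g2 [Y [Y' [_ gE g2E YY gS]]]]; move: gE g2E; rewrite expr0 !scale1r => gE g2E.
  have gP : Psi g g2 = map_mx intR (resE Y) by rewrite gE g2E; exact: Psi_int.
  rewrite gP in gS.
  exists (map_mx intR (resE Y)); last exact: etrans (phi_int t1 Y) (esym gE).
  split; last exact: gS.
  split; first exact: connected_component_sub gS.
  exists (resE Y); last by [].
  have rY : resE Y *m resE Y' = 1%:M by rewrite -resEM YY resE1.
  exact: proj1 (mulmx1_unit rY).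
- have [GU1 GUM GUU GUV] := points_group R.
  have [Xc s1 s2] := proj1 (pointsRP X) XP.
  have xV : invmx X = map_mx intR (invmx x).
    by apply: invmx_eq; rewrite -xE -map_mxM mulmxV// map_mx1.
  have [Vc _ _] := proj1 (pointsRP _) (GUV _ XP).
  rewrite xV in Vc; have e' := int_resE Vc.
  rewrite -xE in Xc; have e := int_resE Xc.
  exists (phi t2 X), (unresE x), (unresE (invmx x)); rewrite expr0 !scale1r; split.
  + by split; [exact: s1|exact: s2].
  + by rewrite -xE {1}e; exact: phi_int.
  + by rewrite -xE {1}e; exact: phi_int.
  + have rY : resE (unresE x *m unresE (invmx x)) = 1%:M.
      by rewrite resEM -e -e'; exact: mulmxV.
    exact: etrans (esym (resEK _)) (etrans (congr1 unresE (etrans rY (esym (resE1 _)))) (resEK _)).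
  + rewrite Psi_phi; first exact: XS.
    by rewrite -xE; exact: Xc.
Qed.
Lemma commensurable_triangle :
  commensurable Gam (phi t1 @` (@integral_points R m SU_equations `&` S0)).
Proof.
have [_ GM GU GV] := mxgroupP Gam; have [_ LM LU LV] := @lifted_group R.
rewrite -lifted0E.
have M0 (x y : 'M[C]_3) : lifted_at 0 x -> lifted_at 0 y -> lifted_at 0 (x *m y) by exact: lifted_atM.
have V0 (x : 'M[C]_3) : lifted_at 0 x -> lifted_at 0 (invmx x) by exact: lifted_atV.
have L0 : (lifted_at 0 : set 'M[C]_3) `<=` lifted by move=> x; exists 0%N.
have IM x y : (Gam `&` lifted_at 0) x -> (Gam `&` lifted_at 0) y -> (Gam `&` lifted_at 0) (x *m y).
  by move=> [x1 x2] [y1 y2]; split; [exact: GM|exact: M0].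
split.
(* For the triangle group the label is the exponent of u modulo 9. *)
- apply: (@finite_index_classes _ _ _ _ nat `I_9 (fun a k => lifted_at k a)).
  + exact: GU.
  + exact: IM.
  + exact: finite_II.
  + move=> a /triangle_lifted[k /lifted_at_mod ka]; exists (k %% 9)%N; last exact: ka.
    by rewrite /= ltn_pmod.
  + move=> a c k Ga Gc ak ck; split; first exact: GM _ _ (GV _ Ga) Gc.
    have := lifted_at_mod (lifted_atM (lifted_atV ak) ck).
    by rewrite addnC -mulSn modnMr.
- have [B bB] := size_sq_entries (R := R) 900.
  have SUlift g : lifted g -> SU_set H1 g by move=> [k [g2 [Y [Y' [[]]]]]].
  pose D := [set k : 'M[C]_3 | lifted k /\ size_sq k <= 900].
  have fD : finite_set D.
    apply: (sub_finite_set _ (finite_lifted (B%:C%C : C))) => k [Lk sk].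
    split; first exact: Lk.
    by move=> i j; apply: bB; split; [exact: SUlift|exact: sk].
  (* The label of a is a reduced element k = g a^-1 with g in the triangle group; if also k = h
     c^-1, then a^-1 c = g^-1 h. The inverse enters because the descent multiplies on the left while
     the cosets are a B. *)
  apply: (@finite_index_classes _ _ _ _ _ D
    (fun a k => exists2 g, (Gam : set _) g & k = g *m invmx a)).
  + by move=> a /L0; exact: LU.
  + exact: IM.
  + exact: fD.
  + move=> a /L0 La; have [_ _ _ SV] := SU_group H1.
    have [g Gg gb] := size_bounded (SV _ (SUlift _ La)).
    exists (g *m invmx a); last by exists g.
    split; last exact: gb.
    by apply: LM; [exact: triangle_lifted|exact: LV].
  + move=> a c k La Lc [g Gg ->] [h Gh e]; split; last exact: M0 _ _ (V0 _ La) Lc.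
    suff -> : invmx a *m c = invmx g *m h by exact: GM _ _ (GV _ Gg) Gh.
    have cU := LU _ (L0 _ Lc).
    have -> : h = g *m invmx a *m c by rewrite e mulmxKV.
    by rewrite !mulmxA mulVmx ?mul1mx; [|exact: GU].
Qed.

(** An element of the kernel is determined by its second component, so the kernel is a closed part
    of the image of the compact group SU(H2). *)
Lemma compact_kernel : compact (S0 `&` [set X | phi t1 X = 1%:M]).
Proof.
have cPsi : continuous (fun g : 'M[C]_3 => Psi 1%:M g).
  by apply: continuous_Psi => [x|x]; [exact: cst_continuous|exact: cvg_id].
have cS0 : closed (@S0 R) by apply: component_closed; exact: closed_points.
have cK : closed [set X : 'M[R]_m | phi t1 X = 1%:M].
  apply: closed_eq_mx; first exact: continuous_phi.
  by move=> x; exact: cst_continuous.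
have cI : compact ((fun g => Psi 1%:M g) @` SU_set H2).
  apply: continuous_compact; last exact: compact_SU2.
  apply: continuous_subspaceT; exact: cPsi.
apply: (subclosed_compact _ cI); first exact: closedI.
move=> X [XS X1]; have [Xc _ s2] := proj1 (pointsRP X) (connected_component_sub XS).
exists (phi t2 X); first exact: s2.
by rewrite -X1; exact: Psi_phi.
Qed.

Lemma arithmetic_triangle : arithmetic_subgroup (SU H1) Gam.
Proof.
exists m, SU_equations, (phi t1); split.
- exact: points_group.
- apply: continuous_subspaceT; exact: continuous_phi.
- split=> [X XS|X Y XS YS].
    by have [_ h _] := proj1 (pointsRP X) (connected_component_sub XS); exact: h.
  have [Xc _ _] := proj1 (pointsRP X) (connected_component_sub XS).
  have [Yc _ _] := proj1 (pointsRP Y) (connected_component_sub YS).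
  exact (phiM t1 Xc Yc).
- exact: compact_kernel.
- exact: commensurable_triangle.
Qed.

Lemma H1_unit : H1 \in unitmx.
Proof.
have e := Pm_diag (eigen_t1_neq0 (R := R)).
have DD : diag_mx (map_mx (real_complex R) (eig_sign t1)) *m diag_mx (map_mx (real_complex R) (eig_sign t1)) = 1%:M.
  apply/matrixP => k l; rewrite mul_diag_mx [LHS]mxE mxE [diag_mx _ _ _]mxE [map_mx _ _ _ _]mxE sg_t1 [RHS]mxE.
  by case: eqP => [->|_]; rewrite ?mulr0// !mulr1n; case: ifP => _; rewrite -rmorphM ?mulrNN mulr1 rmorph1.
have : (Pm t1) ^t* *m H1 *m Pm t1 \in unitmx by rewrite e; have [] := mulmx1_unit DD.
by rewrite !unitmx_mul => /andP[/andP[]].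
Qed.

Lemma cocompact_lattice_triangle : lattice (SU H1) Gam /\ cocompact (SU H1) Gam.
Proof.
(* Solving g^* H1 g = H1 for the inverse gives a formula that is continuous on all matrices. *)
pose cinv (g : 'M[C]_3) := invmx H1 *m g ^t* *m H1.
have sub : Gam `<=` SU H1 by move=> g; exact: triangle_SU.
have fin x : finite_set [set g | (Gam : set _) g /\ forall i j, `|g i j| <= x].
  apply: (sub_finite_set _ (finite_lifted x)) => g [Gg gx].
  by split; [exact: triangle_lifted|exact: gx].
have cc : continuous cinv.
  apply: continuous_mulmx; last by move=> x; exact: cst_continuous.
  apply: continuous_mulmx; first by move=> x; exact: cst_continuous.
  rewrite (_ : (fun=> _) = fun g : 'M[C]_3 => (map_mx Num.conj g)^T).
    by apply: continuous_conj_mx => x; exact: cvg_id.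
  by apply/funext => g; rewrite map_trmx.
have ccE g : (SU H1 : set _) g -> cinv g = invmx g.
  move=> [gH _]; apply/esym/invmx_eq/mulmx1C.
  by rewrite /cinv -!mulmxA (mulmxA (g ^t*)) gH mulVmx// H1_unit.
split.
- exact: (lattice_Gam sub fin (continuous_size_sq (R := R)) (@compact_size_sq R) (@size_bounded R) cc ccE).
- apply: (cocompact_Gam sub (@compact_size_sq R) (@size_bounded R)).
Qed.
End Arithmetic.

Theorem theorem1p1 (R : realType) :
  let psi : R := 2 * pi / 3 in
  let tau : Cplx R := sigma4^* in
  has_signature (p := 2) (q := 1) (Hmx psi tau) /\
  cocompact_arithmetic_lattice (SU (Hmx psi tau)) (triangle_group psi tau).
Proof.
split; first exact: signature_H1.
have [lat coc] := @cocompact_lattice_triangle R.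
split; [exact: lat|exact: coc|exact: arithmetic_triangle].
Qed.
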